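(* Let $p$ be a prime and $r\ge 0$ an integer. Suppose $(\mathbb{Z}_p)^r$ acts cellularly and freely on a connected finite CW-complex $X$. Then the orbit space $X/(\mathbb{Z}_p)^r$ is a mod-$p$ homology rose if and only if $X$ is a mod-$p$ homology rose.
   Context: $\mathbb{Z}_p=\mathbb{F}_p=\mathbb{Z}/p\mathbb{Z}$. A group acts cellularly on a CW-complex $X$ if it acts by homeomorphisms of $X$ that map each cell homeomorphically to another cell. A mod-$p$ homology rose with $m$ petals ($m\geq 1$ an integer) is a topological space $B$ with $H_*(B;\mathbb{F}_p)\cong H_*(\bigvee_m S^1;\mathbb{F}_p)$, where $\bigvee_m S^1$ is a bouquet of $m$ circles. A mod-$p$ homology rose is a mod-$p$ homology rose with $m$ petals for some $m\ge 1$. *)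

(* Defs.v *)
From HB Require Import structures.
From mathcomp Require Import all_boot all_order all_algebra all_fingroup.
From mathcomp Require Import generic_quotient ring_quotient freeg.
From mathcomp Require Import all_classical all_reals all_analysis wedge_sigT.
Import Order.TTheory GRing.Theory Num.Theory numFieldNormedType.Exports.

Set Implicit Arguments.
Unset Strict Implicit.
Unset Printing Implicit Defensive.

Local Open Scope quotient_scope.
Local Open Scope classical_set_scope.
Local Open Scope ring_scope.

(* Euclidean disks; in dimension 0 the open disk is the point and the sphere is
   empty. The library norm on row vectors is the sup norm, hence sqnorm. *)

Definition sqnorm (R : realType) (n : nat) (x : 'rV[R]_n) : R :=
  \sum_(j < n) x 0 j ^+ 2.

Definition closed_disk (R : realType) (n : nat) : set 'rV[R]_n :=
  [set x | sqnorm x <= 1].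

Definition open_disk (R : realType) (n : nat) : set 'rV[R]_n :=
  [set x | sqnorm x < 1].

Definition unit_sphere (R : realType) (n : nat) : set 'rV[R]_n :=
  [set x | sqnorm x = 1].

Arguments closed_disk : clear implicits.
Arguments open_disk : clear implicits.
Arguments unit_sphere : clear implicits.

Unset Implicit Arguments.

(* I indexes the cells. A characteristic map is a total function on R^n of which
   only the values on the closed disk matter. *)
Record cw_complex (R : realType) (X : topologicalType) (I : Type) := CWComplex {
  cell_dim : I -> nat;
  char_map : forall i : I, 'rV[R]_(cell_dim i) -> X;
  open_cell := fun i : I => char_map i @` open_disk R (cell_dim i);
  cw_hausdorff : hausdorff_space X;
  cw_continuous : forall i,
    {within closed_disk R (cell_dim i), continuous (char_map i)};
  (* char_map i is a homeomorphism from the open disk onto open_cell i *)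
  cw_inj : forall i, set_inj (open_disk R (cell_dim i)) (char_map i);
  cw_open : forall i (U : set 'rV[R]_(cell_dim i)), open U ->
    exists2 V : set X, open V &
      char_map i @` (open_disk R (cell_dim i) `&` U) = open_cell i `&` V;
  cw_cover : \bigcup_i open_cell i = [set: X];
  cw_disjoint : trivIset [set: I] open_cell;
  cw_closure_finite : forall i, exists J : set I,
    [/\ finite_set J,
        (forall j, J j -> (cell_dim j < cell_dim i)%N)
      & char_map i @` unit_sphere R (cell_dim i) `<=`
          \bigcup_(j in J) open_cell j];
  cw_weak_topology : forall A : set X,
    (forall i, closed (closed_disk R (cell_dim i) `&` char_map i @^-1` A)) ->
    closed A
}.

Arguments cell_dim {R X I} c i.
Arguments char_map {R X I} c i.
Arguments open_cell {R X I} c i.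

Set Implicit Arguments.

Section Action.
Context (gT : finGroupType) (X : topologicalType) (to : {action gT &-> X}).

Definition acts_by_homeomorphisms := forall g : gT, continuous (to^~ g).

Definition acts_freely := forall (g : gT) (x : X), to x g = x -> g = 1%g.

(* Since the group acts by homeomorphisms, to^~ g restricts to a homeomorphism
   from open_cell i onto its image open_cell j. *)
Definition acts_cellularly (R : realType) (I : Type) (C : cw_complex R X I) :=
  acts_by_homeomorphisms /\
  forall (g : gT) (i : I), exists j : I,
    to^~ g @` open_cell C i = open_cell C j.

Definition orbit_rel : rel X := fun x y => [exists g : gT, to x g == y].

Lemma total_actM x g h : to x (g * h)%g = to (to x g) h.
Proof. by case: to => f [/= _ fM]; rewrite fM ?inE. Qed.

Lemma total_act1 x : to x 1%g = x.
Proof.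
have: to (to x 1%g) 1%g = to x 1%g by rewrite -total_actM mulg1.
by case: to => f [/= finj _] /finj.
Qed.

Lemma orbit_rel_refl : reflexive orbit_rel.
Proof. by move=> x; apply/existsP; exists 1%g; rewrite total_act1. Qed.

Lemma orbit_rel_sym : symmetric orbit_rel.
Proof.
have sub x y : orbit_rel x y -> orbit_rel y x.
  case/existsP => g /eqP <-; apply/existsP; exists g^-1%g.
  by rewrite -total_actM mulgV total_act1.
by move=> x y; apply/idP/idP; exact: sub.
Qed.

Lemma orbit_rel_trans : transitive orbit_rel.
Proof.
move=> y x z /existsP[g /eqP <-] /existsP[h /eqP <-].
by apply/existsP; exists (g * h)%g; rewrite total_actM.
Qed.

Canonical orbit_equiv :=
  EquivRel orbit_rel orbit_rel_refl orbit_rel_sym orbit_rel_trans.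

Definition orbit_space := quotient_topology {eq_quot orbit_equiv}.

HB.instance Definition _ := Topological.on orbit_space.

End Action.

Section SingularHomology.
Context (R : realType) (K : nzRingType).

Definition std_simplex (n : nat) : set 'rV[R]_n.+1 :=
  [set t | (forall j, 0 <= t 0 j) /\ \sum_(j < n.+1) t 0 j = 1].

Arguments std_simplex : clear implicits.

Definition coface_row (n : nat) (i : 'I_n.+2) (t : 'rV[R]_n.+1) : 'rV[R]_n.+2 :=
  \row_j oapp (t 0) 0 (unlift i j).

Lemma coface_row_simplex n i (t : std_simplex n) :
  coface_row i (set_val t) \in std_simplex n.+1.
Proof.
have [t0 t1] := set_mem (valP t); apply/mem_set; split=> [j|].
  by rewrite mxE; case: unliftP => [k|] _ //=; exact: t0.
rewrite (bigD1_ord i) //= mxE unlift_none /= add0r -[RHS]t1.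
by apply: eq_bigr => k _; rewrite mxE liftK.
Qed.

Definition coface (n : nat) (i : 'I_n.+2) (t : std_simplex n) :
  std_simplex n.+1 :=
  @exist _ _ (coface_row i (set_val t)) (coface_row_simplex i t).

Lemma coface_continuous n (i : 'I_n.+2) : continuous (coface i).
Proof.
suff cf : continuous (coface_row i).
  apply: (@continuous_comp_initial _ _ _ set_val) => t.
  apply: (@continuous_comp _ _ _ set_val (coface_row i)); last exact: cf.
  exact: initial_continuous.
move=> t A [P nP sPA].
have FF : Filter (nbhs t) by apply: nbhs_filter.
suff cf a b : \forall u \near t, P a b (coface_row i u a b).
  have := filter_forall FF (fun ab => cf ab.1 ab.2).
  move=> Q; change (nbhs t (coface_row i @^-1` A)); apply: filterS Q => u Pu.
  by apply: sPA => a b; exact: (Pu (a, b)).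
move: (nP a b); rewrite (ord1 a) mxE.
case: (unliftP i b) => [k|] eb /= nPb.
- have Q : nbhs t ((fun u : 'rV[R]_n.+1 => u 0 k) @^-1` P 0 b).
    exact: (@coord_continuous R 1 n.+1 0 k t).
  by apply: filterS Q => u /=; rewrite mxE eb liftK.
- apply: (@filterE _ _ FF) => u; rewrite mxE {2}eb unlift_none /=.
  exact: (@nbhs_singleton R 0 _ nPb).
Qed.

HB.instance Definition _ n (i : 'I_n.+2) :=
  isContinuous.Build _ _ (coface i) (@coface_continuous n i).

Definition singular_simplex (X : topologicalType) (n : nat) :=
  continuousType (std_simplex n) X.

HB.instance Definition _ X n := Choice.on (singular_simplex X n).

Definition face (X : topologicalType) (n : nat) (i : 'I_n.+2)
  (s : singular_simplex X n.+1) : singular_simplex X n := s \o coface i.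

Definition chain (X : topologicalType) (n : nat) :=
  {freeg (singular_simplex X n) / K}.

HB.instance Definition _ X n := GRing.Lmodule.on (chain X n).

Definition boundary (X : topologicalType) (n : nat) :
    chain X n.+1 -> chain X n :=
  fglift (fun s => \sum_(i < n.+2) << (-1) ^+ i *g face i s >>).

Lemma boundary_is_zmod_morphism X n : zmod_morphism (@boundary X n).
Proof. exact: lift_is_additive. Qed.

HB.instance Definition _ X n :=
  GRing.isZmodMorphism.Build (chain X n.+1) (chain X n) (@boundary X n)
    (@boundary_is_zmod_morphism X n).

(* Every 0-chain is a cycle: the homology is not reduced. *)
Definition is_cycle (X : topologicalType) (n : nat) : chain X n -> bool :=
  match n with
  | 0 => fun _ => true
  | m.+1 => fun c => boundary c == 0
  end.

Lemma is_cycle_zmod_closed X n : zmod_closed (@is_cycle X n).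
Proof.
case: n => [|n]; split=> //.
  by rewrite unfold_in /= raddf0.
move=> c d; rewrite !unfold_in /= => /eqP c0 /eqP d0.
by rewrite raddfB /= c0 d0 subr0.
Qed.

HB.instance Definition _ X n :=
  GRing.isZmodClosed.Build (chain X n) (@is_cycle X n)
    (@is_cycle_zmod_closed X n).

Record cycle (X : topologicalType) (n : nat) := Cycle {
  cycle_val :> chain X n;
  _ : cycle_val \in @is_cycle X n
}.

HB.instance Definition _ X n := [isSub for @cycle_val X n].
HB.instance Definition _ X n := [Choice of cycle X n by <:].
HB.instance Definition _ X n :=
  [SubChoice_isSubZmodule of cycle X n by <:].

Definition is_boundary (X : topologicalType) (n : nat) (z : cycle X n) : bool :=
  `[< exists c : chain X n.+1, boundary c = z >].

Lemma is_boundary_zmod_closed X n : zmod_closed (@is_boundary X n).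
Proof.
split=> [|y z]; rewrite !unfold_in /is_boundary.
  by apply/asboolP; exists 0; rewrite !raddf0.
move=> /asboolP[c cy] /asboolP[d dz]; apply/asboolP; exists (c - d).
by rewrite !raddfB /= cy dz.
Qed.

HB.instance Definition _ X n :=
  GRing.isZmodClosed.Build (cycle X n) (@is_boundary X n)
    (@is_boundary_zmod_closed X n).

Definition homology (X : topologicalType) (n : nat) : zmodType :=
  Quotient.quot (GRing.ZmodClosed.clone (cycle X n) (@is_boundary X n) _).

End SingularHomology.

Section HomologyRose.
Context (R : realType).

Definition circle : topologicalType := set_type (unit_sphere R 2).

Lemma circle_base_subproof : delta_mx 0 0 \in unit_sphere R 2.
Proof.
apply/mem_set; rewrite /unit_sphere /= /sqnorm !big_ord_recl big_ord0 !mxE /=.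
by rewrite expr1n expr0n /= !addr0.
Qed.

Definition circle_base : circle := @exist _ _ (delta_mx 0 0) circle_base_subproof.

Definition bouquet (m : nat) : topologicalType :=
  wedge (fun _ : 'I_m => circle_base).

(* H_*(B; F_p) is isomorphic to H_*(bouquet m; F_p) in each degree; an additive
   map between F_p-vector spaces is F_p-linear. *)
Definition homology_rose_with (p m : nat) (B : topologicalType) :=
  (0 < m)%N /\
  forall n : nat, exists f :
    {additive homology R 'F_p B n -> homology R 'F_p (bouquet m) n}, bijective f.

Definition homology_rose (p : nat) (B : topologicalType) :=
  exists m : nat, homology_rose_with p m B.

End HomologyRose.

(* Main.v *)
(* A nonempty space whose points are joined by 1-chains is a mod-p homology rose
   iff its H_1(-; F_p) is finite and nonzero and its higher homology vanishes: a
   finite group killed by p is F_p^m, and the homology of the bouquet of m circles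
   comes from Mayer-Vietoris for the complement of the base point and the
   complement of the points antipodal to it.

   Let G = (Z_p)^r. After subdivision every chain of X/G lifts, so the transfer
   identifies the homology of X/G with that of the G-invariant chains of X. The
   comparison of the G-invariant chains with all chains is Smith theory for one
   basis vector g of G at a time. Put tau = g - 1 and N = 1 + g + ... + g^(p-1);
   on a complex D of chains with free g-action ker tau = im N and ker N = im tau.
   The filtration of D by the ker tau^j shows that vanishing and finiteness of
   homology pass from ker tau to D. Conversely let H_n(D) = 0 for all n >= k. The
   connecting maps H_n(ker tau) -> H_(n+1)(ker N) -> H_(n+2)(ker tau) -> ... are
   then injective. Cover X by M invariant open sets over which the action is a product; an
   application of the connecting map lets a cycle avoid one more of these sets,
   so H_n(ker tau) = 0 for n >= k. For k = 2 this also embeds H_1(ker tau) in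
   H_1(D). *)

Require Import Defs.
From HB Require Import structures.
From mathcomp Require Import all_boot all_order all_algebra all_fingroup.
From mathcomp Require Import generic_quotient ring_quotient freeg.
From mathcomp Require Import all_classical all_reals all_analysis wedge_sigT zify lra ring.

Set Implicit Arguments.
Unset Strict Implicit.
Unset Printing Implicit Defensive.

Import Order.TTheory GRing.Theory Num.Theory numFieldNormedType.Exports.

Local Open Scope classical_set_scope.
Local Open Scope ring_scope.

(** To contract the periodic sequence of tau and N one must choose an origin in every orbit. Over a
    product set this can be done continuously, but in general not over all of X. The contraction is
    therefore no chain map: it commutes with the boundary only on simplices inside the set for which
    its origins were chosen. On a cycle u the defect is minus the boundary of the contracted u, that
    is, the usual degree-lowering connecting map up to sign; this is how each use of the connecting
    map disposes of one set, and why compactness of X is needed.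

    That H_1 is nonzero is transferred contrapositively, by the case k = 1 of the vanishing
    statement in one direction and by the filtration in the other. Finiteness is measured by the
    number of values of a map separating classes, not by dimension, because the choices made along
    the filtration are not additive.

    Averaging over G is impossible mod p, so invariant chains are compared with chains of X/G by
    selecting one simplex in each orbit. Covering space theory is replaced by local sections over
    small sets and subdivision. *)

Definition ctsmap (X Y : topologicalType) (f : X -> Y) (cf : continuous f) :
  continuousType X Y := HB.pack f (isContinuous.Build X Y f cf).

(** * Singular chains *)

Section LinearChains.
Variables (R : realType) (K : comNzRingType).
Implicit Types X Y : topologicalType.

Lemma chain_ind X n (P : chain R K X n -> Prop) :
  P 0 -> (forall k s c, P c -> P (k *: << s >> + c)) -> forall c, P c.
Proof.
move=> P0 PS; apply: freeg_ind_dom0 => // k s c _ _ Pc.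
suff -> : << k *g s >> = k *: << s >> :> chain R K X n by exact: PS.
by apply/eqP/freeg_eqP => t; rewrite coeffZ !coeffU mul1r.
Qed.

Section Extension.
Variables (X : topologicalType) (n : nat) (M : lmodType K).
Implicit Types (f : singular_simplex R X n -> M) (c : chain R K X n).

Definition lext f : chain R K X n -> M := fglift f.

Lemma lext_simplex f s : lext f << s >> = f s.
Proof. by rewrite /lext liftU scale1r. Qed.

Lemma lext_is_linear f : linear (lext f).
Proof.
have B c d : lext f (c - d) = lext f c - lext f d.
  exact: (@lift_is_additive _ _ _ f).
have L0 : lext f 0 = 0 by have := B 0 0; rewrite !subrr.
have LN e : lext f (- e) = - lext f e by have := B 0 e; rewrite L0 !sub0r.
have addl : {morph lext f : c d / c + d}.
  by move=> c d; have := B c (- d); rewrite LN !opprK.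
move=> k c d; rewrite addl; congr (_ + _).
elim/chain_ind: c => [|l s c IH].
  by rewrite scaler0 L0 scaler0.
rewrite scalerDr !addl IH scalerDr; congr (_ + _).
have E j : j *: << s >> = << j *g s >> :> chain R K X n.
  by apply/eqP/freeg_eqP => t; rewrite coeffZ !coeffU mul1r.
by rewrite scalerA !E /lext !liftU scalerA.
Qed.

HB.instance Definition _ f :=
  GRing.isLinear.Build K (chain R K X n) M _ (lext f) (@lext_is_linear f).

Lemma linear_ext (f g : {linear chain R K X n -> M}) :
  (forall s, f << s >> = g << s >>) -> f =1 g.
Proof.
move=> fg; elim/chain_ind => [|k s c IH]; first by rewrite !raddf0.
by rewrite !linearP fg IH.
Qed.

End Extension.

Lemma boundaryE X n :
  @boundary R K X n = lext (fun s => \sum_(i < n.+2) (-1) ^+ i *: << face i s >>).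
Proof.
apply/funext => c; congr (fglift _ c); apply/funext => s.
apply: eq_bigr => i _; apply/eqP/freeg_eqP => t.
by rewrite coeffZ !coeffU mul1r.
Qed.

Lemma boundary_scalable X n : scalable (@boundary R K X n).
Proof. by move=> k c; rewrite boundaryE linearZ. Qed.

HB.instance Definition _ X n := GRing.isScalable.Build K _ _ _ (@boundary R K X n)
  (@boundary_scalable X n).

Lemma boundary_simplex X n (s : singular_simplex R X n.+1) :
  boundary << s >> = \sum_(i < n.+2) (-1) ^+ i *: << face i s >> :> chain R K X n.
Proof. by rewrite boundaryE lext_simplex. Qed.

Lemma coface_inord n (i b : nat) (u : 'rV[R]_n.+1) :
  (i <= n.+1)%N -> (b <= n.+1)%N ->
  coface_row (inord i) u 0 (inord b) =
  if b == i then 0 else u 0 (inord (unbump i b)).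
Proof.
move=> lin lbn; rewrite mxE; case: unliftP => [c|] /(congr1 val) /=.
  rewrite !inordK ?ltnS // => ->.
  by rewrite eq_sym (negbTE (neq_bump _ _)) bumpK inord_val.
by rewrite !inordK ?ltnS // => ->; rewrite eqxx.
Qed.

(** The simplicial identity for iterated faces. The indices are natural numbers sent back by
    [inord], so that they pass between ordinal types of different sizes and the coordinate
    bookkeeping becomes linear arithmetic. *)
Lemma face_face X n (s : singular_simplex R X n.+2) (i j : nat) :
  (i <= j)%N -> (j <= n.+1)%N ->
  face (inord j : 'I_n.+2) (face (inord i : 'I_n.+3) s) =
  face (inord i : 'I_n.+2) (face (inord j.+1 : 'I_n.+3) s).
Proof.
move=> lij ljn; apply/continuousEP => t /=; congr (s _); apply/val_inj => /=.
apply/rowP => k; rewrite -[k]inord_val; have := ltn_ord k; rewrite ltnS => kn.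
rewrite coface_inord ?[RHS]coface_inord; try lia.
case: (eqVneq (k : nat) j.+1) => [->|kj] /=.
  have -> : (j.+1 == i) = false by lia.
  rewrite coface_inord /unbump; try lia.
  by have -> : (j.+1 - (i < j.+1) == j)%N by lia.
case: (eqVneq (k : nat) i) => [->|ki].
  rewrite coface_inord /unbump; try lia.
  by have -> : (i - (j.+1 < i) == i)%N by lia.
rewrite !coface_inord /unbump; try lia.
have -> : (k - (i < k) == j)%N = false by lia.
have -> : (k - (j.+1 < k) == i)%N = false by lia.
by congr (set_val t 0 (inord _)); lia.
Qed.

(** The terms (i, j) and (j+1, i), for i <= j, cancel in pairs. The induction splits off the last
    row and the last column, which cancel each other. *)
Lemma sum_simplicial_eq0 (V : zmodType) (F : nat -> nat -> V) n :
  (forall i j, (i <= j)%N -> (j <= n)%N -> F i j = - F j.+1 i) ->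
  \sum_(0 <= i < n.+2) \sum_(0 <= j < n.+1) F i j = 0.
Proof.
elim: n => [|n IH] Fan.
  by rewrite !big_nat_recr //= !big_geq // !add0r Fan // addNr.
rewrite big_nat_recr //=.
rewrite (eq_bigr (fun i => \sum_(0 <= j < n.+1) F i j + F i n.+1)); last first.
  by move=> i _; rewrite big_nat_recr.
rewrite big_split /= IH ?add0r; last by move=> i j lij ljn; exact: Fan (leqW ljn).
rewrite -big_split big_nat_cond big1 // => i /andP[/andP[_ lin] _].
by rewrite /= Fan // addNr.
Qed.

Lemma boundary_boundary X n (c : chain R K X n.+2) : boundary (boundary c) = 0.
Proof.
pose f : {linear chain R K X n.+2 -> chain R K X n} :=
  [the {linear _ -> _} of @boundary R K X n] \o
  [the {linear _ -> _} of @boundary R K X n.+1].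
pose z : {linear chain R K X n.+2 -> chain R K X n} := \0.
apply: (@linear_ext X n.+2 _ f z) => s /=.
rewrite boundary_simplex linear_sum /=.
under eq_bigr do rewrite linearZ /= boundary_simplex scaler_sumr.
pose F i j : chain R K X n := (-1) ^+ i *: ((-1) ^+ j *:
  << face (inord j : 'I_n.+2) (face (inord i : 'I_n.+3) s) >>).
have := @sum_simplicial_eq0 _ F n.+1; rewrite big_mkord => h.
rewrite -[RHS]h.
  apply: eq_bigr => i _; rewrite big_mkord; apply: eq_bigr => j _.
  by rewrite /F !inord_val.
move=> i j lij ljn; rewrite /F face_face // scalerA mulrC -scalerA.
by rewrite exprS mulN1r scaleNr opprK.
Qed.

End LinearChains.

(** * Push-forward of chains and supports *)

Section PushSupport.
Variables (R : realType) (K : comNzRingType).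
Implicit Types X Y Z : topologicalType.

Definition spush X Y n (f : continuousType X Y) (s : singular_simplex R X n) :
  singular_simplex R Y n := f \o s.

Arguments spush {X Y n} f s.

Definition push X Y n (f : continuousType X Y) :
    {linear chain R K X n -> chain R K Y n} :=
  [the {linear _ -> _} of lext (fun s => << spush f s >> : chain R K Y n)].

Arguments push {X Y n} f.

Lemma push_simplex X Y n (f : continuousType X Y) (s : singular_simplex R X n) :
  push f << s >> = << spush f s >>.
Proof. exact: lext_simplex. Qed.

Lemma boundary_push X Y n (f : continuousType X Y) (c : chain R K X n.+1) :
  boundary (push f c) = push f (boundary c).
Proof.
pose g : {linear chain R K X n.+1 -> chain R K Y n} :=
  [the {linear _ -> _} of @boundary R K Y n] \o push f.
pose h : {linear chain R K X n.+1 -> chain R K Y n} :=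
  push f \o [the {linear _ -> _} of @boundary R K X n].
apply: (linear_ext (f := g) (g := h)) => s /=.
rewrite push_simplex !boundary_simplex linear_sum; apply: eq_bigr => i _.
rewrite linearZ /= push_simplex; congr (_ *: << _ >>).
exact/continuousEP.
Qed.

Lemma push_comp X Y Z n (f : continuousType X Y) (g : continuousType Y Z)
    (h : continuousType X Z) (c : chain R K X n) :
  h =1 g \o f -> push g (push f c) = push h c.
Proof.
move=> hE; pose gf : {linear chain R K X n -> chain R K Z n} := push g \o push f.
apply: (linear_ext (f := gf) (g := push h)) => s /=.
rewrite !push_simplex; congr << _ >>; apply/continuousEP => t /=.
by rewrite hE.
Qed.

Lemma push_id X n (f : continuousType X X) (c : chain R K X n) :
  f =1 id -> push f c = c.
Proof.
move=> fE; apply: (linear_ext (f := push f) (g := [the {linear chain R K X n -> chain R K X n} of idfun])) => s /=.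
by rewrite push_simplex; congr << _ >>; apply/continuousEP => t /=; rewrite fE.
Qed.

(** The predicate bears on simplices rather than points, because it must also express smallness for
    a cover, liftability to X and mesh bounds. *)
Definition chain_in X n (P : singular_simplex R X n -> Prop) (c : chain R K X n) :=
  forall s, s \in dom c -> P s.

Section ChainIn.
Variables (X : topologicalType) (n : nat).
Implicit Types (P : singular_simplex R X n -> Prop) (c d : chain R K X n).

Lemma chain_in0 P : chain_in P 0.
Proof. by move=> s; rewrite dom0. Qed.

Lemma chain_inD P c d : chain_in P c -> chain_in P d -> chain_in P (c + d).
Proof.
by move=> Pc Pd s /domD_subset; rewrite mem_cat => /orP[/Pc|/Pd].
Qed.

Lemma chain_inZ P k c : chain_in P c -> chain_in P (k *: c).
Proof. by move=> Pc s /domZ_subset /Pc. Qed.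

Lemma chain_inN P c : chain_in P c -> chain_in P (- c).
Proof. by rewrite -scaleN1r; exact: chain_inZ. Qed.

Lemma chain_inB P c d : chain_in P c -> chain_in P d -> chain_in P (c - d).
Proof. by move=> Pc Pd; apply: chain_inD => //; exact: chain_inN. Qed.

Lemma chain_in_sum P (I : Type) (r : seq I) (Q : pred I) (F : I -> chain R K X n) :
  (forall i, Q i -> chain_in P (F i)) -> chain_in P (\sum_(i <- r | Q i) F i).
Proof.
move=> PF; elim/big_rec: _ => [|i x Qi]; first exact: chain_in0.
by apply: chain_inD; exact: PF.
Qed.

Lemma chain_in_simplex P s : P s -> chain_in P << s >>.
Proof. by move=> Ps t; rewrite domU1 inE => /eqP ->. Qed.

Lemma chain_in_sub P Q c : (forall s, P s -> Q s) -> chain_in P c -> chain_in Q c.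
Proof. by move=> PQ Pc s /Pc /PQ. Qed.

Lemma chain_in_and P Q c :
  chain_in P c -> chain_in Q c -> chain_in (fun s => P s /\ Q s) c.
Proof. by move=> Pc Qc s sc; split; [exact: Pc | exact: Qc]. Qed.

Lemma chain_sumE c : c = \sum_(s <- dom c) coeff s c *: << s >>.
Proof.
rewrite -[LHS]freeg_sumE; apply: eq_bigr => s _.
by apply/eqP/freeg_eqP => t; rewrite coeffZ !coeffU mul1r.
Qed.

Lemma linear_eq_in (M : lmodType K) (f g : {linear chain R K X n -> M}) P c :
  (forall s, P s -> f << s >> = g << s >>) -> chain_in P c -> f c = g c.
Proof.
move=> fg Pc; rewrite [c]chain_sumE !linear_sum; apply: eq_big_seq => s sc.
by rewrite !linearZ fg //; exact: Pc.
Qed.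

Lemma linear_eq0_in (M : lmodType K) (f : {linear chain R K X n -> M}) P c :
  (forall s, P s -> f << s >> = 0) -> chain_in P c -> f c = 0.
Proof. exact: (linear_eq_in (g := \0)). Qed.

Lemma chain_in_linear Y m (f : {linear chain R K X n -> chain R K Y m}) P Q c :
  (forall s, P s -> chain_in Q (f << s >>)) -> chain_in P c -> chain_in Q (f c).
Proof.
move=> fPQ Pc; rewrite [c]chain_sumE linear_sum big_seq.
have Qsum (I : Type) (r : seq I) (T : pred I) (F : I -> chain R K Y m) :
    (forall i, T i -> chain_in Q (F i)) -> chain_in Q (\sum_(i <- r | T i) F i).
  move=> QF; elim/big_rec: _ => [|i x Ti Qx]; first by move=> s; rewrite dom0.
  by move=> s /domD_subset; rewrite mem_cat => /orP[/(QF _ Ti)|/Qx].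
apply: Qsum => s /Pc /fPQ Qs; rewrite linearZ.
by move=> t /domZ_subset /Qs.
Qed.

End ChainIn.
Definition simplex_in X n (U : set X) (s : singular_simplex R X n) :=
  forall t, U (s t).

Lemma chain_in_boundary X n (P : forall m, singular_simplex R X m -> Prop)
    (c : chain R K X n.+1) :
  (forall s i, P n.+1 s -> P n (face i s)) ->
  chain_in (P n.+1) c -> chain_in (P n) (boundary c).
Proof.
move=> Pface; pose f : {linear _ -> _} := [the {linear _ -> _} of @boundary R K X n].
apply: (chain_in_linear (f := f)) => s Ps /=.
rewrite boundary_simplex; apply: chain_in_sum => i _.
by apply: chain_inZ; apply: chain_in_simplex; exact: Pface.
Qed.

Lemma boundary_in X n U (c : chain R K X n.+1) :
  chain_in (simplex_in U) c -> chain_in (simplex_in U) (boundary c).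
Proof.
by apply: (chain_in_boundary (P := fun m s => simplex_in U s)) => s i Us t /=.
Qed.

End PushSupport.

Arguments spush {R X Y n} f s.
Arguments push {R K X Y n} f.

(** * The standard simplex *)

Section SubspaceTopology.
Variables (T : topologicalType) (S : set T).

Lemma nbhs_set_val (x : S) (A : set S) :
  nbhs x A <-> exists2 B, nbhs (set_val x) B & set_val @^-1` B `<=` A.
Proof.
split; last first.
  move=> [B nB BA]; apply: filterS BA _.
  exact: (@initial_continuous _ _ set_val x).
rewrite nbhsE /= => -[_ [[B oB <-] Bx] BA].
by exists B => //; exists B.
Qed.

Lemma set_val_continuous_at (Z : topologicalType) (f : Z -> S) (z : Z) :
  {for z, continuous (set_val \o f)} -> {for z, continuous f}.
Proof.
move=> cf A /nbhs_set_val [B nB BA]; have := cf _ nB.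
by move=> h; apply: (@filterS _ (nbhs z) _ _ _ _ h) => w; exact: BA.
Qed.

Lemma set_type_compact : compact S -> compact [set: S].
Proof.
move=> /compact_near_coveringP cS; apply/compact_near_coveringP => I F P FF Pnear.
(* The proof of membership is quantified away, so that compactness of S inside T applies to a
   predicate on T. *)
pose P' i y := forall h : y \in S, P i (exist _ y h).
have : \forall i \near F, S `<=` P' i.
  apply: cS => y Sy.
  have [[U V] /= [nU FV] UV] := Pnear (exist _ y (mem_set Sy)) Logic.I.
  move/nbhs_set_val : nU => [B nB BU].
  exists (B, V) => //= -[z i] [/= Bz Vi] h.
  by apply: (UV (exist _ z h, i)); split => //; exact: BU.
by apply: filterS => i Pi -[y h] _; apply: Pi; exact: set_mem.
Qed.

End SubspaceTopology.

Lemma rV_continuous_at (R : realType) n (Z : topologicalType) (f : Z -> 'rV[R]_n)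
    (z : Z) :
  (forall j, {for z, continuous (fun w => f w 0 j)}) -> {for z, continuous f}.
Proof.
move=> cf A [P nP sPA].
have FF : Filter (nbhs z) by exact: nbhs_filter.
suff cP a b : \forall u \near z, P a b (f u a b).
  have := filter_forall FF (fun ab => cP ab.1 ab.2).
  move=> Q; change (nbhs z (f @^-1` A)); apply: filterS Q => u Pu.
  by apply: sPA => a b; exact: (Pu (a, b)).
by move: (nP a b); rewrite (ord1 a) => /(cf b).
Qed.

Section StandardSimplex.
Variable R : realType.
Implicit Types n : nat.
Local Notation simplex n := (@std_simplex R n).

Lemma simplex_ge0 n (t : simplex n) j : 0 <= set_val t 0 j.
Proof. by have [] := set_mem (valP t). Qed.

Lemma simplex_sum n (t : simplex n) : \sum_j set_val t 0 j = 1.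
Proof. by have [] := set_mem (valP t). Qed.

Lemma simplex_le1 n (t : simplex n) j : set_val t 0 j <= 1.
Proof.
rewrite -(simplex_sum t) (bigD1 j) //= lerDl.
by apply: sumr_ge0 => k _; exact: simplex_ge0.
Qed.

Lemma simplex_eqP n (t u : simplex n) :
  (forall j, set_val t 0 j = set_val u 0 j) -> t = u.
Proof. by move=> tu; apply/val_inj/rowP => j; exact: tu. Qed.

Definition mk_simplex n (x : 'rV[R]_n.+1) (x0 : forall j, 0 <= x 0 j)
    (x1 : \sum_j x 0 j = 1) : simplex n := exist _ x (mem_set (conj x0 x1)).

Lemma vertex_ge0 n (i j : 'I_n.+1) : 0 <= (delta_mx 0 i : 'rV[R]_n.+1) 0 j.
Proof. by rewrite !mxE eqxx /= ler0n. Qed.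

Lemma vertex_sum n (i : 'I_n.+1) : \sum_j (delta_mx 0 i : 'rV[R]_n.+1) 0 j = 1.
Proof.
rewrite (bigD1 i) //= big1 ?mxE ?eqxx ?addr0 // => j ji.
by rewrite !mxE eqxx (negbTE ji).
Qed.

Definition vertex n (i : 'I_n.+1) : simplex n :=
  mk_simplex (vertex_ge0 i) (vertex_sum i).

Lemma coord_simplex_continuous n (j : 'I_n.+1) :
  continuous (fun t : simplex n => set_val t 0 j).
Proof.
move=> t; apply: (@continuous_comp _ _ _ set_val (fun x : 'rV[R]_n.+1 => x 0 j)).
  exact: initial_continuous.
exact: coord_continuous.
Qed.

Lemma simplex_continuous_at n (Z : topologicalType) (f : Z -> simplex n) (z : Z) :
  (forall j, {for z, continuous (fun w => set_val (f w) 0 j)}) ->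
  {for z, continuous f}.
Proof. by move=> cf; apply: set_val_continuous_at; exact: rV_continuous_at. Qed.

Lemma sum_continuous_at (Z : topologicalType) (I : Type) (r : seq I)
    (f : I -> Z -> R) (z : Z) :
  (forall i, {for z, continuous (f i)}) ->
  {for z, continuous (fun w => \sum_(i <- r) f i w)}.
Proof.
move=> cf; elim: r => [|i r IH].
  rewrite /prop_for (_ : (fun w => _) = cst 0); first exact: cst_continuous.
  by apply/funext => w; rewrite big_nil.
rewrite /prop_for (_ : (fun w => _) = f i \+ (fun w => \sum_(i <- r) f i w)).
  exact: continuousD.
by apply/funext => w; rewrite big_cons.
Qed.

Lemma compact_simplex n : compact [set: simplex n].
Proof.
apply: set_type_compact; apply: bounded_closed_compact.
  exists 1; split => // M M1 x [x0 x1] /=.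
  rewrite [`|x|]mx_normrE; apply: bigmax_le => //; first by lra.
  move=> [i j] _ /=; rewrite (ord1 i) ger0_norm //.
  by apply: le_trans (ltW M1); exact: (simplex_le1 (mk_simplex x0 x1)).
have -> : simplex n = (\bigcap_j [set x : 'rV[R]_n.+1 | 0 <= x 0 j]) `&`
    (fun x : 'rV[R]_n.+1 => \sum_j x 0 j) @^-1` [set 1].
  by apply/seteqP; split => x [x0 x1]; split => // j; [move=> _|]; exact: x0.
apply: closedI.
  apply: closed_bigI => j _.
  apply: (@closed_comp _ _ (fun x : 'rV[R]_n.+1 => x 0 j) [set y | 0 <= y]).
    by move=> x _; exact: coord_continuous.
  exact: closed_ge.
apply: closed_comp; last exact: closed_eq.
move=> x _; apply: sum_continuous_at => j; exact: coord_continuous.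
Qed.

(** Homotopies below take their parameter in all of R; clamping makes them constant before 0 and
    after 1. *)
Definition clamp (a : R) : R := Num.min 1 (Num.max 0 a).

Lemma clamp_continuous : continuous clamp.
Proof.
move=> a; apply: (@continuous_min _ R); first exact: cst_continuous.
apply: continuous_max; [exact: cst_continuous | exact: cvg_id].
Qed.

Lemma clamp_ge0 a : 0 <= clamp a.
Proof. by rewrite le_min ler01 le_max lexx. Qed.

Lemma clamp_le1 a : clamp a <= 1.
Proof. by rewrite ge_min lexx. Qed.

Lemma clamp_id a : 0 <= a -> a <= 1 -> clamp a = a.
Proof. by move=> a0 a1; rewrite /clamp (max_idPr a0) (min_idPr a1). Qed.

Lemma segment_ge0 n (a : R) (t u : simplex n) j :
  0 <= ((1 - clamp a) *: set_val t + clamp a *: set_val u) 0 j.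
Proof.
rewrite !mxE addr_ge0 ?mulr_ge0 ?simplex_ge0 ?subr_ge0 ?clamp_ge0 ?clamp_le1 //.
Qed.

Lemma segment_sum n (a : R) (t u : simplex n) :
  \sum_j ((1 - clamp a) *: set_val t + clamp a *: set_val u) 0 j = 1.
Proof.
under eq_bigr do rewrite !mxE.
by rewrite big_split -!mulr_sumr !simplex_sum /= !mulr1 subrK.
Qed.

Definition segment n (a : R) (t u : simplex n) : simplex n :=
  mk_simplex (@segment_ge0 n a t u) (segment_sum a t u).

Lemma set_val_segment n (a : R) (t u : simplex n) : set_val (segment a t u) =
  (1 - clamp a) *: set_val t + clamp a *: set_val u.
Proof. by []. Qed.

Lemma segmentE n (a : R) (t u : simplex n) : 0 <= a -> a <= 1 ->
  set_val (segment a t u) = (1 - a) *: set_val t + a *: set_val u.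
Proof. by move=> a0 a1; rewrite set_val_segment clamp_id. Qed.

Lemma segment0 n (t u : simplex n) : segment 0 t u = t.
Proof.
by apply/val_inj; rewrite [LHS]set_val_segment clamp_id ?ler01 // scale0r addr0 subr0 scale1r.
Qed.

Lemma segment1 n (t u : simplex n) : segment 1 t u = u.
Proof.
by apply/val_inj; rewrite [LHS]set_val_segment clamp_id ?ler01 // subrr scale0r add0r scale1r.
Qed.

Lemma segment_continuous_at n (Z : topologicalType) (f : Z -> R)
    (g h : Z -> simplex n) (z : Z) :
  {for z, continuous f} -> {for z, continuous g} -> {for z, continuous h} ->
  {for z, continuous (fun w => segment (f w) (g w) (h w))}.
Proof.
move=> cf cg ch; apply: simplex_continuous_at => j.
have ccf : {for z, continuous (fun w => clamp (f w))}.
  by apply: continuous_comp cf _; exact: clamp_continuous.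
have cgj : {for z, continuous (fun w => set_val (g w) 0 j)}.
  by apply: (@continuous_comp _ _ _ g (fun t => set_val t 0 j)) => //;
    exact: coord_simplex_continuous.
have chj : {for z, continuous (fun w => set_val (h w) 0 j)}.
  by apply: (@continuous_comp _ _ _ h (fun t => set_val t 0 j)) => //;
    exact: coord_simplex_continuous.
rewrite /prop_for (_ : (fun w => _) = (cst 1 \- (fun w => clamp (f w))) \*
  (fun w => set_val (g w) 0 j) \+ (fun w => clamp (f w)) \*
  (fun w => set_val (h w) 0 j)); last by apply/funext => w; rewrite set_val_segment !mxE.
apply: continuousD; apply: continuousM => //.
by apply: continuousB => //; exact: cst_continuous.
Qed.

Lemma connected_locally_constant (Z : topologicalType) (S : Type) (f : Z -> S) :
  connected [set: Z] -> (forall z, \forall w \near z, f w = f z) ->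
  forall z w, f z = f w.
Proof.
move=> cZ fl z w; have fopen (Q : S -> Prop) : open [set y | Q (f y)].
  rewrite openE => y Qy; have := fl y; rewrite /interior /=.
  by apply: filterS => x /= ->.
suff E : [set y | f y = f z] = [set: Z].
  by have : [set: Z] w by []; rewrite -E => /= ->.
apply: cZ; first by exists z.
- by exists [set y | f y = f z]; [exact: (fopen (fun a => a = f z)) | rewrite setTI].
- exists [set y | f y = f z]; last by rewrite setTI.
  rewrite -[X in closed X]setCK; apply: open_closedC.
  exact: (fopen (fun a => a <> f z)).
Qed.

(** Two points are joined by a clamped segment, so connectedness of R suffices. This is what makes
    slice coordinates, the difference of two lifts and signs constant along a singular simplex. *)
Lemma simplex_locally_constant n (S : Type) (f : simplex n -> S) :
  (forall t, \forall u \near t, f u = f t) -> forall t u, f t = f u.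
Proof.
move=> fl t u; rewrite -(segment0 t u) -{2}(segment1 t u).
apply: (connected_locally_constant (f := fun a : R => f (segment a t u))).
  by apply/connected_intervalP => x y z.
move=> a; have cs : {for a, continuous (fun b : R => segment b t u)}.
  by apply: segment_continuous_at; [exact: cvg_id | exact: cst_continuous ..].
exact: cs (fl _).
Qed.

End StandardSimplex.

Lemma pair_continuous_at (X Y Z : topologicalType) (f : X -> Y) (g : X -> Z) (x : X) :
  {for x, continuous f} -> {for x, continuous g} ->
  {for x, continuous (fun w => (f w, g w))}.
Proof.
move=> cf cg A [[U V] /= [nU nV] UV].
apply: (@filterS2 _ (nbhs x) _ _ _ _ _ (cf _ nU) (cg _ nV)) => w Uw Vw.
exact: (UV (_, _)).
Qed.

(** * Cones and subdivision *)

Section Cone.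
Variable R : realType.
Local Notation simplex n := (@std_simplex R n).

Definition shrink_row n (t : 'rV[R]_n.+2) : 'rV[R]_n.+1 :=
  if t 0 0 == 1 then delta_mx 0 0 else \row_j (t 0 (fintype.lift ord0 j) / (1 - t 0 0)).

Lemma shrink_ge0 n (t : simplex n.+1) j : 0 <= shrink_row (set_val t) 0 j.
Proof.
rewrite /shrink_row; case: ifP => _; first exact: vertex_ge0.
by rewrite mxE divr_ge0 ?simplex_ge0 // subr_ge0 simplex_le1.
Qed.

Lemma shrink_sum n (t : simplex n.+1) : \sum_j shrink_row (set_val t) 0 j = 1.
Proof.
rewrite /shrink_row; case: ifPn => [_|t1]; first exact: vertex_sum.
under eq_bigr do rewrite mxE.
rewrite -mulr_suml; have := simplex_sum t; rewrite big_ord_recl => /eqP.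
rewrite addrC eq_sym -subr_eq => /eqP <-.
by rewrite divff // subr_eq0 eq_sym.
Qed.

(* The projection from the 0th vertex onto the opposite face, with a junk value at
   that vertex. *)
Definition shrink n (t : simplex n.+1) : simplex n :=
  mk_simplex (@shrink_ge0 n t) (shrink_sum t).

Lemma shrinkE n (t : simplex n.+1) j : set_val t 0 0 != 1 ->
  set_val (shrink t) 0 j = set_val t 0 (fintype.lift ord0 j) / (1 - set_val t 0 0).
Proof.
move=> t1; have -> : set_val (shrink t) = shrink_row (set_val t) by [].
by rewrite /shrink_row (negbTE t1) mxE.
Qed.

Lemma shrink_continuous_at n (t : simplex n.+1) : set_val t 0 0 != 1 ->
  {for t, continuous (@shrink n)}.
Proof.
move=> t1; apply: simplex_continuous_at => j.
have ct (k : 'I_n.+2) : {for t, continuous (fun w : simplex n.+1 => set_val w 0 k)}.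
  exact: coord_simplex_continuous.
rewrite /prop_for /continuous_at (shrinkE _ t1).
pose g (w : simplex n.+1) := set_val w 0 (fintype.lift ord0 j) / (1 - set_val w 0 0).
have near1 : nbhs t [set w : simplex n.+1 | set_val w 0 0 != 1].
  have nU : nbhs (set_val t 0 0) [set a | a != 1].
    by apply: open_nbhs_nbhs; split => //; exact: open_neq.
  exact: (ct 0 _ nU).
have cg : {for t, continuous g}.
  apply: continuousM => //; apply: continuousV; first by rewrite subr_eq0 eq_sym.
  by apply: continuousB => //; exact: cst_continuous.
move=> A /cg gA; apply: (@filterS2 _ (nbhs t) _ _ _ _ _ near1 gA) => w /= w1.
by rewrite shrinkE.
Qed.

(** [shrink] need not be continuous at the 0th vertex. Since h(-, 1) is constant, compactness of the
    simplex gives a whole tube around level 1 on which h stays close to that constant, so the value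
    of [shrink] is immaterial there. *)
Lemma cone_continuous n (X : topologicalType) (h : simplex n * R -> X) :
  continuous h -> (forall t u, h (t, 1) = h (u, 1)) ->
  continuous (fun t : simplex n.+1 => h (shrink t, set_val t 0 0)).
Proof.
move=> ch h1 t; have ct0 : {for t, continuous (fun w : simplex n.+1 => set_val w 0 0)}.
  exact: coord_simplex_continuous.
case: (eqVneq (set_val t 0 0) 1) => t1; last first.
  apply: (@continuous_comp _ _ _ (fun w => (shrink w, set_val w 0 0)) h).
    apply: pair_continuous_at => //; exact: shrink_continuous_at.
  exact: ch.
move=> A /=; rewrite t1 => nA.
have : \forall a \near (1 : R), [set: simplex n] `<=` (fun u => A (h (u, a))).
  have /compact_near_coveringP cS := @compact_simplex R n.
  apply: (cS R (nbhs (1 : R)) (fun a u => A (h (u, a))) (nbhs_filter _)) => u _.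
  rewrite /= (h1 _ u) in nA; have [UV nUV hUV] := ch (u, 1) _ nA.
  by exists UV => // -[x a] xaUV; exact: (hUV (x, a)).
by rewrite -t1 => /ct0 nt; apply: (@filterS _ (nbhs t) _ _ _ _ nt) => w /=; exact.
Qed.

Lemma coface0_0 n (t : simplex n) : set_val (coface 0 t) 0 0 = 0.
Proof. by rewrite /= mxE unlift_none. Qed.

Lemma shrink_coface0 n (t : simplex n) : shrink (coface 0 t) = t.
Proof.
apply: simplex_eqP => j; rewrite shrinkE coface0_0; last by rewrite eq_sym oner_eq0.
by rewrite subr0 divr1 /= mxE liftK.
Qed.

Lemma coface_lift_0 n (i : 'I_n.+1) (t : simplex n) :
  set_val (coface (fintype.lift ord0 i) t) 0 0 = set_val t 0 0.
Proof.
rewrite /= mxE; case: unliftP => [j|] /(congr1 val) //= E.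
congr (set_val t 0 _); apply: val_inj => /=; move: E; rewrite /bump /=; lia.
Qed.

Lemma shrink_coface_lift n (i : 'I_n.+2) (t : simplex n.+1) : set_val t 0 0 != 1 ->
  shrink (coface (fintype.lift ord0 i) t) = coface i (shrink t).
Proof.
move=> t1; apply: simplex_eqP => j; rewrite shrinkE coface_lift_0 //= !mxE.
case: (unliftP i j) => [k ->|->].
  have -> : fintype.lift ord0 (fintype.lift i k) =
      fintype.lift (fintype.lift ord0 i) (fintype.lift ord0 k).
    by apply: val_inj => /=; rewrite /bump /=; lia.
  by rewrite liftK /= -shrinkE.
by rewrite unlift_none mul0r.
Qed.

Section ConeOperator.
Variables (X : topologicalType) (W : set X) (H : X -> R -> X).
Hypothesis Hcont : forall x a, W x ->
  {for (x, a), continuous (fun p : X * R => H p.1 p.2)}.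
Hypothesis HW : forall x a, W x -> W (H x a).
Hypothesis H0 : forall x, W x -> H x 0 = x.
Hypothesis H1 : forall n (s : singular_simplex R X n), simplex_in W s ->
  forall t u, H (s t) 1 = H (s u) 1.

(** A junk constant simplex off W makes the cone total, as a linear extension requires. [H1] asks
    the end of H to be constant only along each simplex, so W may have several components, each
    contracted to its own point. *)
Lemma scone_subproof n (s : singular_simplex R X n) :
  exists c : singular_simplex R X n.+1,
    simplex_in W s -> forall t, c t = H (s (shrink t)) (set_val t 0 0).
Proof.
have [Ws|] := pselect (simplex_in W s); last first.
  by exists (ctsmap (@cst_continuous _ _ (s (vertex R ord0)))).
pose h (p : simplex n * R) := H (s p.1) p.2.
have ch : continuous h.
  move=> [t a]; apply: (@continuous_comp _ _ _ (fun p => (s p.1, p.2))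
    (fun p : X * R => H p.1 p.2)); last by apply: Hcont; exact: Ws.
  apply: pair_continuous_at; last exact: cvg_snd.
  by apply: (@continuous_comp _ _ _ fst s); [exact: cvg_fst | exact: cts_fun].
by exists (ctsmap (cone_continuous ch (H1 Ws))).
Qed.

Definition scone n (s : singular_simplex R X n) : singular_simplex R X n.+1 :=
  sval (cid (scone_subproof s)).

Lemma sconeE n (s : singular_simplex R X n) t :
  simplex_in W s -> scone s t = H (s (shrink t)) (set_val t 0 0).
Proof. by move=> Ws; exact: (svalP (cid (scone_subproof s))). Qed.

Lemma scone_in n (s : singular_simplex R X n) :
  simplex_in W s -> simplex_in W (scone s).
Proof. by move=> Ws t; rewrite sconeE //; apply: HW; exact: Ws. Qed.

Lemma face0_scone n (s : singular_simplex R X n) :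
  simplex_in W s -> face ord0 (scone s) = s.
Proof.
move=> Ws; apply/continuousEP => t.
have -> : face ord0 (scone s) t = scone s (coface 0 t) by [].
by rewrite sconeE // coface0_0 shrink_coface0 H0.
Qed.

Lemma face_lift_scone n (s : singular_simplex R X n.+1) (i : 'I_n.+2) :
  simplex_in W s -> face (fintype.lift ord0 i) (scone s) = scone (face i s).
Proof.
move=> Ws; apply/continuousEP => t.
have -> : face (fintype.lift ord0 i) (scone s) t =
  scone s (coface (fintype.lift ord0 i) t) by [].
rewrite !sconeE //; last by move=> u; exact: Ws.
(* At the cone point [shrink] need not commute with cofaces, but there both sides are values of H at
   time 1, which agree by [H1]. *)
rewrite coface_lift_0; have [->|t1] := eqVneq (set_val t 0 0) 1.
  by apply: (H1 Ws).
by rewrite shrink_coface_lift.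
Qed.

Lemma face1_scone (s : singular_simplex R X 0) t : simplex_in W s ->
  face (fintype.lift ord0 ord0) (scone s) t = H (s t) 1.
Proof.
move=> Ws.
have -> : face (fintype.lift ord0 ord0) (scone s) t =
  scone s (coface (fintype.lift ord0 ord0) t) by [].
rewrite sconeE // coface_lift_0 (_ : set_val t 0 0 = 1); first exact: (H1 Ws).
by have := simplex_sum t; rewrite big_ord_recl big_ord0 addr0.
Qed.

Section Coefficients.
Variable K : comNzRingType.

Definition cone n : {linear chain R K X n -> chain R K X n.+1} :=
  [the {linear _ -> _} of lext (fun s => << scone s >> : chain R K X n.+1)].

Lemma cone_simplex n (s : singular_simplex R X n) : cone n << s >> = << scone s >>.
Proof. exact: lext_simplex. Qed.

Lemma cone_in n (c : chain R K X n) :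
  chain_in (simplex_in W) c -> chain_in (simplex_in W) (cone n c).
Proof.
apply: chain_in_linear => s Ws; rewrite cone_simplex.
by apply: chain_in_simplex; exact: scone_in.
Qed.

(** The 0th face of a cone is its base; the other faces are the cones on the faces of the base with
    index raised by one, whence the minus sign. *)
Lemma boundary_cone n (c : chain R K X n.+1) : chain_in (simplex_in W) c ->
  boundary (cone n.+1 c) = c - cone n (boundary c).
Proof.
pose f : {linear chain R K X n.+1 -> chain R K X n.+1} :=
  [the {linear _ -> _} of @boundary R K X n.+1] \o cone n.+1.
pose g : {linear chain R K X n.+1 -> chain R K X n.+1} :=
  GRing.sub_fun [the {linear chain R K X n.+1 -> _} of idfun]
  (cone n \o [the {linear _ -> _} of @boundary R K X n]).
apply: (linear_eq_in (f := f) (g := g)) => s Ws /=.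
rewrite cone_simplex !boundary_simplex big_ord_recl face0_scone //.
rewrite expr0 scale1r linear_sum; congr (_ + _); rewrite -sumrN.
apply: eq_bigr => i _; rewrite face_lift_scone // linearZ /= cone_simplex.
by rewrite /bump /= exprS mulN1r scaleNr.
Qed.

Lemma boundary_cone0 (s : singular_simplex R X 0) : simplex_in W s ->
  boundary (cone 0 << s >>) =
  << s >> - << face (fintype.lift ord0 ord0) (scone s) >>.
Proof.
move=> Ws; rewrite cone_simplex boundary_simplex !big_ord_recl big_ord0 addr0.
by rewrite face0_scone // expr0 scale1r expr1 scaleN1r.
Qed.

End Coefficients.
End ConeOperator.

End Cone.

(** * Barycentric subdivision and its chain homotopy *)

Section Subdivision.
Variables (R : realType) (K : comNzRingType).
Local Notation simplex n := (@std_simplex R n).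
Local Notation chain := (chain R K).
Implicit Types X Y : topologicalType.

Lemma boundaryB X n (c d : chain X n.+1) :
  boundary (c - d) = boundary c - boundary d.
Proof. exact: raddfB. Qed.

Lemma boundaryD X n (c d : chain X n.+1) :
  boundary (c + d) = boundary c + boundary d.
Proof. exact: raddfD. Qed.

Lemma boundaryN X n (c : chain X n.+1) : boundary (- c) = - boundary c.
Proof. exact: raddfN. Qed.

Lemma boundary0 X n : boundary 0 = 0 :> chain X n.
Proof. exact: raddf0. Qed.

Lemma barycenter_ge0 n (j : 'I_n.+1) : 0 <= (const_mx n.+1%:R^-1 : 'rV[R]_n.+1) 0 j.
Proof. by rewrite mxE invr_ge0. Qed.

Lemma barycenter_sum n : \sum_j (const_mx n.+1%:R^-1 : 'rV[R]_n.+1) 0 j = 1.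
Proof.
under eq_bigr do rewrite mxE.
by rewrite sumr_const card_ord -[X in X *+ _]mul1r -mulrnAr -[_ *+ _]mulr_natl mul1r divff.
Qed.

Definition barycenter n : simplex n :=
  mk_simplex (@barycenter_ge0 n) (barycenter_sum n).

Definition to_barycenter n (t : simplex n) (a : R) := segment a t (barycenter n).

Lemma to_barycenter_continuous n (t : simplex n) a : [set: simplex n] t ->
  {for (t, a), continuous (fun p : simplex n * R => to_barycenter p.1 p.2)}.
Proof.
move=> _; apply: segment_continuous_at; [exact: cvg_snd|exact: cvg_fst|].
exact: cst_continuous.
Qed.

Lemma to_barycenter1 n m (s : singular_simplex R (simplex n) m) :
  simplex_in setT s -> forall t u, to_barycenter (s t) 1 = to_barycenter (s u) 1.
Proof. by move=> _ t u; rewrite /to_barycenter !segment1. Qed.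

Definition bcone n m : {linear chain (simplex n) m -> chain (simplex n) m.+1} :=
  cone (@to_barycenter_continuous n) (@to_barycenter1 n) K m.

Lemma boundary_bcone n m (c : chain (simplex n) m.+1) :
  boundary (bcone n m.+1 c) = c - bcone n m (boundary c).
Proof.
apply: boundary_cone => // t _; exact: segment0.
Qed.

Lemma point_simplex_eq X (x y : singular_simplex R X 0) t : x t = y t -> x = y.
Proof.
move=> xy; apply/continuousEP => u; have point (v : simplex 0) : set_val v 0 0 = 1.
  by have := simplex_sum v; rewrite big_ord_recl big_ord0 addr0.
have -> // : u = t by apply: simplex_eqP => j; rewrite ord1 !point.
Qed.

Definition point_simplex (X : topologicalType) (x : X) : singular_simplex R X 0 :=
  ctsmap (@cst_continuous (simplex 0) X x).

Lemma boundary_bcone0 n (s : singular_simplex R (simplex n) 0) :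
  boundary (bcone n 0 << s >>) = << s >> - << point_simplex (barycenter n) >>.
Proof.
rewrite /bcone boundary_cone0 //; last by move=> t _; exact: segment0.
congr (_ - << _ >>); apply: (@point_simplex_eq _ _ _ (vertex R 0)).
by rewrite face1_scone //= /to_barycenter segment1.
Qed.

Definition id_simplex n : singular_simplex R (simplex n) n :=
  ctsmap (fun t => @cvg_id _ (nbhs t)).

(** Barycentric subdivision of the universal simplex; [Sd] carries it to all simplices by
    naturality. *)
Fixpoint sd_id n : chain (simplex n) n :=
  match n with
  | 0 => << id_simplex 0 >>
  | m.+1 => bcone m.+1 m (\sum_(i < m.+2) (-1) ^+ i *: push (coface i) (sd_id m))
  end.

(** No subdivision term is needed under the cone b. For x = id - h(d id) the induction gives dx =
    Sd(d id), so d(bx) = x - b(dx) produces the term [- sd_id] by itself. *)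
Fixpoint sdh_id n : chain (simplex n) n.+1 :=
  match n with
  | 0 => 0
  | m.+1 => bcone m.+1 m.+1 (<< id_simplex m.+1 >> -
      \sum_(i < m.+2) (-1) ^+ i *: push (coface i) (sdh_id m))
  end.

Definition Sd X n : {linear chain X n -> chain X n} :=
  [the {linear _ -> _} of lext (fun s => push s (sd_id n))].

Definition Sdh X n : {linear chain X n -> chain X n.+1} :=
  [the {linear _ -> _} of lext (fun s => push s (sdh_id n))].

Lemma Sd_simplex X n (s : singular_simplex R X n) : Sd X n << s >> = push s (sd_id n).
Proof. exact: lext_simplex. Qed.

Lemma Sdh_simplex X n (s : singular_simplex R X n) :
  Sdh X n << s >> = push s (sdh_id n).
Proof. exact: lext_simplex. Qed.

Lemma Sd_push X Y n (f : continuousType X Y) (c : chain X n) :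
  Sd Y n (push f c) = push f (Sd X n c).
Proof.
pose g : {linear chain X n -> chain Y n} := Sd Y n \o push f.
pose h : {linear chain X n -> chain Y n} := push f \o Sd X n.
apply: (linear_ext (f := g) (g := h)) => s /=.
by rewrite push_simplex !Sd_simplex; apply/esym/push_comp.
Qed.

Lemma Sdh_push X Y n (f : continuousType X Y) (c : chain X n) :
  Sdh Y n (push f c) = push f (Sdh X n c).
Proof.
pose g : {linear chain X n -> chain Y n.+1} := Sdh Y n \o push f.
pose h : {linear chain X n -> chain Y n.+1} := push f \o Sdh X n.
apply: (linear_ext (f := g) (g := h)) => s /=.
by rewrite push_simplex !Sdh_simplex; apply/esym/push_comp.
Qed.

Lemma push_id_simplex X n (s : singular_simplex R X n) :
  push s << id_simplex n >> = << s >> :> chain X n.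
Proof. by rewrite push_simplex; congr << _ >>; apply/continuousEP. Qed.

Lemma boundary_id n : boundary << id_simplex n.+1 >> =
  \sum_(i < n.+2) (-1) ^+ i *: << coface i : singular_simplex R _ n >>
  :> chain (simplex n.+1) n.
Proof.
rewrite boundary_simplex; apply: eq_bigr => i _; congr (_ *: << _ >>).
exact/continuousEP.
Qed.

Lemma sd_idE n : sd_id n.+1 = bcone n.+1 n (Sd _ n (boundary << id_simplex n.+1 >>)).
Proof.
rewrite boundary_id linear_sum /=; congr (bcone _ _ _).
by apply: eq_bigr => i _; rewrite linearZ /= Sd_simplex.
Qed.

Lemma sdh_idE n : sdh_id n.+1 = bcone n.+1 n.+1
  (<< id_simplex n.+1 >> - Sdh _ n (boundary << id_simplex n.+1 >>)).
Proof.
rewrite boundary_id linear_sum /=; congr (bcone _ _ (_ - _)).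
by apply: eq_bigr => i _; rewrite linearZ /= Sdh_simplex.
Qed.

Lemma Sd0 X (c : chain X 0) : Sd X 0 c = c.
Proof.
apply: (linear_ext (g := [the {linear chain X 0 -> chain X 0} of idfun])) => s /=.
by rewrite Sd_simplex push_id_simplex.
Qed.

Lemma Sdh0 X (c : chain X 0) : Sdh X 0 c = 0.
Proof.
apply: (linear_eq0_in (P := fun=> True)) => // s _.
by rewrite Sdh_simplex linear0.
Qed.

(** One step of the strong induction for [boundary_Sd]. The induction hypothesis covers all spaces,
    since it is used for chains inside a simplex of larger dimension than their degree. *)
Lemma boundary_sd_id n (IH : forall m X (c : chain X m.+1), (m < n)%N ->
    boundary (Sd X m.+1 c) = Sd X m (boundary c)) :
  boundary (sd_id n.+1) = Sd _ n (boundary << id_simplex n.+1 >>).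
Proof.
rewrite sd_idE; case: n IH => [_|n IH]; last first.
  by rewrite boundary_bcone IH // boundary_boundary !linear0 addr0.
(* Dimension 1: the cone over each end point contributes the barycenter, and the two contributions
   have opposite signs. *)
rewrite Sd0 boundary_simplex !linear_sum /= !big_ord_recl !big_ord0 !addr0.
rewrite !expr0 expr1 !linearZ /= !boundary_bcone0 !scale1r scaleN1r.
by rewrite scaleN1r opprB addrA subrK.
Qed.

Lemma boundary_Sd X n (c : chain X n.+1) : boundary (Sd X n.+1 c) = Sd X n (boundary c).
Proof.
have [m] := ubnP n; elim: m n X c => // m IHm n X c; rewrite ltnS => lnm.
pose f : {linear chain X n.+1 -> chain X n} :=
  [the {linear _ -> _} of @boundary R K X n] \o Sd X n.+1.
pose g : {linear chain X n.+1 -> chain X n} :=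
  Sd X n \o [the {linear _ -> _} of @boundary R K X n].
apply: (linear_ext (f := f) (g := g)) => s /=.
rewrite Sd_simplex boundary_push -[in RHS](push_id_simplex s) boundary_push Sd_push.
by rewrite boundary_sd_id // => k Y d lkn; apply: IHm; exact: leq_trans lkn lnm.
Qed.

Lemma boundary_sdh_id n (IH : forall m X (c : chain X m.+1), (m < n)%N ->
    boundary (Sdh X m.+1 c) = c - Sd X m.+1 c - Sdh X m (boundary c)) :
  boundary (sdh_id n.+1) = << id_simplex n.+1 >> - sd_id n.+1 -
     Sdh _ n (boundary << id_simplex n.+1 >>).
Proof.
rewrite sdh_idE boundary_bcone addrAC; congr (_ - _); congr (_ - _).
rewrite sd_idE boundaryB; congr (bcone _ _ _).
case: n IH => [_|n IH]; last first.
  by rewrite IH // boundary_boundary linear0 ?subr0 opprB addrC subrK.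
by rewrite Sdh0 linear0 oppr0 addr0 Sd0.
Qed.

Lemma boundary_Sdh X n (c : chain X n.+1) :
  boundary (Sdh X n.+1 c) = c - Sd X n.+1 c - Sdh X n (boundary c).
Proof.
have [m] := ubnP n; elim: m n X c => // m IHm n X c; rewrite ltnS => lnm.
pose f : {linear chain X n.+1 -> chain X n.+1} :=
  [the {linear _ -> _} of @boundary R K X n.+1] \o Sdh X n.+1.
pose g : {linear chain X n.+1 -> chain X n.+1} :=
  GRing.sub_fun (GRing.sub_fun
    [the {linear chain X n.+1 -> _} of idfun] (Sd X n.+1))
  (Sdh X n \o [the {linear _ -> _} of @boundary R K X n]).
apply: (linear_ext (f := f) (g := g)) => s /=.
rewrite Sdh_simplex Sd_simplex boundary_push.
rewrite -[X in X - _ - _](push_id_simplex s).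
rewrite -[X in Sdh _ _ (boundary X)](push_id_simplex s) boundary_push Sdh_push.
rewrite -!linearB /= boundary_sdh_id // => k Y d lkn.
by apply: IHm; exact: leq_trans lkn lnm.
Qed.

Lemma push_in X Y n (f : continuousType X Y) (U : set Y) (c : chain X n) :
  (forall x, U (f x)) -> chain_in (simplex_in U) (push f c).
Proof.
move=> Uf; apply: (chain_in_linear (P := fun=> True)) => // s _.
by rewrite push_simplex; apply: chain_in_simplex => t; exact: Uf.
Qed.

Lemma Sd_in X n (U : set X) (c : chain X n) :
  chain_in (simplex_in U) c -> chain_in (simplex_in U) (Sd X n c).
Proof.
by apply: chain_in_linear => s Us; rewrite Sd_simplex; exact: push_in.
Qed.

End Subdivision.

(** * Mesh of iterated subdivisions and small chains *)

Section Mesh.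
Variables (R : realType) (K : comNzRingType).
Local Notation simplex n := (@std_simplex R n).
Local Notation chain := (chain R K).
Implicit Types X Y : topologicalType.

Definition affine n m (f : simplex n -> 'rV[R]_m) :=
  forall t, f t = \sum_j set_val t 0 j *: f (vertex R j).

Definition vertex_diam n m (f : simplex n -> 'rV[R]_m) (d : R) :=
  forall j k, `|f (vertex R j) - f (vertex R k)| <= d.

Lemma norm_convex_le n m (t : simplex n) (y : 'I_n.+1 -> 'rV[R]_m) d :
  (forall j, `|y j| <= d) -> `|\sum_j set_val t 0 j *: y j| <= d.
Proof.
move=> yd; apply: le_trans (ler_norm_sum _ _ _) _.
rewrite -[leRHS]mul1r -(simplex_sum t) mulr_suml; apply: ler_sum => j _.
by rewrite normrZ ger0_norm ?simplex_ge0 // ler_wpM2l ?simplex_ge0.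
Qed.

Lemma convex_sub n m (t : simplex n) (y : 'I_n.+1 -> 'rV[R]_m) (x : 'rV[R]_m) :
  \sum_j set_val t 0 j *: y j - x = \sum_j set_val t 0 j *: (y j - x).
Proof.
rewrite -{1}[x]scale1r -(simplex_sum t) scaler_suml -sumrB.
by apply: eq_bigr => j _; rewrite scalerBr.
Qed.

Lemma affine_diam n m (f : simplex n -> 'rV[R]_m) d :
  affine f -> vertex_diam f d -> forall t u, `|f t - f u| <= d.
Proof.
move=> af fd t u; rewrite (af t) convex_sub; apply: norm_convex_le => j.
rewrite -normrN opprB (af u) convex_sub; apply: norm_convex_le => k; exact: fd.
Qed.

Lemma affine_comp n m l (f : simplex m -> 'rV[R]_l) (g : simplex n -> simplex m) :
  affine f -> affine (fun t => set_val (g t)) -> affine (f \o g).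
Proof.
move=> af ag t /=; rewrite af.
have agt k : set_val (g t) 0 k =
    \sum_j set_val t 0 j * set_val (g (vertex R j)) 0 k.
  by rewrite [set_val (g t)]ag summxE; apply: eq_bigr => j _; rewrite mxE.
rewrite [LHS](eq_bigr (fun j => \sum_k
    (set_val t 0 k * set_val (g (vertex R k)) 0 j) *: f (vertex R j))); last first.
  by move=> j _; rewrite agt scaler_suml.
rewrite exchange_big; apply: eq_bigr => k _.
rewrite [in RHS]af scaler_sumr; apply: eq_bigr => j _.
by rewrite scalerA.
Qed.

Lemma affine_set_val n : affine (fun t : simplex n => set_val t).
Proof.
move=> t; apply/rowP => k; rewrite summxE (bigD1 k) //= !mxE !eqxx mulr1.
by rewrite big1 ?addr0 // => j jk; rewrite !mxE eq_sym (negbTE jk) andbF mulr0.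
Qed.

Lemma coface_vertex n (i : 'I_n.+2) (j : 'I_n.+1) :
  coface i (vertex R j) = vertex R (fintype.lift i j).
Proof.
apply: simplex_eqP => k; rewrite /= !mxE; case: (unliftP i k) => [l|] -> /=.
  by rewrite mxE (inj_eq lift_inj).
by rewrite (negbTE (neq_lift _ _)).
Qed.

Lemma affine_coface n (i : 'I_n.+2) : affine (fun t : simplex n => set_val (coface i t)).
Proof.
move=> t; apply/rowP => k; rewrite summxE.
under eq_bigr do rewrite coface_vertex !mxE eqxx /=.
rewrite /= mxE; case: (unliftP i k) => [l|] -> /=.
  rewrite (bigD1 l) //= eqxx mulr1 big1 ?addr0 // => j jl.
  by rewrite (inj_eq lift_inj) eq_sym (negbTE jl) mulr0.
by rewrite big1 // => j _; rewrite (negbTE (neq_lift _ _)) mulr0.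
Qed.

(** The barycenter minus the k-th vertex is an average of n+1 differences of vertices, one of which
    is zero: hence the factor n / (n+1). Convexity extends the bound to every t. *)
Lemma barycenter_dist n m (f : simplex n -> 'rV[R]_m) d :
  affine f -> vertex_diam f d ->
  forall t, `|f (barycenter R n) - f t| <= n%:R / n.+1%:R * d.
Proof.
move=> af fd t; rewrite -normrN opprB (af t) convex_sub.
apply: norm_convex_le => k; rewrite -normrN opprB (af (barycenter R n)) convex_sub.
rewrite (bigD1 k) //= subrr scaler0 add0r.
apply: le_trans (ler_norm_sum _ _ _) _.
apply: (@le_trans _ _ (\sum_(i < n.+1 | i != k) n.+1%:R^-1 * d)).
  apply: ler_sum => j _; rewrite normrZ mxE ger0_norm ?invr_ge0 //.
  by rewrite ler_wpM2l ?invr_ge0.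
have ck : #|[pred i : 'I_n.+1 | i != k]| = n by rewrite (cardC1 k) card_ord.
by rewrite sumr_const ck -mulrnAl -[n.+1%:R^-1 *+ n]mulr_natl.
Qed.

Let bscone n m := @scone R _ setT _ (@to_barycenter_continuous R n)
  (@to_barycenter1 R n) m.

Lemma bscone_vertex0 n m (s : singular_simplex R (simplex n) m) :
  bscone s (vertex R ord0) = barycenter R n.
Proof.
by rewrite /bscone sconeE // !mxE !eqxx /to_barycenter segment1.
Qed.

Lemma shrink_vertex n (j : 'I_n.+1) :
  shrink (vertex R (fintype.lift ord0 j)) = vertex R j.
Proof. by rewrite -coface_vertex shrink_coface0. Qed.

Lemma bscone_vertex_lift n m (s : singular_simplex R (simplex n) m) j :
  bscone s (vertex R (fintype.lift ord0 j)) = s (vertex R j).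
Proof.
by rewrite /bscone sconeE // shrink_vertex !mxE /to_barycenter segment0.
Qed.

Lemma affine_bscone n m (s : singular_simplex R (simplex n) m) :
  affine (fun t => set_val (s t)) -> affine (fun t => set_val (bscone s t)).
Proof.
move=> as_ t; rewrite big_ord_recl bscone_vertex0.
under eq_bigr do rewrite bscone_vertex_lift.
rewrite /bscone sconeE // /to_barycenter segmentE ?simplex_ge0 ?simplex_le1 //.
rewrite addrC; congr (_ + _).
have [t1|t1] := eqVneq (set_val t 0 0) 1.
  rewrite t1 subrr scale0r big1 // => j _.
  have := simplex_sum t; rewrite big_ord_recl t1 => /eqP.
  rewrite -subr_eq0 [1 + _]addrC addrK psumr_eq0; last by move=> *; exact: simplex_ge0.
  by move=> /allP /(_ j (mem_index_enum _)) /eqP ->; rewrite scale0r.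
rewrite as_ scaler_sumr; apply: eq_bigr => j _.
by rewrite shrinkE // scalerA mulrC divfK // subr_eq0 eq_sym.
Qed.

(** The bound is required for all affine f, so that it applies with f an affine simplex that is
    itself being subdivided. *)
Definition mesh_reducing n (s : singular_simplex R (simplex n) n) :=
  affine (fun t => set_val (s t)) /\
  forall m (f : simplex n -> 'rV[R]_m) d, affine f -> vertex_diam f d ->
    vertex_diam (f \o s) (n%:R / n.+1%:R * d).

(** Two distinct vertices of a piece either both lie in the face under the cone, where induction
    gives the smaller factor n / (n+1), or one is the barycenter, where [barycenter_dist] gives
    (n+1) / (n+2). *)
Lemma sd_id_mesh n : chain_in (@mesh_reducing n) (sd_id R K n).
Proof.
elim: n => [|n IH].
  apply: chain_in_simplex; split; first exact: affine_set_val.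
  by move=> m f d af fd j k; rewrite !ord1 subrr normr0 mul0r mul0r.
apply: (chain_in_linear (P := fun s => exists i s', mesh_reducing s' /\
    s = spush (coface i) s')).
  move=> s [i [s' [[as' ms'] ->]]]; rewrite cone_simplex.
  apply: chain_in_simplex; set k := spush _ s'.
  have ak : affine (fun t => set_val (k t)).
    apply: (affine_comp (f := fun t => set_val (coface i t))) => //.
    exact: affine_coface.
  split; first exact: affine_bscone.
  move=> m f d af fd; have d0 : 0 <= d by apply: le_trans (fd ord0 ord0).
  have kv j : @scone R _ setT _ (@to_barycenter_continuous R n.+1)
      (@to_barycenter1 R n.+1) n k (vertex R (fintype.lift ord0 j)) =
      k (vertex R j) by exact: bscone_vertex_lift.
  have k0 : @scone R _ setT _ (@to_barycenter_continuous R n.+1)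
      (@to_barycenter1 R n.+1) n k (vertex R ord0) = barycenter R n.+1.
    exact: bscone_vertex0.
  move=> a b /=; case: (unliftP ord0 a) => [j|] ->; last first.
    by rewrite k0; exact: barycenter_dist.
  case: (unliftP ord0 b) => [l|] ->; last first.
    by rewrite k0 -normrN opprB; exact: barycenter_dist.
  rewrite !kv; apply: (@le_trans _ _ (n%:R / n.+1%:R * d)).
    apply: (ms' m (f \o coface i)).
      by apply: affine_comp => //; exact: affine_coface.
    by move=> u v /=; rewrite !coface_vertex; exact: fd.
  rewrite ler_wpM2r // ler_pdivrMr // mulrAC ler_pdivlMr // -!natrM ler_nat.
  by rewrite !(mulnS, mulSn); lia.
apply: chain_in_sum => i _; apply: chain_inZ.
apply: chain_in_linear IH => s ms; rewrite push_simplex; apply: chain_in_simplex.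
by exists i, s.
Qed.

Definition mesh_le n (d : R) (s : singular_simplex R (simplex n) n) :=
  affine (fun t => set_val (s t)) /\ vertex_diam (fun t => set_val (s t)) d.

(** The trailing 1 bounds the diameter of the vertex set in the sup norm. *)
Lemma iter_Sd_mesh n k :
  chain_in (@mesh_le n ((n%:R / n.+1%:R) ^+ k * 1))
    (iter k (Sd R K (simplex n) n) << id_simplex R n >>).
Proof.
elim: k => [|k IH] /=.
  apply: chain_in_simplex; rewrite expr0 mul1r; split; first exact: affine_set_val.
  move=> i j; rewrite [`|_|]mx_normrE; apply: bigmax_le => // -[a b] _ /=.
  rewrite !mxE; do 2 case: (_ && _) => /=; rewrite ?subrr ?subr0 ?sub0r ?normrN
    ?normr1 ?normr0 //.
apply: chain_in_linear IH => s [as_ ds]; rewrite Sd_simplex.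
apply: chain_in_linear (@sd_id_mesh n) => s' [as' ds'].
rewrite push_simplex; apply: chain_in_simplex; split.
  exact: (affine_comp (f := fun t => set_val (s t)) as_ as').
by rewrite exprS -mulrA; exact: (ds' _ _ _ as_ ds).
Qed.

Lemma lebesgue_number n (X : topologicalType) (I : Type) (U : I -> set X)
    (s : singular_simplex R X n) :
  (forall i, open (U i)) -> (forall t, exists i, U i (s t)) ->
  exists2 e : R, 0 < e & forall t : simplex n, exists i, forall u : simplex n,
    `|set_val u - set_val t| < e -> U i (s u).
Proof.
move=> oU cU.
pose P (e : R) (t : simplex n) := exists i, forall u : simplex n, `|set_val u - set_val t| < e -> U i (s u).
suff : \forall e \near 0^'+, [set: simplex n] `<=` P e.
  move=> near0; near (0 : R)^'+ => e; exists e => //.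
  by move=> t; exact: (near near0 e).
have /compact_near_coveringP cS := @compact_simplex R n.
apply: (cS R (0 : R)^'+ P) => t _; have [i Uit] := cU t.
have : nbhs t (s @^-1` U i).
  by apply: (@cts_fun _ _ s t); exact: open_nbhs_nbhs.
move/nbhs_set_val => [B /nbhs_ballP [e /= e0 eB] BU].
(* Half of e goes to moving the centre from t to u, the other half to the radius around u. *)
exists (set_val @^-1` ball (set_val t) (e / 2), [set d : R | d < e / 2]) => /=.
  split; last by exact: nbhs_right_lt (divr_gt0 _ _).
  apply/nbhs_set_val; exists (ball (set_val t) (e / 2)) => //.
  by apply: nbhsx_ballx; rewrite divr_gt0.
move=> [u d] [/= tu de]; exists i => v uv; apply: BU; apply: eB.
rewrite -ball_normE /= in tu *; rewrite -(subrKA (set_val u)).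
apply: le_lt_trans (ler_normD _ _) _; rewrite [e]splitr; apply: ltrD => //.
by rewrite -normrN opprB; exact: lt_trans uv de.
Unshelve. all: by end_near. Qed.

Lemma iter_Sd_push X Y n k (f : continuousType X Y) (c : chain X n) :
  iter k (Sd R K Y n) (push f c) = push f (iter k (Sd R K X n) c).
Proof. by elim: k => //= k ->; rewrite Sd_push. Qed.

Lemma iter_Sd_in X n (U : set X) k (c : chain X n) :
  chain_in (simplex_in U) c -> chain_in (simplex_in U) (iter k (Sd R K X n) c).
Proof. by move=> Uc; elim: k => //= k IH; exact: Sd_in. Qed.

Definition small X (I : Type) (U : I -> set X) n (s : singular_simplex R X n) :=
  exists i, simplex_in (U i) s.

Arguments small {X I} U {n} s.

Lemma Sd_small X (I : Type) (U : I -> set X) n (c : chain X n) :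
  chain_in (small U) c -> chain_in (small U) (Sd R K X n c).
Proof.
apply: chain_in_linear => s [i Us]; rewrite Sd_simplex.
by apply: (chain_in_sub (P := simplex_in (U i))); [move=> s'; exists i|exact: push_in].
Qed.

(** A Lebesgue number handles one simplex. Smallness survives further subdivision, so the finitely
    many simplices of a chain can be given a common number of subdivisions. *)
Lemma small_subdivision X (I : Type) (U : I -> set X) n (c : chain X n) :
  (forall i, open (U i)) -> (forall x, exists i, U i x) ->
  exists k, forall l, (k <= l)%N -> chain_in (small U) (iter l (Sd R K X n) c).
Proof.
move=> oU cU; suff [k sk] : exists k, chain_in (small U) (iter k (Sd R K X n) c).
  exists k => l kl; rewrite -(subnK kl) iterD.
  by elim: (l - k)%N => //= m IH; exact: Sd_small.
have simplex_case (s : singular_simplex R X n) : exists k, chain_in (small U) (iter k (Sd R K X n) << s >>).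
  have [e e0 he] := @lebesgue_number n X I U s oU (fun t => cU (s t)).
  have : (n%:R / n.+1%:R : R) ^+ k @[k --> \oo] --> (0 : R).
    apply: cvg_expr; rewrite ger0_norm ?divr_ge0 // ltr_pdivrMr // mul1r ltr_nat //.
  move=> /cvgr0Pnorm_lt /(_ e e0) [k _ /(_ k (leqnn k))] /= ke.
  exists k; rewrite -(push_id_simplex K s) iter_Sd_push.
  apply: (chain_in_linear _ (@iter_Sd_mesh n k)) => s' [as' ds'].
  rewrite push_simplex; apply: chain_in_simplex.
  have [i hi] := he (s' (vertex R ord0)); exists i => t; apply: hi.
  apply: le_lt_trans (affine_diam as' ds' _ _) _.
  by rewrite mulr1; apply: le_lt_trans ke; exact: ler_norm.
elim/chain_ind: c => [|a s c [k IH]]; first by exists 0%N; exact: chain_in0.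
have [l sl] := simplex_case s; exists (k + l)%N.
have small_more i j d : chain_in (small U) (iter i (Sd R K X n) d) ->
    chain_in (small U) (iter (j + i) (Sd R K X n) d).
  by move=> sd; rewrite iterD; elim: j => //= j IHj; exact: Sd_small.
have iter_lin j (b : K) d d' : iter j (Sd R K X n) (b *: d + d') =
    b *: iter j (Sd R K X n) d + iter j (Sd R K X n) d'.
  by elim: j => //= j ->; rewrite linearP.
rewrite iter_lin; apply: chain_inD; first by apply: chain_inZ; exact: small_more.
by rewrite addnC; exact: small_more.
Qed.

End Mesh.

Arguments small {R X I} U {n} s.

(** * Smith theory *)

Section HomologyPredicates.
Variables (C : nat -> zmodType) (d : forall n, {additive C n.+1 -> C n}).

Definition subcomplex (P : forall n, C n -> Prop) :=
  [/\ forall n, P n 0, forall n x y, P n x -> P n y -> P n (x - y)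
    & forall n x, P n.+1 x -> P n (d n x)].

(* The index n refers to the homology in degree n.+1. *)
Definition acyclic_at (P : forall n, C n -> Prop) n :=
  forall z, P n.+1 z -> d n z = 0 -> exists2 w, P n.+2 w & d n.+1 w = z.

(** The separating map f is any function: the bounds are built from chosen representatives and
    numbers of subdivisions, which depend on the cycle in no additive way. *)
Definition homology_card_le (P : forall n, C n -> Prop) n (c : nat) :=
  exists (T : finType) (f : C n.+1 -> T), #|T| = c /\
    forall z z', P n.+1 z -> d n z = 0 -> P n.+1 z' -> d n z' = 0 ->
      f z = f z' -> exists2 w, P n.+2 w & d n.+1 w = z - z'.

(** The homological form of being a rose. Degree 0 is left out, since it is settled by
    connectedness. *)
Definition rose_homology (P : forall n, C n -> Prop) :=
  [/\ exists c, homology_card_le P 0 c, ~ acyclic_at P 0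
    & forall n, (0 < n)%N -> acyclic_at P n].

Lemma subcomplexD (P : forall n, C n -> Prop) n x y : subcomplex P ->
  P n x -> P n y -> P n (x + y).
Proof.
move=> [P0 PB _] Px Py; rewrite -[y]opprK -[- y]sub0r.
by apply: (PB) => //; exact: (PB).
Qed.

(** Vanishing is the bound 1, and 1 to any power is 1; statements on cardinality bounds thereby also
    yield statements on vanishing. *)
Lemma acyclic_card1 (P : forall n, C n -> Prop) n : subcomplex P ->
  acyclic_at P n <-> homology_card_le P n 1.
Proof.
move=> [P0 PB Pd]; split => [aP|].
  exists unit, (fun=> tt); split; first exact: card_unit.
  move=> z z' Pz dz Pz' dz' _; apply: aP; first exact: PB.
  by rewrite raddfB dz dz' subr0.
move=> [T [f [T1 hf]]] z Pz dz.
have := hf z 0 Pz dz (P0 _) (raddf0 _); rewrite subr0; apply.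
by apply: (fintype_le1P _) => //; rewrite T1.
Qed.

End HomologyPredicates.

Section Smith.
Variables (C : nat -> zmodType) (d : forall n, {additive C n.+1 -> C n}).
Hypothesis dd : forall n x, d n (d n.+1 x) = 0.
Variable D : forall n, C n -> Prop.
Hypothesis Dsub : subcomplex d D.
Let D0 n : D 0 := let: And3 h _ _ := Dsub in h n.
Let DB n (x y : C n) : D x -> D y -> D (x - y) :=
  let: And3 _ h _ := Dsub in h n x y.
Let Dd n (x : C n.+1) : D x -> D (d n x) := let: And3 _ _ h := Dsub in h n x.

Let DN n (x : C n) : D x -> D (- x).
Proof. by move=> Dx; rewrite -sub0r; exact: DB. Qed.

Let DD n (x y : C n) : D x -> D y -> D (x + y).
Proof. by move=> Dx Dy; rewrite -[y]opprK; apply: DB => //; exact: DN. Qed.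

(* [op true] is tau = g - 1 and [op false] is the norm; the contractions
   [con b l] exhibit the exactness of the periodic sequence they form. *)
Variable op : bool -> forall n, {additive C n -> C n}.
Hypothesis opd : forall b n x, op b n (d n x) = d n (op b n.+1 x).
Hypothesis Dop : forall b n x, D x -> D (op b n x).
Hypothesis op_op : forall b n x, D x -> op b n (op (~~ b) n x) = 0.

Variable con : bool -> nat -> forall n, {additive C n -> C n}.
Hypothesis Dcon : forall b l n x, D x -> D (con b l n x).
Hypothesis op_con : forall b l n x, D x ->
  op b n (con b l n x) + con (~~ b) l n (op (~~ b) n x) = x.

Definition opker b n (x : C n) := D x /\ op b n x = 0.

Lemma opker_subcomplex b : subcomplex d (opker b).
Proof.
split=> [n|n x y [Dx x0] [Dy y0]|n x [Dx x0]]; split.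
- exact: D0.
- exact: raddf0.
- exact: DB.
- by rewrite raddfB x0 y0 subr0.
- exact: Dd.
- by rewrite opd x0 raddf0.
Qed.

Let opkerD b n (x y : C n) : opker b x -> opker b y -> opker b (x + y).
Proof.
by move=> [Dx x0] [Dy y0]; split; [exact: DD | rewrite raddfD x0 y0 addr0].
Qed.

Let op_con_ker b l n x : opker (~~ b) x -> op b n (con b l n x) = x.
Proof. by move=> [Dx x0]; rewrite -[RHS](op_con b l Dx) x0 raddf0 addr0. Qed.

(** On the kernel of [op (~~ b)] the map [con b l] is a right inverse of [op b], so both terms
    become d v under [op b]. *)
Let con_commutator b l n (v : C n.+1) : opker (~~ b) v ->
  opker b (con b l n (d n v) - d n (con b l n.+1 v)).
Proof.
move=> kv; have [Dv v0] := kv; split.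
  by apply: DB; [apply: Dcon; exact: Dd | apply: Dd; exact: Dcon].
rewrite raddfB opd !op_con_ker ?subrr //.
by have [_ _] := opker_subcomplex (~~ b); exact.
Qed.

(* If z = d w in D then u = op b w represents the connecting image of z, and the
   lift con b l u recovers z from u. *)
Lemma opker_connecting b l n (z : C n.+1) (w : C n.+2) :
  opker b z -> D w -> d n.+1 w = z ->
  [/\ opker (~~ b) (op b n.+2 w), d n.+1 (op b n.+2 w) = 0 &
  forall u v, opker (~~ b) u -> opker (~~ b) v -> d n.+2 v = op b n.+2 w - u ->
    exists2 y, opker b y & d n.+1 y = z - d n.+1 (con b l n.+2 u)].
Proof.
move=> [Dz z0] Dw dw; split.
- split; first exact: Dop.
  by rewrite -{2}[b]negbK op_op.
- by rewrite -opd dw z0.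
move=> u v ku kv dv.
(* [con (d v)] is the error made in replacing [op b w] by u; subtracting the boundary of [con v]
   moves it into the kernel and leaves its own boundary unchanged. *)
set e := con b l n.+2 (d n.+2 v) - d n.+2 (con b l n.+3 v).
have kw : opker b (w - con b l n.+2 (op b n.+2 w)).
  have kopw : opker (~~ b) (op b n.+2 w).
    by split; [exact: Dop | rewrite -{2}[b]negbK op_op].
  split; first by apply: DB => //; apply: Dcon; exact: Dop.
  by rewrite raddfB op_con_ker // subrr.
have ke : opker b e by exact: con_commutator.
exists (w - con b l n.+2 (op b n.+2 w) + e).
  exact: opkerD.
rewrite !raddfD !raddfN dw /= -addrA; congr (_ + _).
by rewrite dd subr0 dv raddfB raddfB /= addrA addNr add0r.
Qed.

(** [sm l] stands for chains each of whose simplices lies in one of the sets numbered l, ..., M-1.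
    The contraction [con b l] commutes with d on simplices in the l-th set, so the commutator only
    sees the later ones; at l = M none is left. *)
Variables (M : nat) (sm : nat -> forall n, C n -> Prop).
Hypothesis sm_con : forall b l n x, D x -> sm l x ->
  sm l.+1 (con b l n (d n x) - d n (con b l n.+1 x)).
Hypothesis smN : forall l n (x : C n), sm l x -> sm l (- x).
Hypothesis sm_subdiv : forall b n (z : C n.+1), opker b z -> d n z = 0 ->
  exists z' v, [/\ opker b z', d n z' = 0, sm 0 z', opker b v & d n.+1 v = z - z'].
Hypothesis sm_eq0 : forall n (x : C n), sm M x -> x = 0.

(** The claim R is proved for all b and all n >= k at once, because a step of the induction on l
    passes to the other operator one degree up, applies the hypothesis there and comes back by
    [d (con u)]. This is why vanishing is assumed in all degrees from k on. *)
Lemma opker_acyclic k : (forall n, (k <= n)%N -> acyclic_at d D n) ->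
  forall b n, (k <= n)%N -> acyclic_at d (opker b) n.
Proof.
move=> aD; suff R l b n (z : C n.+1) : (k <= n)%N -> opker b z -> d n z = 0 ->
    exists z' v, [/\ opker b z', d n z' = 0, sm l z', opker b v
                   & d n.+1 v = z - z'].
  move=> b n kn z kz dz; have [z' [v [_ _ /sm_eq0 z'0 kv dv]]] := R M b n z kn kz dz.
  by exists v; rewrite // dv z'0 subr0.
elim: l b n z => [|l IH] b n z kn kz dz; first exact: sm_subdiv.
have [w Dw dw] := aD n kn z kz.1 dz.
have [kw dopw hw] := opker_connecting l kz Dw dw.
have [u [v [ku du su kv dv]]] := IH (~~ b) n.+1 _ (leqW kn) kw dopw.
have [y ky dy] := hw u v ku kv dv.
(* As d u = 0, this is minus the commutator of [con] and d at u: it lies in the kernel by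
   [con_commutator] and gains one index by [sm_con]. *)
exists (d n.+1 (con b l n.+2 u)), y; split => //; last first.
  have := sm_con b ku.1 su; rewrite du raddf0 sub0r => /smN.
  by rewrite opprK.
have := con_commutator l ku; rewrite du raddf0 sub0r => -[k1 k2].
split; first by rewrite -[d _ _]opprK; exact: DN.
by move/eqP: k2; rewrite raddfN oppr_eq0 => /eqP.
Qed.

(** If the connecting image of z bounds, [opker_connecting] applies with u = 0 and returns z itself
    as a boundary. *)
Lemma opker_injective b n (z : C n.+1) (w : C n.+2) :
  acyclic_at d (opker (~~ b)) n.+1 -> opker b z -> D w -> d n.+1 w = z ->
  exists2 y, opker b y & d n.+1 y = z.
Proof.
move=> aK kz Dw dw; have [kw dopw hw] := opker_connecting 0 kz Dw dw.
have [v kv dv] := aK _ kw dopw.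
have [y ky dy] := hw 0 v (conj (D0 _) (raddf0 _)) kv (etrans dv (esym (subr0 _))).
by exists y => //; rewrite dy (raddf0 (con _ _ _)) (raddf0 (d _)) subr0.
Qed.

Variable m : nat.
Hypothesis norm_iter : forall n (x : C n), D x -> op false n x = iter m (op true n) x.

Let iker j n (x : C n) := D x /\ iter j (op true n) x = 0.

Let iter_opB j n (x y : C n) :
  iter j (op true n) (x - y) = iter j (op true n) x - iter j (op true n) y.
Proof. by elim: j => //= j ->; rewrite raddfB. Qed.

Let iter_op0 j n : iter j (op true n) 0 = 0.
Proof. by elim: j => //= j ->; rewrite raddf0. Qed.

Let iter_opd j n (x : C n.+1) :
  iter j (op true n) (d n x) = d n (iter j (op true n.+1) x).
Proof. by elim: j => //= j ->; rewrite opd. Qed.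

Let iker_subcomplex j : subcomplex d (iker j).
Proof.
split=> [n|n x y [Dx x0] [Dy y0]|n x [Dx x0]]; split.
- exact: D0.
- exact: iter_op0.
- exact: DB.
- by rewrite iter_opB x0 y0 subr0.
- exact: Dd.
- by rewrite iter_opd x0 raddf0.
Qed.

(** As N = tau^m and j <= m, N kills x; exactness then puts x in the image of tau, and the
    contraction of x is a preimage. *)
Let iker_lift j n (x : C n) : (j <= m)%N -> iker j x ->
  exists2 y, iker j.+1 y & op true n y = x.
Proof.
move=> jm [Dx x0]; have Nx : op false n x = 0.
  by rewrite norm_iter // -(subnK jm) iterD x0 iter_op0.
have E : op true n (con true 0 n x) = x by apply: op_con_ker; split.
by exists (con true 0 n x) => //; split; [exact: Dcon | rewrite iterSr E].
Qed.

(** Counting along 0 -> ker tau -> ker tau^(j+2) -> ker tau^(j+1) -> 0, where tau is onto by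
    [iker_lift]. A cycle is recorded by the class of its image and by the class in ker tau of what
    is left after subtracting a chosen cycle with the same image class. *)
Let iker_card n c j : (j <= m)%N -> homology_card_le d (opker true) n c ->
  homology_card_le d (iker j.+1) n (c ^ j.+1).
Proof.
move=> jm [T1 [f1 [cT1 hf1]]]; elim: j jm => [|j IH] jm.
  exists T1, f1; split; first by rewrite expn1.
  move=> z z' [Dz /= z0] dz [Dz' /= z'0] dz' /hf1 [] // w [Dw w0] dw.
  by exists w.
have [Tj [fj [cTj hfj]]] := IH (ltnW jm).
pose cyc (z : C n.+1) := iker j.+2 z /\ d n z = 0.
(* A chosen cycle above each attained value t, and 0 above the others. *)
pose r (t : Tj) : C n.+1 :=
  if pselect (exists z, cyc z /\ fj (op true _ z) = t) is left h
  then sval (cid h) else 0.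
have rP z : cyc z -> cyc (r (fj (op true _ z))) /\
    fj (op true _ (r (fj (op true _ z)))) = fj (op true _ z).
  rewrite /r => cz; case: pselect => [h|[]]; last by exists z.
  exact: (svalP (cid h)).
have op_cyc z : cyc z -> iker j.+1 (op true _ z) /\ d n (op true _ z) = 0.
  by move=> [[Dz z0] dz]; rewrite -opd dz raddf0; split => //; split;
    [exact: Dop | rewrite -iterSr].
(* The images of z and of the chosen r differ by the boundary of some u; a lift y of u through tau
   puts z - r - d y into ker tau. *)
have aex z : exists y, cyc z ->
    iker j.+2 y /\ opker true (z - r (fj (op true _ z)) - d n.+1 y).
  have [cz|] := pselect (cyc z); last by exists 0.
  have [cr fr] := rP z cz; have [kz dz] := op_cyc z cz; have [kr dr] := op_cyc _ cr.
  have [u ku du] := hfj _ _ kz dz kr dr (esym fr).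
  have [y ky oy] := iker_lift jm ku; exists y => _; split => //; split.
    by apply: DB; [apply: DB; [exact: cz.1.1 | exact: cr.1.1] | apply: Dd; exact: ky.1].
  by rewrite !raddfB opd /= oy du subrr.
have [y hy] := choice aex.
pose a z := z - r (fj (op true _ z)) - d n.+1 (y z).
exists (T1 * Tj)%type, (fun z => (f1 (a z), fj (op true _ z))); split.
  by rewrite card_prod cT1 cTj -expnS.
move=> z z' kz dz kz' dz' [fa fr].
have cz : cyc z by split.
have cz' : cyc z' by split.
have [kyz kaz] := hy z cz.
have [kyz' kaz'] := hy z' cz'.
have da x : cyc x -> d n (a x) = 0.
  move=> cx; have [cr _] := rP x cx.
  by rewrite /a !raddfB dd /= cx.2 cr.2 !subr0.
have [w kw dw] := hf1 _ _ kaz (da z cz) kaz' (da z' cz') fa.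
have [_ kB _] := iker_subcomplex j.+2.
exists (w - (y z' - y z)).
  apply: (kB); last exact: (kB).
  by split; [exact: kw.1 | rewrite iterSr kw.2 iter_op0].
have dB n' (x x' : C n'.+1) : d n' (x - x') = d n' x - d n' x' by exact: raddfB.
rewrite !dB dw fr; set u := d _ (y z); set u' := d _ (y z'); set v := r _.
by rewrite [LHS]addrAC !opprB !addrA !subrK.
Qed.

(** tau^(m+1) = tau N kills D, so D is the last stage of the filtration. *)
Lemma homology_card_le_opker n c : homology_card_le d (opker true) n c ->
  homology_card_le d D n (c ^ m.+1).
Proof.
move=> /(iker_card (leqnn m)) [T [f [cT hf]]]; exists T, f; split => // z z' Dz dz Dz' dz'.
have iD k (x : C k) : D x -> iker m.+1 x.
  by move=> Dx; split => //; rewrite iterS -norm_iter // (op_op true).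
by move=> /(hf _ _ (iD _ _ Dz) dz (iD _ _ Dz') dz') [w [Dw _] dw]; exists w.
Qed.

Lemma acyclic_opker n : acyclic_at d (opker true) n -> acyclic_at d D n.
Proof.
move=> /(acyclic_card1 _ (opker_subcomplex true)) /homology_card_le_opker.
by rewrite exp1n => /(acyclic_card1 _ Dsub).
Qed.

Lemma rose_homology_opker : rose_homology d (opker true) <-> rose_homology d D.
Proof.
split=> [[[c fin] nonac ac]|[[c [T [f [cT hf]]]] nonac ac]].
  split; first by exists (c ^ m.+1)%N; exact: homology_card_le_opker.
    (* Index 0 is homology degree 1: if H_1(D) vanished too, D would be acyclic in all positive
       degrees, and so would ker tau. *)
    move=> ac0; apply: nonac; apply: (@opker_acyclic 0) => // -[|n] // _.
    exact/acyclic_opker/ac.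
  by move=> n n0; exact/acyclic_opker/ac.
have acK b n : (0 < n)%N -> acyclic_at d (opker b) n by exact: opker_acyclic.
split => //; last by move=> n; exact: acK.
  exists c, T, f; split => // z z' kz dz kz' dz' /hf [] //; [exact: kz.1|exact: kz'.1|].
  move=> w Dw dw; apply: (opker_injective (acK _ _ _) _ Dw dw) => //.
  by have [_ + _] := opker_subcomplex true; apply.
by move=> /acyclic_opker.
Qed.

End Smith.

(** * The norm as a power of g - 1 in characteristic p *)

Section PowersMinusOne.
Variables (p : nat) (V : lmodType 'F_p) (g : {linear V -> V}).
Hypothesis pr : prime p.

Let coef m k : 'F_p := (-1) ^+ (m + k) * 'C(m, k)%:R.

Let coefS m k : coef m.+1 k.+1 = coef m k - coef m k.+1.
Proof.
rewrite /coef binS natrD mulrDr addrC addSn addnS !exprS !mulN1r !opprK.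
by rewrite mulNr opprK.
Qed.

Lemma iter_subr1 m x :
  iter m (fun y => g y - y) x = \sum_(0 <= k < m.+1) coef m k *: iter k g x.
Proof.
elim: m => [|m IH]; first by rewrite big_nat1 /coef expr0 mul1r scale1r.
rewrite iterS IH [RHS]big_nat_recl //= linear_sum.
under [in RHS]eq_bigr do rewrite coefS scalerBl.
rewrite sumrB addrCA; congr (_ + _).
  by apply: eq_bigr => k _; rewrite linearZ.
rewrite big_nat_recl // opprD; congr (_ + _).
  by rewrite /coef !addn0 !bin0 exprS !mulr1 -scaleNr mulN1r.
rewrite [in RHS]big_nat_recr //=.
by rewrite [coef m m.+1]/coef bin_small // mulr0 scale0r addr0.
Qed.

(** All coefficients of (g - 1)^(p-1) are 1 mod p: by Pascal's rule neighbouring ones differ by a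
    multiple of some C(p, k) with 0 < k < p, and the top one is 1. The induction descends from the
    top, hence the index p-1-j. *)
Lemma iter_subr1_prime x :
  iter p.-1 (fun y => g y - y) x = \sum_(0 <= k < p) iter k g x.
Proof.
have p0 := prime_gt0 pr.
suff c1 k : (k < p)%N -> coef p.-1 k = 1.
  rewrite iter_subr1 prednK //; apply: eq_big_nat => k /andP[_ kp].
  by rewrite c1 // scale1r.
suff c1 j : (j < p)%N -> coef p.-1 (p.-1 - j) = 1.
  by move=> kp; rewrite -[k](subKn (n := p.-1)) ?c1 //; lia.
elim: j => [_|j IH jp].
  by rewrite subn0 /coef addnn -mul2n exprM sqrrN expr1n expr1n mul1r binn.
rewrite -IH; last exact: ltnW.
have E : (p.-1 - j = (p.-1 - j.+1).+1)%N by lia.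
apply/eqP; rewrite E -subr_eq0 -coefS prednK // /coef.
have /dvdnP[q ->] : (p %| 'C(p, (p.-1 - j.+1).+1))%N by apply: prime_dvd_bin => //; lia.
by rewrite natrM pchar_Fp_0 // !mulr0.
Qed.

End PowersMinusOne.

Lemma sum_Fp (p : nat) (V : nmodType) (F : 'F_p -> V) : prime p ->
  \sum_(u : 'F_p) F u = \sum_(0 <= m < p) F m%:R.
Proof.
move=> pr; have gen q : q = p ->
    \sum_(0 <= m < p) F m%:R = \sum_(0 <= m < q) F m%:R by move=> ->.
rewrite (gen _ (Fp_cast pr)) big_mkord.
by apply: eq_bigr => u _; rewrite natr_Zp.
Qed.

Lemma val_Fp_lt (p : nat) (a : 'F_p) : prime p -> (a < p)%N.
Proof. by move=> pr; have := ltn_ord a; rewrite [X in (_ < X)%N](Fp_cast pr). Qed.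

Lemma val_FpS (p : nat) (a : 'F_p) : prime p -> a != -1 -> (a + 1 : 'F_p) = a.+1 :> nat.
Proof.
move=> pr a1; have ap := val_Fp_lt a pr.
have a1p : (a.+1 < p)%N.
  rewrite ltn_neqAle ap andbT; apply: contraNneq a1 => E.
  have : a.+1%:R = 0 :> 'F_p by rewrite E pchar_Fp_0.
  by rewrite -natr1 natr_Zp => /eqP; rewrite addr_eq0.
by rewrite -{1}[a]natr_Zp natr1 val_Fp_nat // modn_small.
Qed.

Lemma val_Fp_opp1 (p : nat) : prime p -> (-1 : 'F_p) = p.-1 :> nat.
Proof.
move=> pr; have p0 := prime_gt0 pr.
have -> : -1 = p.-1%:R :> 'F_p.
  by apply/eqP; rewrite eq_sym -addr_eq0 natr1 prednK // pchar_Fp_0.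
by rewrite val_Fp_nat // modn_small // prednK.
Qed.

Lemma boundary_iter_Sd (R : realType) (K : comNzRingType) (X : topologicalType)
    n k (c : chain R K X n.+1) :
  boundary (iter k (Sd R K X n.+1) c) = iter k (Sd R K X n) (boundary c).
Proof. by elim: k => //= k <-; rewrite boundary_Sd. Qed.

Lemma boundary_Sdh_iter (R : realType) (K : comNzRingType) (X : topologicalType)
    n k (c : chain R K X n.+1) : boundary c = 0 ->
  boundary (Sdh R K X n.+1 (iter k (Sd R K X n.+1) c)) =
  iter k (Sd R K X n.+1) c - iter k.+1 (Sd R K X n.+1) c.
Proof.
move=> dc; rewrite boundary_Sdh boundary_iter_Sd dc.
have -> : iter k (Sd R K X n) 0 = 0 by elim: k => //= k ->; rewrite linear0.
by rewrite linear0 subr0.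
Qed.

(** * Translation of chains by the group *)

Section TranslationOperators.
Variables (R : realType) (p r : nat) (X : topologicalType).
Variable to : {action 'rV['F_p]_r &-> X}.
Hypothesis pr : prime p.
Hypothesis tocont : acts_by_homeomorphisms to.
Local Notation G := 'rV['F_p]_r.
Local Notation chain n := (chain R 'F_p X n).
Local Notation simplex n := (singular_simplex R X n).

Lemma to_to x (v w : G) : to (to x v) w = to x (v + w).
Proof. by rewrite -total_actM. Qed.

Lemma to0 x : to x (0 : G) = x.
Proof. exact: (total_act1 to). Qed.

Definition transl (v : G) : continuousType X X := ctsmap (@tocont v).

Definition chain_act (v : G) n : {linear chain n -> chain n} := push (transl v).

Lemma spush_transl n (v w : G) (s : simplex n) :
  spush (transl v) (spush (transl w) s) = spush (transl (w + v)) s.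
Proof. by apply/continuousEP => t /=; rewrite to_to. Qed.

Lemma spush_transl0 n (s : simplex n) : spush (transl 0) s = s.
Proof. by apply/continuousEP => t /=; rewrite to0. Qed.

Lemma face_spush (Y : topologicalType) n (f : continuousType X Y) (s : simplex n.+1) k :
  face k (spush f s) = spush f (face k s).
Proof. exact/continuousEP. Qed.

Lemma chain_act_act n (v w : G) (c : chain n) : chain_act v n (chain_act w n c) = chain_act (w + v) n c.
Proof. by apply: push_comp => x /=; rewrite to_to. Qed.

Lemma chain_actC n (v w : G) (c : chain n) : chain_act v n (chain_act w n c) = chain_act w n (chain_act v n c).
Proof. by rewrite !chain_act_act addrC. Qed.

Lemma chain_act0 n (c : chain n) : chain_act 0 n c = c.
Proof. by apply: push_id => x /=; rewrite to0. Qed.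

(** Interpolates between all chains, at i = 0, and the G-invariant ones, at i = r, by imposing
    invariance under one more basis vector at a time. *)
Definition fixed_below (i : nat) n (c : chain n) :=
  forall v : G, (forall j : 'I_r, (i <= j)%N -> v 0 j = 0) -> chain_act v n c = c.

Lemma fixed_below0 n (c : chain n) : fixed_below 0 c.
Proof.
move=> v v0; rewrite (_ : v = 0) ?chain_act0 //.
by apply/rowP => j; rewrite mxE; exact: v0.
Qed.

Definition bd n : {additive chain n.+1 -> chain n} := @boundary R 'F_p X n.

Lemma fixed_below_subcomplex i : subcomplex bd (fixed_below i).
Proof.
split=> [n v _|n x y fx fy v v0|n x fx v v0]; first exact: linear0.
  by rewrite linearB /= fx // fy.
by rewrite /chain_act -boundary_push; congr boundary; exact: fx.
Qed.

Section Step.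
Variable i : 'I_r.
Let delta : G := delta_mx 0 i.
Variable e : nat -> X -> G.
Hypothesis e_to : forall l x v, e l (to x v) = e l x + v.

(** [e l] is equivariant but possibly discontinuous. Reading it at one vertex gives every simplex an
    exponent, even if [e l] varies along the simplex. *)
Definition exponent l n (s : simplex n) : 'F_p := e l (s (vertex R ord0)) 0 i.

Lemma exponent_transl l n v (s : simplex n) :
  exponent l (spush (transl v) s) = exponent l s + v 0 i.
Proof. by rewrite /exponent /= e_to mxE. Qed.

Definition period_op (b : bool) n : {linear chain n -> chain n} :=
  [the {linear _ -> _} of lext (fun s : simplex n =>
    if b then << spush (transl delta) s >> - << s >> : chain n
    else \sum_(u : 'F_p) << spush (transl (u *: delta)) s >>)].

(** With g the translation by delta, write s = g^a s0, where a is the exponent of s and s0 has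
    exponent 0. Then [true] gives (1 + g + ... + g^(a-1)) s0, while [false] sends g^(p-1) s0 to g^p
    s0 = s0 and the other translates to 0: the standard contraction of the periodic resolution of a
    cyclic group. *)
Definition contract (b : bool) l n : {linear chain n -> chain n} :=
  [the {linear _ -> _} of lext (fun s : simplex n =>
    if b then \sum_(0 <= m < exponent l s)
      << spush (transl ((m%:R - exponent l s) *: delta)) s >> : chain n
    else if exponent l s == -1 then << spush (transl delta) s >> else 0)].

Lemma tau_simplex n (s : simplex n) :
  period_op true n << s >> = << spush (transl delta) s >> - << s >>.
Proof. exact: lext_simplex. Qed.

Lemma norm_simplex n (s : simplex n) :
  period_op false n << s >> = \sum_(u : 'F_p) << spush (transl (u *: delta)) s >>.
Proof. exact: lext_simplex. Qed.

Lemma contract_true_simplex l n (s : simplex n) :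
  contract true l n << s >> = \sum_(0 <= m < exponent l s)
      << spush (transl ((m%:R - exponent l s) *: delta)) s >>.
Proof. exact: lext_simplex. Qed.

Lemma contract_false_simplex l n (s : simplex n) : contract false l n << s >> =
  if exponent l s == -1 then << spush (transl delta) s >> else 0.
Proof. exact: lext_simplex. Qed.

Lemma tauE n c : period_op true n c = chain_act delta n c - c.
Proof.
pose f : {linear chain n -> chain n} := GRing.sub_fun (chain_act delta n)
  [the {linear chain n -> chain n} of idfun].
apply: (linear_ext (g := f)) => s /=.
by rewrite tau_simplex push_simplex.
Qed.

Lemma normE n c : period_op false n c = \sum_(u : 'F_p) chain_act (u *: delta) n c.
Proof.
elim/chain_ind: c => [|k s c IH].
  by rewrite linear0 big1 // => u _; rewrite linear0.
rewrite linearP IH norm_simplex scaler_sumr -big_split; apply: eq_bigr => u _.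
by rewrite linearP /= push_simplex.
Qed.

Lemma period_op_chain_act b n v c :
  period_op b n (chain_act v n c) = chain_act v n (period_op b n c).
Proof.
case: b; first by rewrite !tauE linearB /= (chain_actC v delta).
by rewrite !normE linear_sum; apply: eq_bigr => u _; exact: chain_actC.
Qed.

Lemma period_op_boundary b n (c : chain n.+1) :
  period_op b n (boundary c) = boundary (period_op b n.+1 c).
Proof.
case: b; first by rewrite !tauE boundaryB boundary_push.
rewrite !normE raddf_sum; apply: eq_bigr => u _.
by rewrite /= boundary_push.
Qed.

Lemma period_op_fixed b n j (c : chain n) :
  fixed_below j c -> fixed_below j (period_op b n c).
Proof. by move=> fc v v0; rewrite -period_op_chain_act fc. Qed.

Lemma period_op_comp b n (c : chain n) : period_op b n (period_op (~~ b) n c) = 0.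
Proof.
have shift (F : 'F_p -> chain n) : \sum_u F (u + 1) = \sum_u F u.
  by rewrite [RHS](reindex_inj (addIr 1)).
have NT (c' : chain n) : \sum_(u : 'F_p) chain_act (u *: delta) n (chain_act delta n c') =
    \sum_(u : 'F_p) chain_act (u *: delta) n c'.
  rewrite -[RHS]shift; apply: eq_bigr => u _.
  by rewrite chain_act_act scalerDl scale1r addrC.
case: b => /=; last first.
  by rewrite normE tauE; under eq_bigr do rewrite linearB /=; rewrite sumrB NT subrr.
rewrite tauE normE linear_sum /=.
apply/eqP; rewrite subr_eq0 -[eqbRHS]shift; apply/eqP; apply: eq_bigr => u _.
by rewrite chain_act_act scalerDl scale1r.
Qed.

(** For j <= i the vectors in question have i-th coordinate 0, so translating by them preserves the
    exponent and commutes with the contraction. *)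
Lemma contract_fixed b l n j (c : chain n) : (j <= i)%N ->
  fixed_below j c -> fixed_below j (contract b l n c).
Proof.
move=> ji fc v v0; rewrite -[in RHS](fc v v0).
pose f : {linear chain n -> chain n} := chain_act v n \o contract b l n.
pose f' : {linear chain n -> chain n} := contract b l n \o chain_act v n.
apply: (linear_ext (f := f) (g := f')) => s /=; rewrite push_simplex.
have ev : exponent l (spush (transl v) s) = exponent l s.
  by rewrite exponent_transl v0 // addr0.
case: b @f @f' => _ _.
  rewrite !contract_true_simplex ev linear_sum; apply: eq_bigr => m _ /=.
  by rewrite push_simplex !spush_transl addrC.
rewrite !contract_false_simplex ev; case: ifP => _; last by rewrite linear0.
by rewrite push_simplex !spush_transl addrC.
Qed.

Let f l n (s : simplex n) (m : nat) : chain n :=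
  << spush (transl ((m%:R - exponent l s) *: delta)) s >>.

Let f_exponent l n (s : simplex n) : f l s (exponent l s) = << s >>.
Proof. by rewrite /f natr_Zp subrr scale0r spush_transl0. Qed.

Let fS l n (s : simplex n) m :
  << spush (transl delta) (spush (transl ((m%:R - exponent l s) *: delta)) s) >> =
  f l s m.+1.
Proof.
by rewrite /f spush_transl -{2}[delta]scale1r -scalerDl addrAC natr1.
Qed.

Let f_transl l n (s : simplex n) m :
  << spush (transl ((m%:R - exponent l (spush (transl delta) s)) *: delta))
    (spush (transl delta) s) >> = f l s m :> chain n.
Proof.
rewrite /f spush_transl -{1}[delta]scale1r -scalerDl exponent_transl mxE !eqxx.
by rewrite opprD addrCA subrKC.
Qed.

(** For s = g^a s0 the first term telescopes to s - s0; in the norm of s only the translate of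
    exponent -1 survives [contract false], and it gives s0. *)
Lemma tau_contract l n (c : chain n) :
  period_op true n (contract true l n c) +
    contract false l n (period_op false n c) = c.
Proof.
pose h : {linear chain n -> chain n} := GRing.add_fun
  (period_op true n \o contract true l n) (contract false l n \o period_op false n).
apply: (linear_ext (f := h)
  (g := [the {linear chain n -> chain n} of idfun])) => s {c}.
have -> : h << s >> = period_op true n (contract true l n << s >>) +
  contract false l n (period_op false n << s >>) by [].
rewrite contract_true_simplex linear_sum.
under eq_bigr do rewrite tau_simplex fS.
rewrite telescope_sumr // f_exponent norm_simplex linear_sum.
under [X in _ + X]eq_bigr => u _ do rewrite contract_false_simplex exponent_transl
  !mxE !eqxx mulr1 spush_transl.
rewrite -big_mkcond /= (big_pred1 (- 1 - exponent l s)) /=; last first.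
  by move=> u; rewrite [RHS]eq_sym subr_eq eq_sym addrC.
have -> : (-1 - exponent l s) *: delta + delta = (0%:R - exponent l s) *: delta.
  by rewrite -{2}[delta]scale1r -scalerDl addrAC addNr.
by rewrite -/(f l s 0) subrK.
Qed.

Let deltaS m : delta + m%:R *: delta = m.+1%:R *: delta.
Proof. by rewrite -{1}[delta]scale1r -scalerDl addrC natr1. Qed.

(** For s = g^a s0, passing from s to g s adds the summand g^a s0 = s to [contract true]. The
    exception is a = p-1, where the sum for g s is empty and the norm of s0 makes up the
    difference. *)
Lemma norm_contract l n (c : chain n) :
  period_op false n (contract false l n c) +
    contract true l n (period_op true n c) = c.
Proof.
pose h : {linear chain n -> chain n} := GRing.add_fun
  (period_op false n \o contract false l n) (contract true l n \o period_op true n).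
apply: (linear_ext (f := h)
  (g := [the {linear chain n -> chain n} of idfun])) => s {c}.
have -> : h << s >> = period_op false n (contract false l n << s >>) +
  contract true l n (period_op true n << s >>) by [].
rewrite tau_simplex linearB /= !contract_true_simplex.
under [X in _ + (X - _)]eq_bigr do rewrite f_transl.
have es : exponent l (spush (transl delta) s) = exponent l s + 1.
  by rewrite exponent_transl mxE !eqxx.
rewrite contract_false_simplex es; case: eqP => [e1|/eqP e1].
  rewrite e1 addNr big_geq // sub0r norm_simplex sum_Fp // val_Fp_opp1 //.
  rewrite -[X in index_iota 0 X](prednK (prime_gt0 pr)) big_nat_recr //=.
  rewrite addrAC -sumrB big1 ?add0r => [|m _].
    by rewrite spush_transl deltaS prednK ?prime_gt0 // pchar_Fp_0 // scale0r
      spush_transl0.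
  by rewrite spush_transl deltaS opprK natr1 subrr.
rewrite linear0 add0r val_FpS // big_nat_recr //= -/(f l s _) f_exponent.
by rewrite addrAC subrr add0r.
Qed.

Lemma period_op_contract b l n (c : chain n) :
  period_op b n (contract b l n c) +
    contract (~~ b) l n (period_op (~~ b) n c) = c.
Proof. by case: b; [exact: tau_contract | exact: norm_contract]. Qed.

Lemma iter_chain_act m n c : iter m (chain_act delta n) c = chain_act (m%:R *: delta) n c.
Proof.
elim: m => [|m IH]; first by rewrite scale0r chain_act0.
by rewrite iterS IH chain_act_act -{2}[delta]scale1r -scalerDl natr1.
Qed.

Lemma norm_iter_tau n (c : chain n) :
  period_op false n c = iter p.-1 (period_op true n) c.
Proof.
have -> : iter p.-1 (period_op true n) c =
    iter p.-1 (fun y => chain_act delta n y - y) c.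
  by apply: eq_iter => y; exact: tauE.
rewrite (iter_subr1_prime _ pr) normE sum_Fp //.
by apply: eq_bigr => m _; rewrite iter_chain_act.
Qed.

Let padd b n : {additive chain n -> chain n} := period_op b n.

Let cadd b l n : {additive chain n -> chain n} := contract b l n.

(** A vector supported on the coordinates up to i is one supported below i plus a multiple of delta,
    so the extra invariance is invariance under delta alone. *)
Lemma fixed_belowS n (c : chain n) :
  fixed_below i.+1 c <-> opker (@fixed_below i) padd true c.
Proof.
split=> [fc|[fc /= /eqP]].
  split; first by move=> v v0; apply: fc => j /ltnW; exact: v0.
  rewrite /= tauE fc ?subrr // => j ij; rewrite mxE eqxx /=.
  by case: eqP ij => // ->; rewrite ltnn.
rewrite tauE subr_eq0 => /eqP gc v v0.
rewrite -[v](subrK (v 0 i *: delta)) -chain_act_act fc => [|j].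
  rewrite -[v 0 i]natr_Zp -iter_chain_act; elim: (v 0 i : nat) => //= m ->; exact: gc.
rewrite !mxE eqxx /= leq_eqVlt => /orP[/eqP/val_inj <-|ij].
  by rewrite eqxx mulr1 subrr.
rewrite v0 // sub0r; case: eqP => [E|_]; last by rewrite mulr0 oppr0.
by move: ij; rewrite E ltnn.
Qed.

Variables (M : nat) (U : nat -> set X).
Hypothesis Uopen : forall l, open (U l).
Hypothesis Ucover : forall x, exists2 l, (l < M)%N & U l x.
Hypothesis Uinv : forall l x v, U l x -> U l (to x v).
Hypothesis Uconst : forall l n (s : simplex n), simplex_in (U l) s ->
  forall t u, e l (s t) = e l (s u).

Let sm l n (c : chain n) := chain_in
  (fun s => exists m, [/\ (l <= m)%N, (m < M)%N & simplex_in (U m) s]) c.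

Lemma exponent_face l n (s : simplex n.+1) k :
  simplex_in (U l) s -> exponent l (face k s) = exponent l s.
Proof. by move=> Us; rewrite /exponent /= (Uconst Us _ (vertex R ord0)). Qed.

(** Inside U l the coordinate [e l] is constant along the simplex, so the faces have its exponent
    and are moved by the same translations. *)
Lemma contract_boundary_simplex b l n (s : simplex n.+1) : simplex_in (U l) s ->
  contract b l n (boundary << s >>) = boundary (contract b l n.+1 << s >>).
Proof.
move=> Us; rewrite boundary_simplex linear_sum; case: b => /=.
  rewrite contract_true_simplex raddf_sum.
  under [RHS]eq_bigr do rewrite /= boundary_simplex.
  rewrite exchange_big; apply: eq_bigr => k _.
  rewrite linearZ /= contract_true_simplex exponent_face // scaler_sumr.
  by apply: eq_bigr => m _; rewrite face_spush.
rewrite contract_false_simplex; case: ifP => es; last first.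
  rewrite raddf0 big1 // => k _.
  by rewrite linearZ /= contract_false_simplex exponent_face // es scaler0.
rewrite boundary_simplex; apply: eq_bigr => k _.
by rewrite linearZ /= contract_false_simplex exponent_face // es face_spush.
Qed.

Lemma contract_in b l n m (c : chain n) :
  chain_in (simplex_in (U m)) c -> chain_in (simplex_in (U m)) (contract b l n c).
Proof.
apply: chain_in_linear => s Us.
have Ut v : simplex_in (U m) (spush (transl v) s) by move=> t; exact/Uinv/Us.
case: b.
  rewrite contract_true_simplex; apply: chain_in_sum => k _.
  by apply: chain_in_simplex; exact: Ut.
rewrite contract_false_simplex; case: ifP => _; last exact: chain_in0.
by apply: chain_in_simplex; exact: Ut.
Qed.

Let sm_con b l n (c : chain n.+1) : sm l c ->
  sm l.+1 (contract b l n (boundary c) - boundary (contract b l n.+1 c)).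
Proof.
pose h : {linear chain n.+1 -> chain n} := GRing.sub_fun
  (contract b l n \o [the {linear _ -> _} of @boundary R 'F_p X n])
  ([the {linear _ -> _} of @boundary R 'F_p X n] \o contract b l n.+1).
apply: (chain_in_linear (f := h)) => s [m [lm mM Us]].
have -> : h << s >> = contract b l n (boundary << s >>) -
  boundary (contract b l n.+1 << s >>) by [].
move: lm; rewrite leq_eqVlt => /orP[/eqP lm|lm].
  by rewrite contract_boundary_simplex ?lm // subrr; exact: chain_in0.
apply: (chain_in_sub (P := simplex_in (U m))); first by move=> s' Us'; exists m.
apply: chain_inB.
  by apply: contract_in; apply: boundary_in; exact: chain_in_simplex.
by apply: boundary_in; apply: contract_in; exact: chain_in_simplex.
Qed.

Let natural_opker b n m (h : {linear chain n -> chain m}) c :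
  (forall v x, chain_act v m (h x) = h (chain_act v n x)) ->
  opker (@fixed_below i) padd b c -> opker (@fixed_below i) padd b (h c).
Proof.
move=> hv [fc bc]; split; first by move=> v v0; rewrite hv fc.
suff E : period_op b m (h c) = h (period_op b n c).
  by rewrite [LHS]E -(linear0 h); congr (h _); exact: bc.
case: (b); first by rewrite !tauE linearB /= hv.
by rewrite !normE linear_sum; apply: eq_bigr => u _; rewrite hv.
Qed.

Let Sd_opker b n k c : opker (@fixed_below i) padd b c ->
  opker (@fixed_below i) padd b (iter k (Sd R 'F_p X n) c).
Proof.
move=> kc; elim: k => //= k IH; apply: natural_opker => // v x.
by rewrite /chain_act Sd_push.
Qed.

Let sm_subdiv b n (z : chain n.+1) : opker (@fixed_below i) padd b z ->
  bd n z = 0 -> exists z' v, [/\ opker (@fixed_below i) padd b z', bd n z' = 0,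
    sm 0 z', opker (@fixed_below i) padd b v & bd n.+1 v = z - z'].
Proof.
move=> kz dz; pose V (l : 'I_M) := U l.
have [l|x|k hk] := @small_subdivision R 'F_p X _ V n.+1 z; first exact: Uopen.
  by have [l lM Ul] := Ucover x; exists (Ordinal lM).
have subK : subcomplex bd (opker (@fixed_below i) padd b).
  apply: opker_subcomplex; first exact: fixed_below_subcomplex.
  by move=> b' m x; exact: period_op_boundary.
suff [v kv dv] : exists2 v, opker (@fixed_below i) padd b v &
    bd n.+1 v = z - iter k (Sd R 'F_p X n.+1) z.
  exists (iter k (Sd R 'F_p X n.+1) z), v; split => //; first exact: Sd_opker.
    rewrite /bd /= boundary_iter_Sd; rewrite /bd /= in dz; rewrite dz.
    by elim: (k) => //= k' ->; rewrite linear0.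
  apply: chain_in_sub (hk k (leqnn k)) => s [l Vs].
  by exists l; split => //; exact: ltn_ord.
elim: k {hk} => [|k [v kv dv]].
  by exists 0; [have [+ _ _] := subK; apply | rewrite raddf0 subrr].
exists (v + Sdh R 'F_p X n.+1 (iter k (Sd R 'F_p X n.+1) z)).
  apply: (subcomplexD subK) => //; apply: natural_opker; last exact: Sd_opker.
  by move=> w x; rewrite /chain_act Sdh_push.
rewrite raddfD dv /= boundary_Sdh_iter //.
by rewrite addrA subrK.
Qed.

Let sm_eq0 n (c : chain n) : sm M c -> c = 0.
Proof.
move=> smc; apply/eqP; rewrite -dom_eq0; case E : (dom c) => [|s ss] //.
have [|m [Mm mM _]] := smc s; first by rewrite E mem_head.
by move: (leq_ltn_trans Mm mM); rewrite ltnn.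
Qed.

Lemma rose_homology_fixed_belowS :
  rose_homology bd (@fixed_below i.+1) <-> rose_homology bd (@fixed_below i).
Proof.
have -> : @fixed_below i.+1 = opker (@fixed_below i) padd true.
  by apply: functional_extensionality_dep => n; apply/funext => c;
    apply/propext; exact: fixed_belowS.
apply: (@rose_homology_opker _ bd _ _ _ padd _ _ _ cadd _ _ M (@sm) _ _ _ _ p.-1).
- by move=> n x; exact: boundary_boundary.
- exact: fixed_below_subcomplex.
- by move=> b n x; exact: period_op_boundary.
- by move=> b n x; exact: period_op_fixed.
- by move=> b n x _; exact: period_op_comp.
- by move=> b l n x; exact: contract_fixed.
- by move=> b l n x _; exact: period_op_contract.
- by move=> b l n x _; exact: sm_con.
- by move=> l n x; exact: chain_inN.
- exact: sm_subdiv.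
- exact: sm_eq0.
- by move=> n x _; exact: norm_iter_tau.
Qed.

End Step.
End TranslationOperators.

(** * Free actions and orbit spaces *)

Section FreeAction.
Variables (p r : nat) (X : topologicalType).
Variable to : {action 'rV['F_p]_r &-> X}.
Hypothesis tocont : acts_by_homeomorphisms to.
Hypothesis tofree : acts_freely to.
Local Notation G := 'rV['F_p]_r.

Lemma to_inj x (v w : G) : to x v = to x w -> v = w.
Proof.
move=> vw; have h : to x (v - w) = x by rewrite -to_to vw to_to subrr to0.
by apply/eqP; rewrite -subr_eq0; apply/eqP; exact: tofree h.
Qed.

(** The translates of W are then pairwise disjoint: an open wandering set is a sheet over an evenly
    covered subset of the orbit space. *)
Definition wandering (W : set X) := forall x (v : G), W x -> W (to x v) -> v = 0.

(** Freeness and the Hausdorff property separate x from each translate with v nonzero; G is finite,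
    so the neighbourhoods found can be intersected. *)
Lemma wandering_nbhs x : hausdorff_space X ->
  exists W, [/\ open W, W x & wandering W].
Proof.
move=> hX.
have sep (v : G) : exists W, [/\ open W, W x &
    v != 0 -> forall y, W y -> ~ W (to y v)].
  have [->|v0] := eqVneq v 0; first by exists setT; split=> //; exact: openT.
  have xv : x != to x v by apply: contra v0 => /eqP xv; apply/eqP/(@tofree v x).
  move: (hX); rewrite open_hausdorff => /(_ _ _ xv) [[A B]] /= [xA xvB] [oA oB AB].
  exists (A `&` (to^~ v @^-1` B)); split.
  - by apply: openI => //; apply: open_comp oB => y _; exact: tocont.
  - by split; exact: set_mem.
  - move=> _ y [_ Bxv] [Axv _].
    by move/eqP/seteqP : AB => [+ _] => /(_ (to y v)); apply.
have [W hW] := choice sep; exists (\bigcap_v W v); split.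
- rewrite openE => y Wy; have nW v : nbhs y (W v).
    by apply: open_nbhs_nbhs; split; [have [] := hW v | exact: Wy].
  have := filter_forall (nbhs_filter y) nW; rewrite /interior /=.
  by apply: filterS => z Wz v _; exact: Wz.
- by move=> v _; have [] := hW v.
- move=> y v Wy Wyv; apply: contrapT => /eqP v0; have [_ _ /(_ v0)] := hW v.
  by move=> /(_ y (Wy v Logic.I)); apply; exact: Wyv.
Qed.

Local Notation Y := (orbit_space to).

Definition orbit_map (x : X) : Y := (\pi_({eq_quot orbit_equiv to}) x)%qT.

Lemma orbit_mapP x y : orbit_map x = orbit_map y <-> exists v, to x v = y.
Proof.
split=> [/eqmodP/existsP[v /eqP]|[v xv]]; first by exists v.
by apply/eqmodP/existsP; exists v; apply/eqP.
Qed.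

Lemma orbit_map_transl x v : orbit_map (to x v) = orbit_map x.
Proof. by apply/esym/orbit_mapP; exists v. Qed.

Definition orbit_repr (y : Y) : X := repr y.

Lemma orbit_reprK y : orbit_map (orbit_repr y) = y.
Proof. exact: reprK. Qed.

Lemma orbit_map_continuous : continuous orbit_map.
Proof. exact: pi_continuous. Qed.

Lemma orbit_map_open (W : set X) : open W -> open (orbit_map @` W).
Proof.
move=> oW; suff : open (orbit_map @^-1` (orbit_map @` W)) by [].
rewrite openE => y [x Wx /orbit_mapP[v xv]].
have Wyv : W (to y (- v)) by rewrite -xv to_to subrr to0.
have : nbhs y (to^~ (- v) @^-1` W).
  by apply: (@tocont (- v) y); exact: open_nbhs_nbhs.
rewrite /interior /=; apply: filterS => z Wz.
by exists (to z (- v)) => //; exact: orbit_map_transl.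
Qed.

(* The points of orbits meeting W, or the chosen representatives of the others:
   exactly one point in each orbit when W is wandering. *)
Definition slice (W : set X) : set X :=
  [set x | W x \/ (forall v, ~ W (to x v)) /\ x = orbit_repr (orbit_map x)].

Lemma slice_exists W x : exists v, slice W (to x (- v)).
Proof.
have [[v Wv]|nW] := pselect (exists v, W (to x v)).
  by exists (- v); rewrite opprK; left.
have /orbit_mapP[v xv] : orbit_map x = orbit_map (orbit_repr (orbit_map x)).
  by rewrite orbit_reprK.
exists (- v); rewrite opprK; right; split; last by rewrite orbit_map_transl.
by move=> w Ww; apply: nW; exists (v + w); rewrite -to_to.
Qed.

Lemma slice_unique W x v w : wandering W ->
  slice W (to x (- v)) -> slice W (to x (- w)) -> v = w.
Proof.
move=> wW; have xvw u u' : to (to x u) (u' - u) = to x u'.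
  by rewrite to_to addrC subrK.
move=> [Wv|[nWv Ev]] [Ww|[nWw Ew]].
- have := wW _ (- w - - v) Wv; rewrite xvw => /(_ Ww) /eqP.
  by rewrite opprK addrC subr_eq0 => /eqP.
- by case: (nWw (- v - - w)); rewrite xvw.
- by case: (nWv (- w - - v)); rewrite xvw.
- apply: oppr_inj; apply: (@to_inj x).
  by rewrite Ev Ew !orbit_map_transl.
Qed.

(** For wandering W it is equivariant on all of X, but for open W its local constancy is only
    ensured on the saturation of W; elsewhere it follows the arbitrary [orbit_repr]. *)
Definition slice_coord (W : set X) (x : X) : G := sval (cid (slice_exists W x)).

Lemma slice_coordP W x v : wandering W -> slice W (to x (- v)) -> slice_coord W x = v.
Proof. by move=> wW sv; apply: (slice_unique wW) sv; exact: (svalP (cid (slice_exists W x))). Qed.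

Lemma slice_coord_to W x v : wandering W -> slice_coord W (to x v) = slice_coord W x + v.
Proof.
move=> wW; apply: slice_coordP => //.
by rewrite to_to opprD addrCA subrr addr0; exact: (svalP (cid (slice_exists W x))).
Qed.

Lemma slice_coord_near (W : set X) x v : open W -> wandering W -> W (to x (- v)) ->
  \forall y \near x, slice_coord W y = v.
Proof.
move=> oW wW Wx; have : nbhs x (to^~ (- v) @^-1` W).
  by apply: (@tocont (- v) x); exact: open_nbhs_nbhs.
by apply: filterS => y Wy; apply: slice_coordP => //; left.
Qed.

Definition saturation (W : set X) : set X := [set x | exists v, W (to x v)].

Lemma saturation_open W : open W -> open (saturation W).
Proof.
move=> oW; rewrite openE => x [v Wv]; rewrite /interior /=.
have : nbhs x (to^~ v @^-1` W) by apply: (@tocont v x); exact: open_nbhs_nbhs.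
by apply: filterS => y Wy; exists v.
Qed.

Lemma saturation_inv W x v : saturation W x -> saturation W (to x v).
Proof. by move=> [w Ww]; exists (w - v); rewrite to_to addrC subrK. Qed.

Lemma slice_coord_const (R : realType) (W : set X) n (s : singular_simplex R X n) :
  open W -> wandering W -> simplex_in (saturation W) s ->
  forall t u, slice_coord W (s t) = slice_coord W (s u).
Proof.
move=> oW wW Ws; apply: (simplex_locally_constant (f := slice_coord W \o s)) => t /=.
have [v Wv] := Ws t; have Wv' : W (to (s t) (- - v)) by rewrite opprK.
have near_st := slice_coord_near oW wW Wv'.
rewrite (nbhs_singleton near_st).
exact: (@cts_fun _ _ s t _ near_st).
Qed.

Lemma wandering_cover : hausdorff_space X -> compact [set: X] ->
  exists (M : nat) (W : nat -> set X), (forall l, open (W l) /\ wandering (W l)) /\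
    forall x, exists2 l, (l < M)%N & saturation (W l) x.
Proof.
move=> hX cX; have [W hW] := choice (fun x => wandering_nbhs x hX).
have [[x0 _]|nX] := pselect (exists x : X, True); last first.
  exists 0%N, (fun=> set0); split; first by split=> [|x v //]; exact: open0.
  by move=> x; case: nX; exists x.
(* The point x0 makes X pointed for the finite subcover criterion and is the default of [nth]; an
   empty X has been covered by M = 0 sets. *)
pose T : ptopologicalType := HB.pack X (isPointed.Build X x0).
have : @compact T [set: T] by exact: cX.
rewrite compact_cover => cT; have [||D _ cD] := cT X setT W.
- by move=> x _; have [] := hW x.
- by move=> x _; exists x => //; have [] := hW x.
exists (size (finmap.enum_fset D)), (fun l => W (nth x0 (finmap.enum_fset D) l)).
split=> [l|x]; first by have [] := hW (nth x0 (finmap.enum_fset D) l).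
have [y yD Wyx] := cD x Logic.I; exists (index y (finmap.enum_fset D)).
  by rewrite index_mem.
by exists 0; rewrite to0 nth_index.
Qed.

Lemma rose_homology_invariants (R : realType) : prime p ->
  hausdorff_space X -> compact [set: X] ->
  rose_homology (@bd R p X) (@fixed_below R p r X to tocont r) <->
  rose_homology (@bd R p X) (fun n c => True).
Proof.
move=> pr hX cX; have [M [W [hW cW]]] := wandering_cover hX cX.
suff H i : (i <= r)%N ->
    rose_homology (@bd R p X) (@fixed_below R p r X to tocont i) <->
    rose_homology (@bd R p X) (fun n c => True) by exact: H.
elim: i => [_|i IH ir].
  have -> // : @fixed_below R p r X to tocont 0 = fun n c => True.
  apply: functional_extensionality_dep => n; apply/funext => c; apply/propext.
  by split=> // _; exact: fixed_below0.
apply: iff_trans (IH (ltnW ir)).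
apply: (@rose_homology_fixed_belowS R p r X to pr tocont (Ordinal ir)
  (fun l => slice_coord (W l)) _ M (fun l => saturation (W l))).
- by move=> l x v; apply: slice_coord_to; have [] := hW l.
- by move=> l; apply: saturation_open; have [] := hW l.
- exact: cW.
- by move=> l x v; exact: saturation_inv.
- by move=> l n s Ws; have [oW wW] := hW l; exact: slice_coord_const.
Qed.

End FreeAction.

(** * Transfer between the orbit space and invariant chains *)

Section Transfer.
Variables (R : realType) (p r : nat) (X : topologicalType).
Variable to : {action 'rV['F_p]_r &-> X}.
Hypothesis tocont : acts_by_homeomorphisms to.
Hypothesis tofree : acts_freely to.
Hypothesis hX : hausdorff_space X.
Local Notation G := 'rV['F_p]_r.
Local Notation Y := (orbit_space to).
Local Notation chain X n := (chain R 'F_p X n).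
Local Notation simplex X n := (singular_simplex R X n).

Definition orbit_proj : continuousType X Y := ctsmap (@orbit_map_continuous p r X to).

Definition liftable n (s : simplex Y n) := exists s', spush orbit_proj s' = s.

Lemma liftable_face n (s : simplex Y n.+1) k : liftable s -> liftable (face k s).
Proof. by move=> [s' <-]; exists (face k s'); rewrite face_spush. Qed.

(** Two lifts differ at t by some v t. A wandering neighbourhood shows that v is locally constant,
    hence constant on the simplex. *)
Lemma lift_unique n (s s' : simplex X n) :
  spush orbit_proj s = spush orbit_proj s' ->
  exists v, s' = spush (transl tocont v) s.
Proof.
move=> ss'; have orb t : exists v, to (s t) v = s' t.
  by apply/orbit_mapP; have /continuousEP := ss'; apply.
have [v hv] := choice orb.
have vc := simplex_locally_constant (f := v).
exists (v (vertex R ord0)); apply/continuousEP => t /=.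
rewrite -(vc _ t) ?hv // => {}t.
have [W [oW Wt wW]] := wandering_nbhs tocont tofree (s t) hX.
have n1 : nbhs t (s @^-1` W).
  by apply: (@cts_fun _ _ s t); apply: open_nbhs_nbhs.
have n2 : nbhs t (s' @^-1` (to^~ (- v t) @^-1` W)).
  apply: (@cts_fun _ _ s' t); apply: (@tocont (- v t)); apply: open_nbhs_nbhs.
  by split => //; rewrite -hv to_to subrr to0.
apply: filterS2 n1 n2 => u /= Wu Wu'.
have := wW (s u) (v u - v t) Wu; rewrite -to_to hv => /(_ Wu') /eqP.
by rewrite subr_eq0 => /eqP.
Qed.

(** W meets each orbit at most once, so its points give a section over the image of W; the section
    is continuous because the orbit map is open. *)
Lemma small_liftable (W : set X) n (s : simplex Y n) :
  open W -> wandering to W -> simplex_in (orbit_map to @` W) s -> liftable s.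
Proof.
move=> oW wW Ws.
have /choice[s' hs'] t : exists x, W x /\ orbit_map to x = s t.
  by have [x Wx xs] := Ws t; exists x.
have cs' : continuous s'.
  move=> t A; rewrite nbhsE => -[B [oB Bt] BA].
  have [Wt st] := hs' t.
  have : nbhs (s t) (orbit_map to @` (B `&` W)).
    apply: open_nbhs_nbhs; split; first by apply: orbit_map_open => //; exact: openI.
    by exists (s' t).
  move=> /(@cts_fun _ _ s t) nst; apply: (@filterS _ (nbhs t) _ _ _ _ nst) => u [x [Bx Wx] xs].
  have [Wu su] := hs' u; apply: BA.
  move: xs; rewrite -su => /orbit_mapP[v xv].
  by rewrite -xv (wW x v) ?to0 // xv.
exists (ctsmap cs'); apply/continuousEP => t /=.
by have [_] := hs' t.
Qed.

Lemma iter_Sd_liftable n (c : chain Y n) :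
  exists k, chain_in (@liftable n) (iter k (Sd R 'F_p Y n) c).
Proof.
have [W hW] := choice (fun x => wandering_nbhs tocont tofree x hX).
have [x|y|k hk] := @small_subdivision R 'F_p Y X
    (fun x => orbit_map to @` W x) n c.
- by apply: orbit_map_open => //; have [] := hW x.
- exists (orbit_repr y), (orbit_repr y); last exact: orbit_reprK.
  by have [] := hW (orbit_repr y).
exists k; apply: chain_in_sub (hk k (leqnn k)) => s [x Ws].
by have [oW _ wW] := hW x; exact: small_liftable Ws.
Qed.

Lemma push_liftable n (s : simplex Y n) m (c : Defs.chain R 'F_p (@std_simplex R n) m) :
  liftable s -> chain_in (@liftable m) (push s c).
Proof.
move=> [s' <-]; apply: (chain_in_linear (P := fun=> True)) => // u _.
rewrite push_simplex; apply: chain_in_simplex; exists (spush s' u).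
exact/continuousEP.
Qed.

Lemma Sd_liftable n (c : chain Y n) :
  chain_in (@liftable n) c -> chain_in (@liftable n) (Sd R 'F_p Y n c).
Proof.
by apply: chain_in_linear => s ls; rewrite Sd_simplex; exact: push_liftable.
Qed.

Lemma Sdh_liftable n (c : chain Y n) :
  chain_in (@liftable n) c -> chain_in (@liftable n.+1) (Sdh R 'F_p Y n c).
Proof.
by apply: chain_in_linear => s ls; rewrite Sdh_simplex; exact: push_liftable.
Qed.

Definition orbit_sum n (s : simplex X n) : chain X n :=
  \sum_(v : G) << spush (transl tocont v) s >>.

Lemma orbit_sum_transl n v (s : simplex X n) :
  orbit_sum (spush (transl tocont v) s) = orbit_sum s.
Proof.
rewrite /orbit_sum [RHS](reindex_inj (addrI v)); apply: eq_bigr => w _.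
by rewrite spush_transl.
Qed.

(** The choice of lift is harmless by [lift_unique]. The default 0 confines the chain map property
    to liftable chains, which subdivision always reaches; lifting of arbitrary simplices is never
    invoked. *)
Definition transfer n : {linear chain Y n -> chain X n} :=
  [the {linear _ -> _} of lext (fun s : simplex Y n =>
    if pselect (liftable s) is left h then orbit_sum (sval (cid h)) else 0)].

Lemma transfer_proj n (s : simplex X n) :
  transfer n << spush orbit_proj s >> = orbit_sum s.
Proof.
rewrite /transfer /= lext_simplex; case: pselect => [h|[]]; last by exists s.
have /esym/lift_unique[v ->] := svalP (cid h).
by rewrite orbit_sum_transl.
Qed.

Lemma boundary_orbit_sum n (s : simplex X n.+1) : boundary (orbit_sum s) =
  \sum_(i < n.+2) (-1) ^+ i *: orbit_sum (face i s).
Proof.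
rewrite /orbit_sum raddf_sum.
under eq_bigr do rewrite /= boundary_simplex.
rewrite exchange_big; apply: eq_bigr => k _; rewrite scaler_sumr.
by apply: eq_bigr => v _; rewrite face_spush.
Qed.

Lemma boundary_transfer n (c : chain Y n.+1) : chain_in (@liftable n.+1) c ->
  boundary (transfer n.+1 c) = transfer n (boundary c).
Proof.
pose f : {linear chain Y n.+1 -> chain X n} :=
  [the {linear _ -> _} of @boundary R 'F_p X n] \o transfer n.+1.
pose g : {linear chain Y n.+1 -> chain X n} :=
  transfer n \o [the {linear _ -> _} of @boundary R 'F_p Y n].
apply: (linear_eq_in (f := f) (g := g)) => s [s' <-].
have -> : f << spush orbit_proj s' >> =
  boundary (transfer n.+1 << spush orbit_proj s' >>) by [].
have -> : g << spush orbit_proj s' >> =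
  transfer n (boundary << spush orbit_proj s' >>) by [].
rewrite transfer_proj boundary_orbit_sum boundary_simplex linear_sum.
by apply: eq_bigr => i _; rewrite linearZ face_spush transfer_proj.
Qed.

Lemma chain_act_orbit_sum n v (s : simplex X n) :
  chain_act R tocont v n (orbit_sum s) = orbit_sum s.
Proof.
rewrite /orbit_sum linear_sum [RHS](reindex_inj (addIr v)).
by apply: eq_bigr => w _; rewrite /= push_simplex spush_transl.
Qed.

Local Notation invariant n c := (@fixed_below R p r X to tocont r n c).

Lemma invariantP n (c : chain X n) : invariant n c <-> forall v, chain_act R tocont v n c = c.
Proof.
split=> [ic v|ic v _]; last exact: ic.
by apply: ic => j; rewrite leqNgt ltn_ord.
Qed.

Lemma transfer_invariant n (c : chain Y n) : invariant n (transfer n c).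
Proof.
apply/invariantP => v.
pose f : {linear chain Y n -> chain X n} := chain_act R tocont v n \o transfer n.
apply: (linear_ext (f := f) (g := transfer n)) => s.
have -> : f << s >> = chain_act R tocont v n (transfer n << s >>) by [].
rewrite /transfer /= lext_simplex; case: pselect => [h|_]; last exact: linear0.
exact: chain_act_orbit_sum.
Qed.

(* A set-theoretic section: it selects one simplex in each orbit. *)
Let e (x : X) : G := slice_coord to set0 x.

Let e_to x v : e (to x v) = e x + v.
Proof. by apply: slice_coord_to. Qed.

Let es n (s : simplex X n) := e (s (vertex R ord0)).

Let es_transl n v (s : simplex X n) : es (spush (transl tocont v) s) = es s + v.
Proof. exact: e_to. Qed.

Let select v n : {linear chain X n -> chain X n} := [the {linear _ -> _} of
  lext (fun s : simplex X n => if es s == v then << s >> : chain X n else 0)].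

Let selectE v n s : select v n << s >> = if es s == v then << s >> else 0.
Proof. exact: lext_simplex. Qed.

(** Projecting whole orbits would multiply by p^r, which is 0 mod p for r > 0; so only the simplex
    of coordinate 0 in each orbit is projected. *)
Definition descend n : {linear chain X n -> chain Y n} := push orbit_proj \o select 0 n.

Lemma descendE n s : descend n << s >> = if es s == 0 then << spush orbit_proj s >> else 0.
Proof.
rewrite /descend /= lext_simplex; case: ifP => _; last by rewrite linear0.
exact: lext_simplex.
Qed.

Lemma descend_liftable n c : chain_in (@liftable n) (descend n c).
Proof.
apply: (chain_in_linear (P := fun=> True)) => // s _; rewrite descendE.
case: ifP => _; last exact: chain_in0.
by apply: chain_in_simplex; exists s.
Qed.

Lemma transferK n (c : chain Y n) : chain_in (@liftable n) c ->
  descend n (transfer n c) = c.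
Proof.
pose f : {linear chain Y n -> chain Y n} := descend n \o transfer n.
apply: (linear_eq_in (f := f) (g := [the {linear chain Y n -> chain Y n} of idfun])).
move=> s [s' <-].
have -> : f << spush orbit_proj s' >> =
  descend n (transfer n << spush orbit_proj s' >>) by [].
rewrite transfer_proj linear_sum.
under eq_bigr do rewrite descendE es_transl.
rewrite -big_mkcond /= (big_pred1 (- es s')) => [|v]; last first.
  by rewrite /= addrC addr_eq0.
congr << _ >>; apply/continuousEP => t /=; exact: orbit_map_transl.
Qed.

(** On an invariant chain, translating the part of coordinate 0 by v gives the part of coordinate v,
    and the sum of these parts over v is the chain. *)
Lemma descendK n (c : chain X n) : invariant n c -> transfer n (descend n c) = c.
Proof.
move=> /invariantP ic.
have trs x : transfer n (descend n x) =
    \sum_(v : G) chain_act R tocont v n (select 0 n x).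
  elim/chain_ind: x => [|k s x IH].
    by rewrite !linear0 big1 // => v _; rewrite !linear0.
  rewrite !linearP IH descendE.
  under [RHS]eq_bigr do rewrite linearP selectE.
  rewrite big_split -scaler_sumr; congr (_ *: _ + _).
  case: ifP => _; last by rewrite linear0 big1 // => v _; rewrite linear0.
  by rewrite transfer_proj; apply: eq_bigr => v _; rewrite /= push_simplex.
have gs v x : chain_act R tocont v n (select 0 n x) = select v n (chain_act R tocont v n x).
  pose f : {linear chain X n -> chain X n} := chain_act R tocont v n \o select 0 n.
  pose g : {linear chain X n -> chain X n} := select v n \o chain_act R tocont v n.
  apply: (linear_ext (f := f) (g := g)) => s.
  have -> : f << s >> = chain_act R tocont v n (select 0 n << s >>) by [].
  have -> : g << s >> = select v n (chain_act R tocont v n << s >>) by [].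
  rewrite selectE /= push_simplex lext_simplex es_transl.
  have -> : (es s + v == v) = (es s == 0) by rewrite -subr_eq0 addrK.
  by case: ifP => _; [exact: push_simplex | exact: linear0].
rewrite trs; under eq_bigr do rewrite gs ic.
elim/chain_ind: (c) => [|k s x IH]; first by rewrite big1 // => v _; rewrite linear0.
under eq_bigr do rewrite linearP selectE.
rewrite big_split -scaler_sumr IH -big_mkcond /= (big_pred1 (es s)) // => v; exact: eq_sym.
Qed.

(** A face of a selected simplex may start at another vertex and have another coordinate, so
    compatibility with the boundary is not visible termwise. On invariant chains it is inherited
    from the transfer, whose inverse this is. *)
Lemma boundary_descend n (c : chain X n.+1) : invariant n.+1 c ->
  boundary (descend n.+1 c) = descend n (boundary c).
Proof.
move=> ic; have ibc : invariant n (boundary c).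
  by have [_ _] := fixed_below_subcomplex R tocont r; apply.
rewrite -[LHS]transferK; last first.
  apply: (chain_in_boundary (P := fun m s => @liftable m s)).
    by move=> s k; exact: liftable_face.
  exact: descend_liftable.
by rewrite -boundary_transfer; [rewrite descendK|exact: descend_liftable].
Qed.

Lemma iter_Sd_homologous n k (c : chain Y n.+1) : boundary c = 0 ->
  exists2 h, boundary h = c - iter k (Sd R 'F_p Y n.+1) c &
    (chain_in (@liftable n.+1) c -> chain_in (@liftable n.+2) h).
Proof.
move=> dc; elim: k => [|k [h dh lh]].
  by exists 0; [rewrite boundary0 subrr | move=> _; exact: chain_in0].
exists (h + Sdh R 'F_p Y n.+1 (iter k (Sd R 'F_p Y n.+1) c)).
  by rewrite boundaryD dh boundary_Sdh_iter // addrA subrK.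
move=> lc; apply: chain_inD; first exact: lh.
by apply: Sdh_liftable; elim: (k) => //= j; exact: Sd_liftable.
Qed.

(** The bounding chain c is subdivided until it lifts. The homotopy from [descend z] to its
    subdivision is liftable as well, so their sum can be transferred. *)
Lemma descend_boundary n (z : chain X n.+1) (c : chain Y n.+2) :
  invariant n.+1 z -> boundary z = 0 -> boundary c = descend n.+1 z ->
  exists2 w, invariant n.+2 w & boundary w = z.
Proof.
move=> iz dz dc; have [k lk] := iter_Sd_liftable c.
have dqz : boundary (descend n.+1 z) = 0 by rewrite boundary_descend // dz linear0.
have [h dh /(_ (@descend_liftable _ z)) lh] := iter_Sd_homologous k dqz.
exists (transfer n.+2 (h + iter k (Sd R 'F_p Y n.+2) c)).
  exact: transfer_invariant.
rewrite boundary_transfer; last exact: chain_inD.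
by rewrite boundaryD dh boundary_iter_Sd dc subrK descendK.
Qed.

Lemma homology_card_orbit n c :
  homology_card_le (@bd R p Y) (fun n c => True) n c <->
  homology_card_le (@bd R p X) (@fixed_below R p r X to tocont r) n c.
Proof.
split=> [[T [f [cT hf]]]|[T [f [cT hf]]]]; exists T.
  exists (fun z => f (descend n.+1 z)); split => // z z' iz dz iz' dz' fz.
  rewrite /bd /= in dz dz'.
  have dq x : invariant n.+1 x -> boundary x = 0 -> boundary (descend n.+1 x) = 0.
    by move=> ix dx; rewrite boundary_descend // dx linear0.
  have [w _ dw] := hf _ _ Logic.I (dq z iz dz) Logic.I (dq z' iz' dz') fz.
  apply: (@descend_boundary n (z - z') w).
  - by have [_ + _] := fixed_below_subcomplex R tocont r; apply.
  - by rewrite boundaryB dz dz' subr0.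
  - by rewrite linearB.
(* The number of subdivisions depends on the chain, so S need not be additive; [homology_card_le]
   does not ask for it. *)
have [k hk] := choice (@iter_Sd_liftable n.+1).
pose S (z : chain Y n.+1) := iter (k z) (Sd R 'F_p Y n.+1) z.
exists (fun z => f (transfer n.+1 (S z))); split => // z z' _ dz _ dz' fz.
rewrite /bd /= in dz dz'.
have dS x : boundary x = 0 -> boundary (S x) = 0.
  by move=> dx; rewrite /S boundary_iter_Sd dx; elim: (k x) => //= j ->; rewrite linear0.
have dT x : boundary x = 0 -> boundary (transfer n.+1 (S x)) = 0.
  by move=> dx; rewrite boundary_transfer ?dS ?linear0 //; exact: hk.
have [w iw dw] := hf _ _ (transfer_invariant (S z)) (dT z dz)
  (transfer_invariant (S z')) (dT z' dz') fz.
rewrite /bd /= in dw.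
have [h dh _] := iter_Sd_homologous (k z) dz.
have [h' dh' _] := iter_Sd_homologous (k z') dz'.
exists (descend n.+2 w + (h - h')) => //.
rewrite /bd /= boundaryD boundaryB boundary_descend // dw linearB.
rewrite !transferK; try exact: hk.
by rewrite dh dh' -/(S z) -/(S z') addrACA -opprD !subrKC.
Qed.

Lemma rose_homology_orbit :
  rose_homology (@bd R p Y) (fun n c => True) <->
  rose_homology (@bd R p X) (@fixed_below R p r X to tocont r).
Proof.
have subT (Z : topologicalType) : subcomplex (@bd R p Z) (fun n c => True) by [].
have subF := fixed_below_subcomplex R tocont r.
have ac n : acyclic_at (@bd R p Y) (fun n c => True) n <->
    acyclic_at (@bd R p X) (@fixed_below R p r X to tocont r) n.
  split=> [/(acyclic_card1 _ (subT _))|/(acyclic_card1 _ subF)].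
    by move=> /homology_card_orbit /(acyclic_card1 _ subF).
  by move=> /homology_card_orbit /(acyclic_card1 _ (subT _)).
split=> -[[c hc] nonac van]; split; try by [move=> /ac|move=> n /van /ac].
  by exists c; apply/homology_card_orbit.
by exists c; apply/homology_card_orbit.
Qed.

End Transfer.

(** * Homology groups *)

Section ElementaryAbelian.
Variables (p : nat) (V : zmodType).
Hypothesis pr : prime p.
Hypothesis Vp : forall x : V, x *+ p = 0.

Lemma mulrn_modp (x : V) k : x *+ (k %% p) = x *+ k.
Proof.
by rewrite [in RHS](divn_eq k p) mulrnDr mulnC mulrnA Vp mul0rn add0r.
Qed.

Lemma mulrn_Fp_nat (x : V) k : x *+ (k%:R : 'F_p) = x *+ k.
Proof. by rewrite val_Fp_nat // mulrn_modp. Qed.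

Definition Fp_comb d (e : 'I_d -> V) (v : 'rV['F_p]_d) : V := \sum_j e j *+ v 0 j.

Lemma Fp_comb_additive d (e : 'I_d -> V) : zmod_morphism (Fp_comb e).
Proof.
have add u v : Fp_comb e (u + v) = Fp_comb e u + Fp_comb e v.
  rewrite -big_split; apply: eq_bigr => j _ /=.
  by rewrite !mxE -mulrnDr -[in LHS](natr_Zp (u 0 j)) -[in LHS](natr_Zp (v 0 j))
    -natrD mulrn_Fp_nat.
move=> u v; rewrite -[in RHS](subrK v u) [in RHS]add addrK //.
Qed.

HB.instance Definition _ d (e : 'I_d -> V) :=
  GRing.isZmodMorphism.Build 'rV['F_p]_d V (Fp_comb e) (@Fp_comb_additive d e).

Definition Fp_cons d (x : V) (e : 'I_d -> V) (j : 'I_d.+1) : V :=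
  if fintype.unlift ord0 j is Some k then e k else x.

Lemma Fp_comb_cons d x (e : 'I_d -> V) v : Fp_comb (Fp_cons x e) v =
  x *+ v 0 ord0 + Fp_comb e (\row_j v 0 (fintype.lift ord0 j)).
Proof.
rewrite /Fp_comb big_ord_recl /Fp_cons unlift_none; congr (_ + _).
by apply: eq_bigr => j _; rewrite liftK mxE.
Qed.

(** An independent family of length d embeds p^d elements into T, so a longest one exists, and by
    maximality it spans. *)
Lemma elementary_abelian_finite (T : finType) (f : V -> T) : injective f ->
  exists d (g : {additive 'rV['F_p]_d -> V}), bijective g.
Proof.
move=> finj; pose P d := `[< exists e : 'I_d -> V, injective (Fp_comb e) >].
have P0 : exists d, P d.
  exists 0%N; apply/asboolP; exists (fun=> 0) => u v _.
  by apply/rowP => -[].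
have Pbound d : P d -> (d <= #|T|)%N.
  move=> /asboolP[e einj]; have := leq_card _ (inj_comp finj einj).
  rewrite card_mx mul1n card_Fp //; apply: leq_trans.
  by apply: ltnW; apply: ltn_expl; exact: prime_gt1.
case: (ex_maxnP P0 Pbound) => d /asboolP[e einj] dmax; exists d, (Fp_comb e).
suff surj x : exists v, Fp_comb e v = x.
  have [g gK] := choice surj; exists g => // v; apply: einj; exact: gK.
apply: contrapT => nx; have : P d.+1; last by move=> /dmax; rewrite ltnn.
apply/asboolP; exists (Fp_cons x e).
apply: (@raddf_inj _ _ (Fp_comb (Fp_cons x e))) => v /=; rewrite Fp_comb_cons.
have [v0|v0] := eqVneq (v 0 ord0) 0.
  rewrite v0 mulr0n add0r -(raddf0 (Fp_comb e)) => /einj /rowP w0.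
  apply/rowP => j; case: (unliftP ord0 j) => [k|] ->; last by rewrite v0 mxE.
  by have := w0 k; rewrite !mxE.
move=> /eqP; rewrite addr_eq0 => /eqP xv; case: nx.
(* In the relation the coefficient of x is invertible mod p, so x lies in the span of e after
   all. *)
set w := \row_j _ in xv; exists (- w *+ (v 0 ord0)^-1).
by rewrite raddfMn raddfN -xv -mulrnA -mulrn_Fp_nat natrM !natr_Zp divff.
Qed.

End ElementaryAbelian.

Lemma bij_additive_inv (U V : zmodType) (f : {additive U -> V}) : bijective f ->
  exists g : {additive V -> U}, bijective g.
Proof.
move=> [g fK gK].
have gB : zmod_morphism g.
  by move=> x y; apply: (can_inj fK); rewrite raddfB !gK.
pose h : {additive V -> U} := HB.pack g (GRing.isZmodMorphism.Build V U g gB).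
by exists h; exists f.
Qed.

Lemma bij_additive_comp (U V W : zmodType) (f : {additive U -> V})
    (g : {additive V -> W}) : bijective f -> bijective g ->
  exists h : {additive U -> W}, bijective h.
Proof. by move=> bf bg; exists (g \o f); exact: bij_comp. Qed.

Section HomologyGroups.
Variables (R : realType) (p : nat) (X : topologicalType).
Hypothesis pr : prime p.
Local Notation chain n := (chain R 'F_p X n).
Local Notation H n := (homology R 'F_p X n).

Definition hclass n (z : Defs.cycle R 'F_p X n) : H n := (\pi_(H n) z)%qT.

Lemma hclass_surj n (h : H n) : exists z, hclass z = h.
Proof. by exists (repr h); exact: reprK. Qed.

Lemma hclassB n (y z : Defs.cycle R 'F_p X n) : hclass (y - z) = hclass y - hclass z.
Proof. exact: raddfB. Qed.

Lemma hclass0 n : hclass 0 = 0 :> H n.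
Proof. exact: raddf0. Qed.

Lemma hclass_eq n (y z : Defs.cycle R 'F_p X n) :
  hclass y = hclass z <-> exists c, boundary c = (y : chain n) - (z : chain n).
Proof.
have -> : (hclass y = hclass z) <-> is_boundary (y - z).
  by split=> [/eqP|h]; [|apply/eqP]; rewrite /hclass -Quotient.idealrBE.
by split=> [/asboolP|h]; [|apply/asboolP].
Qed.

Lemma cycle_exists n (z : chain n.+1) : boundary z = 0 ->
  exists y : Defs.cycle R 'F_p X n.+1, y = z :> chain n.+1.
Proof. by move=> /eqP dz; exists (Cycle (dz : z \in @is_cycle R 'F_p X n.+1)). Qed.

Lemma cycle_boundary n (z : Defs.cycle R 'F_p X n.+1) : boundary (z : chain n.+1) = 0.
Proof. by apply/eqP; exact: (valP z). Qed.

Lemma homology_torsion n (h : H n) : h *+ p = 0.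
Proof.
have [z <-] := hclass_surj h.
have hB : zmod_morphism (@hclass n) by exact: hclassB.
have hMn k : hclass z *+ k = hclass (z *+ k).
  pose g : {additive _ -> _} := HB.pack (@hclass n)
    (GRing.isZmodMorphism.Build _ _ (@hclass n) hB).
  exact/esym/(raddfMn g).
rewrite -hclass0 hMn; congr hclass; apply/val_inj.
transitivity ((z : chain n) *+ p); first exact: (raddfMn val).
by rewrite -scaler_nat pchar_Fp_0 // scale0r.
Qed.

Definition fullc n (c : chain n) := True.

Lemma acyclic_homology n :
  acyclic_at (@bd R p X) fullc n <-> forall h : H n.+1, h = 0.
Proof.
have h0 := hclass0 n.+1.
split=> [ac h|ac z _ dz].
  have [z <-] := hclass_surj h; rewrite -h0; apply/hclass_eq.
  have [c _ dc] := ac (z : chain n.+1) Logic.I (cycle_boundary z).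
  by exists c; rewrite /= subr0 -dc.
have [y yz] := cycle_exists dz.
have /hclass_eq[c dc] : hclass y = hclass 0 by rewrite h0; exact: ac.
by exists c => //; rewrite /bd /= dc /= subr0.
Qed.

Lemma homology_card_le_homology n c : homology_card_le (@bd R p X) fullc n c <->
  exists (T : finType) (f : H n.+1 -> T), #|T| = c /\ injective f.
Proof.
split=> -[T [f [cT hf]]].
  have [g gP] := choice (@hclass_surj n.+1).
  exists T, (fun h => f (g h : chain n.+1)); split => // h h' /hf [||||c' _ dc];
    rewrite /bd /= ?cycle_boundary //.
  by rewrite -(gP h) -(gP h'); apply/hclass_eq; exists c'.
(* Chains that are not cycles get the spare value; replacing it by [t0] afterwards keeps the
   cardinality of T. *)
pose F (z : chain n.+1) : T + unit := if pselect (exists y : Defs.cycle R 'F_p X n.+1, y = z :> chain n.+1)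
  is left h then inl (f (hclass (sval (cid h)))) else inr tt.
have FE (y : Defs.cycle R 'F_p X n.+1) : F (y : chain n.+1) = inl (f (hclass y)).
  rewrite /F; case: pselect => [h|[]]; last by exists y.
  by congr (inl (f (hclass _))); apply/val_inj; exact: (svalP (cid h)).
have [[t0 _]|nT] := pselect (exists t : T, True); last first.
  by case: nT; exists (f 0).
exists T, (fun z => if F z is inl t then t else t0); split => //.
move=> z z' _ dz _ dz'; have [y <-] := cycle_exists dz; have [y' <-] := cycle_exists dz'.
by rewrite !FE => /hf /hclass_eq [c' dc]; exists c'.
Qed.

End HomologyGroups.

(** * Chain connectedness and homology in degree 0 *)

Section PathConnected.
Variables (R : realType) (p : nat) (X : topologicalType).
Hypothesis pr : prime p.
Local Notation chain n := (chain R 'F_p X n).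
Local Notation H n := (homology R 'F_p X n).

Definition point_class (x : X) : chain 0 := << point_simplex R x >>.

Definition chain_connected := forall x y : X,
  exists c : chain 1, boundary c = point_class x - point_class y.

Local Notation "x ~~> y" :=
  (exists c : chain 1, boundary c = point_class x - point_class y) (at level 70).

Lemma chain_connected_trans x y z : x ~~> y -> y ~~> z -> x ~~> z.
Proof.
move=> [c dc] [d dd]; exists (c + d).
by rewrite boundaryD dc dd addrA subrK.
Qed.

Lemma chain_connected_sym x y : x ~~> y -> y ~~> x.
Proof. by move=> [c dc]; exists (- c); rewrite boundaryN dc opprB. Qed.

Lemma simplex0E (s : singular_simplex R X 0) : s = point_simplex R (s (vertex R 0)).
Proof. exact: (point_simplex_eq (t := vertex R 0)). Qed.

Definition augment : {linear chain 0 -> ('F_p)^o} :=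
  [the {linear _ -> _} of lext (fun=> 1 : ('F_p)^o)].

Lemma augment_simplex s : augment << s >> = 1.
Proof. exact: lext_simplex. Qed.

Lemma augment_boundary (c : chain 1) : augment (boundary c) = 0.
Proof.
pose f : {linear chain 1 -> ('F_p)^o} :=
  augment \o [the {linear _ -> _} of @boundary R 'F_p X 0].
apply: (linear_eq0_in (f := f) (P := fun=> True)) => // s _.
have -> : f << s >> = augment (boundary << s >>) by [].
rewrite boundary_simplex !big_ord_recl big_ord0 addr0 linearP linearZZ.
by rewrite !augment_simplex expr0 expr1 scale1r scaleN1r subrr.
Qed.

(** The augmentation is the isomorphism: every 0-chain is homologous to its augmentation times the
    point x0. *)
Lemma homology0_connected (x0 : X) : chain_connected ->
  exists f : {additive H 0 -> 'F_p}, bijective f.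
Proof.
move=> cX.
have aug_inj (c : chain 0) : exists d, boundary d = c - augment c *: point_class x0.
  elim/chain_ind: c => [|k s c [d dc]].
    by exists 0; rewrite boundary0 linear0 scale0r subr0.
  have [e de] := cX (s (vertex R 0)) x0; rewrite /point_class -simplex0E in de.
  exists (k *: e + d); rewrite boundaryD linearZ /= de dc linearP augment_simplex.
  rewrite scalerBr scalerDl opprD addrACA; congr (_ + _); congr (_ - _).
  by congr (- (_ *: _)); exact/esym/mulr1.
pose f (h : H 0) : 'F_p := augment (cycle_val (repr h)).
have fE z : f (hclass z) = augment (cycle_val z).
  have /hclass_eq[c dc] : hclass (repr (hclass z)) = hclass z by exact: reprK.
  have := augment_boundary c; rewrite dc (raddfB augment) => /eqP.
  by rewrite subr_eq0 => /eqP.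
have fB : zmod_morphism f.
  move=> h h'; have [z <-] := hclass_surj h; have [z' <-] := hclass_surj h'.
  by rewrite -hclassB !fE; exact: (raddfB augment).
pose g : {additive H 0 -> 'F_p} := HB.pack f (GRing.isZmodMorphism.Build _ _ f fB).
exists g.
pose cyc0 (c : chain 0) : Defs.cycle R 'F_p X 0 := Cycle (isT : c \in @is_cycle R 'F_p X 0).
exists (fun a => hclass (cyc0 (a *: point_class x0))) => [h|a] /=.
  have [z <-] := hclass_surj h; rewrite fE; apply/esym/hclass_eq.
  exact: aug_inj.
by rewrite fE linearZZ augment_simplex [_ *: _]mulr1.
Qed.

End PathConnected.

(** * The bouquet of circles *)

Section Circle.
Variable R : realType.
Local Notation circle := (circle R).
Implicit Types (y c : circle) (a : R).

Definition cx y : R := set_val y 0 0.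
Definition cy y : R := set_val y 0 1.

Lemma circleE y : cx y ^+ 2 + cy y ^+ 2 = 1.
Proof.
have := set_mem (valP y); rewrite /unit_sphere /= /sqnorm !big_ord_recl big_ord0 addr0.
by rewrite (_ : fintype.lift _ _ = 1) //; apply: val_inj.
Qed.

Lemma circle_eqP y c : cx y = cx c -> cy y = cy c -> y = c.
Proof.
move=> h0 h1; apply/val_inj/rowP => j.
have [->|->] : j = 0 \/ j = 1 by case: j => -[|[|]] // i; [left|right]; apply: val_inj.
  exact: h0.
exact: h1.
Qed.

Lemma mk_circle_subproof (u v : R) : u ^+ 2 + v ^+ 2 = 1 ->
  (\row_(j < 2) if j == 0 then u else v) \in unit_sphere R 2.
Proof.
move=> uv; apply/mem_set; rewrite /unit_sphere /= /sqnorm.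
by rewrite !big_ord_recl big_ord0 addr0 !mxE.
Qed.

Definition mk_circle (u v : R) (h : u ^+ 2 + v ^+ 2 = 1) : circle :=
  exist _ (\row_(j < 2) if j == 0 then u else v) (mk_circle_subproof h).

Lemma cx_mk u v h : cx (@mk_circle u v h) = u.
Proof. by rewrite /cx /= mxE. Qed.

Lemma cy_mk u v h : cy (@mk_circle u v h) = v.
Proof. by rewrite /cy /= mxE. Qed.

Lemma cx_continuous : continuous cx.
Proof.
move=> y; apply: (@continuous_comp _ _ _ set_val (fun x : 'rV[R]_2 => x 0 0)).
  exact: initial_continuous.
exact: coord_continuous.
Qed.

Lemma cy_continuous : continuous cy.
Proof.
move=> y; apply: (@continuous_comp _ _ _ set_val (fun x : 'rV[R]_2 => x 0 1)).
  exact: initial_continuous.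
exact: coord_continuous.
Qed.

Lemma circle_continuous_at (Z : topologicalType) (f : Z -> circle) z :
  {for z, continuous (fun w => cx (f w))} -> {for z, continuous (fun w => cy (f w))} ->
  {for z, continuous f}.
Proof.
move=> fx fy; apply: set_val_continuous_at; apply: rV_continuous_at => j.
by have [->|->] : j = 0 \/ j = 1 by case: j => -[|[|]] // i; [left|right]; apply: val_inj.
Qed.

Definition mixx y c a := (1 - clamp a) * cx y + clamp a * cx c.
Definition mixy y c a := (1 - clamp a) * cy y + clamp a * cy c.
Definition mixn y c a := Num.sqrt (mixx y c a ^+ 2 + mixy y c a ^+ 2).

Definition antipodal y c := cx y = - cx c /\ cy y = - cy c.

Lemma mixn_ge0 y c a : 0 <= mixn y c a. Proof. exact: sqrtr_ge0. Qed.

Lemma mixn_sqr y c a : mixn y c a ^+ 2 = mixx y c a ^+ 2 + mixy y c a ^+ 2.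
Proof. by rewrite sqr_sqrtr // addr_ge0 ?sqr_ge0. Qed.

(** If the chord met the centre at time b, then (1 - b) y = - b c; comparing norms gives (1 - b)^2 =
    b^2, so b = 1/2 and y = - c. *)
Lemma mixn_gt0 y c a : ~ antipodal y c -> 0 < mixn y c a.
Proof.
move=> nyc; rewrite lt_neqAle mixn_ge0 andbT eq_sym; apply/eqP => n0; apply: nyc.
have := mixn_sqr y c a; rewrite n0 expr0n /= => /esym/eqP.
rewrite paddr_eq0 ?sqr_ge0 // !sqrf_eq0 => /andP[/eqP x0 /eqP y0].
move: x0 y0; rewrite /mixx /mixy; move: (clamp a) => b x0 y0.
have := circleE y; have := circleE c => ec ey.
have b2 : b = 1 / 2.
  have E : (1 - b) ^+ 2 = b ^+ 2.
    have -> : (1 - b) ^+ 2 = ((1 - b) * cx y) ^+ 2 + ((1 - b) * cy y) ^+ 2.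
      by rewrite !exprMn -mulrDr ey mulr1.
    have -> : (1 - b) * cx y = - (b * cx c) by apply/eqP; rewrite -addr_eq0 x0.
    have -> : (1 - b) * cy y = - (b * cy c) by apply/eqP; rewrite -addr_eq0 y0.
    by rewrite !sqrrN !exprMn -mulrDr ec mulr1.
  nra.
by split; move: x0 y0; rewrite b2; lra.
Qed.

Lemma normalize_subproof y c a : mixn y c a != 0 ->
  (mixx y c a / mixn y c a) ^+ 2 + (mixy y c a / mixn y c a) ^+ 2 = 1.
Proof.
by move=> n0; rewrite !exprMn -mulrDl -mixn_sqr -exprMn divff // expr1n.
Qed.

(* The radial projection to the circle of the chord from y to c, with the junk
   value y when the chord meets the centre. *)
Definition slide y c a : circle :=
  match pselect (mixn y c a != 0) with
  | left h => mk_circle (normalize_subproof h)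
  | right _ => y
  end.

Lemma slideE y c a : ~ antipodal y c ->
  cx (slide y c a) = mixx y c a / mixn y c a /\
  cy (slide y c a) = mixy y c a / mixn y c a.
Proof.
move=> nyc; have n0 := mixn_gt0 a nyc.
rewrite /slide; case: pselect => [h|[]]; first by rewrite cx_mk cy_mk.
by rewrite gt_eqF.
Qed.

Lemma clamp0 : clamp (0 : R) = 0. Proof. by rewrite clamp_id. Qed.
Lemma clamp1 : clamp (1 : R) = 1. Proof. by rewrite clamp_id. Qed.

Lemma slide0 y c : ~ antipodal y c -> slide y c 0 = y.
Proof.
move=> nyc; have [ex ey] := slideE 0 nyc.
have [Ex Ey] : mixx y c 0 = cx y /\ mixy y c 0 = cy y.
  by rewrite /mixx /mixy clamp0 subr0 !mul1r !mul0r !addr0.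
have n1 : mixn y c 0 = 1 by rewrite /mixn Ex Ey circleE sqrtr1.
by apply: circle_eqP; rewrite ?ex ?ey n1 divr1.
Qed.

Lemma slide1 y c : ~ antipodal y c -> slide y c 1 = c.
Proof.
move=> nyc; have [ex ey] := slideE 1 nyc.
have [Ex Ey] : mixx y c 1 = cx c /\ mixy y c 1 = cy c.
  by rewrite /mixx /mixy clamp1 subrr !mul1r !mul0r !add0r.
have n1 : mixn y c 1 = 1 by rewrite /mixn Ex Ey circleE sqrtr1.
by apply: circle_eqP; rewrite ?ex ?ey n1 divr1.
Qed.

Lemma slide_id c a : slide c c a = c.
Proof.
have nc : ~ antipodal c c by move=> [h1 h2]; have := circleE c; nra.
have [ex ey] := slideE a nc.
have [Ex Ey] : mixx c c a = cx c /\ mixy c c a = cy c.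
  by rewrite /mixx /mixy -!mulrDl subrK !mul1r.
have n1 : mixn c c a = 1 by rewrite /mixn Ex Ey circleE sqrtr1.
by apply: circle_eqP; rewrite ?ex ?ey ?Ex ?Ey n1 divr1.
Qed.

(** If the projection were - c, then (1 - b) y = - (n + b) c with n > 0; norms force 1 - b = n + b >
    0, so y = - c. *)
Lemma slide_not_antipodal y c a : ~ antipodal y c -> ~ antipodal (slide y c a) c.
Proof.
move=> nyc; have [ex ey] := slideE a nyc; have n0 := mixn_gt0 a nyc.
rewrite /antipodal ex ey => -[hx hy]; apply: nyc.
have {hx} hx : mixx y c a = - cx c * mixn y c a by rewrite -hx divfK // gt_eqF.
have {hy} hy : mixy y c a = - cy c * mixn y c a by rewrite -hy divfK // gt_eqF.
move: n0 hx hy; rewrite /mixx /mixy; move: (mixn y c a) => n.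
have := clamp_ge0 a; have := clamp_le1 a; move: (clamp a) => b b1 b0 n0 hx hy.
have ec := circleE c; have ey' := circleE y.
have Ex : (1 - b) * cx y = - (n + b) * cx c by lra.
have Ey : (1 - b) * cy y = - (n + b) * cy c by lra.
have E : (1 - b) ^+ 2 = (n + b) ^+ 2.
  transitivity (((1 - b) * cx y) ^+ 2 + ((1 - b) * cy y) ^+ 2).
    by rewrite !exprMn -mulrDr ey' mulr1.
  by rewrite Ex Ey !mulNr !sqrrN !exprMn -mulrDr ec mulr1.
have nb : 1 - b = n + b.
  apply/eqP; rewrite -subr_eq0; have /eqP : (1 - b - (n + b)) * (1 - b + (n + b)) = 0.
    by rewrite -subr_sqr E subrr.
  rewrite mulf_eq0 => /orP[//|/eqP h]; lra.
have nb0 : 1 - b != 0 by rewrite nb; lra.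
split; apply: (mulfI nb0); rewrite ?Ex ?Ey -nb; ring.
Qed.

Lemma slide_continuous_at (Z : topologicalType) (f : Z -> circle) c (g : Z -> R) z :
  ~ antipodal (f z) c -> {for z, continuous f} -> {for z, continuous g} ->
  {for z, continuous (fun w => slide (f w) c (g w))}.
Proof.
move=> nfz cf cg.
have cclamp : {for z, continuous (fun w => clamp (g w))}.
  by apply: (@continuous_comp _ _ _ g (@clamp R)) => //; exact: clamp_continuous.
have cmix (k : circle -> R) : continuous k ->
    {for z, continuous (fun w => (1 - clamp (g w)) * k (f w) + clamp (g w) * k c)}.
  move=> ck; apply: (@continuousD _ R^o); apply: continuousM => //.
  - by apply: (@continuousB _ R^o) => //; exact: cst_continuous.
  - by apply: (@continuous_comp _ _ _ f k) => //; exact: ck.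
  - exact: cst_continuous.
have cx' := cmix _ cx_continuous; have cy' := cmix _ cy_continuous.
have cn : {for z, continuous (fun w => mixn (f w) c (g w))}.
  apply: (@continuous_comp _ _ _
    (fun w => mixx (f w) c (g w) ^+ 2 + mixy (f w) c (g w) ^+ 2) Num.sqrt);
    last exact: sqrt_continuous.
  by apply: (@continuousD _ R^o); apply: continuousM.
have n0 : mixn (f z) c (g z) != 0 by rewrite gt_eqF // mixn_gt0.
have near_na : nbhs z [set w | mixn (f w) c (g w) != 0].
  have nU : nbhs (mixn (f z) c (g z)) [set a | a != 0].
    by apply: open_nbhs_nbhs; split => //; exact: open_neq.
  exact: (cn _ nU).
have near_eq (k : circle -> R) (mixk : circle -> circle -> R -> R) :
    (forall y a, mixn y c a != 0 -> k (slide y c a) = mixk y c a / mixn y c a) ->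
    {for z, continuous (fun w => mixk (f w) c (g w))} ->
    {for z, continuous (fun w => k (slide (f w) c (g w)))}.
  move=> kE ck A; rewrite /= kE // => nA.
  have cq : {for z, continuous (fun w => mixk (f w) c (g w) / mixn (f w) c (g w))}.
    by apply: continuousM => //; exact: continuousV.
  apply: (@filterS2 _ (nbhs z) _ _ _ _ _ near_na (cq _ nA)) => w /= wn Aw.
  by rewrite kE.
apply: circle_continuous_at.
  apply: (near_eq cx mixx) => // y a h; rewrite /slide.
  by case: pselect => [h'|//]; rewrite cx_mk.
apply: (near_eq cy mixy) => // y a h; rewrite /slide.
by case: pselect => [h'|//]; rewrite cy_mk.
Qed.

End Circle.

(** * Coordinates on the bouquet *)

Section BouquetTopology.
Variables (R : realType) (m : nat).
Local Notation circle := (circle R).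
Local Notation base := (circle_base R).
Local Notation B := (bouquet R m).

Definition petal (i : 'I_m) (y : circle) : B :=
  @wedge_lift _ _ (fun _ : 'I_m => base) i y.

Definition petal_coord (k : 'I_m) (x : B) : circle :=
  @wedge_fun _ (fun _ : 'I_m => circle) (fun _ : 'I_m => base) circle
    (fun i y => if i == k then y else base) x.

Lemma petal_coordE k i y : petal_coord k (petal i y) = if i == k then y else base.
Proof.
rewrite /petal_coord /petal wedge_lift_funE // => i1 i2.
by case: eqP; case: eqP.
Qed.

Lemma petal_continuous i : continuous (petal i).
Proof.
exact: (@wedge_lift_continuous 'I_m (fun _ => circle) (fun _ => base) i).
Qed.

Lemma petal_coord_continuous k : continuous (petal_coord k).
Proof.
apply: wedge_fun_continuous => [i|i j]; last by case: eqP; case: eqP.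
by case: eqP => _; [move=> y; exact: cvg_id | exact: cst_continuous].
Qed.

Lemma petal_base i j : petal i base = petal j base.
Proof.
exact: (@wedge_liftE 'I_m (fun _ => circle) (fun _ => base) j base i base).
Qed.

Lemma petal_cover x : exists i y, x = petal i y.
Proof.
have : [set: B] x by []; rewrite /B /bouquet -wedgeTE => -[i _ [y _ <-]].
by exists i, y.
Qed.

Lemma petal_index_exists (x : B) : exists i, x = petal i (petal_coord i x).
Proof.
have [i [y ->]] := petal_cover x.
by exists i; rewrite petal_coordE eqxx.
Qed.

(* At the base point, where all the petals meet, the value is arbitrary. *)
Definition petal_index (x : B) : 'I_m := sval (cid (petal_index_exists x)).

Lemma petal_indexK x : petal (petal_index x) (petal_coord (petal_index x) x) = x.
Proof. exact/esym/(svalP (cid (petal_index_exists x))). Qed.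

Lemma petal_coord_neq k x : petal_coord k x != base -> petal_index x = k.
Proof.
apply: contra_neq_eq => nk; rewrite -[x]petal_indexK petal_coordE.
by rewrite (negbTE nk).
Qed.

Lemma petal_coord_off k x : petal_index x != k -> petal_coord k x = base.
Proof. by move=> xk; apply: contraNeq xk => /petal_coord_neq ->. Qed.

Lemma petal_coord_neqK k x : petal_coord k x != base -> petal k (petal_coord k x) = x.
Proof. by move=> /petal_coord_neq <-; exact: petal_indexK. Qed.

Lemma closed_base : closed [set base].
Proof.
have hc : hausdorff_space circle.
  move=> y c yc; apply/val_inj.
  apply: (@norm_hausdorff R 'rV[R]_2) => U V nU nV.
  have n1 : nbhs y [set z : circle | U (set_val z)].
    by apply/nbhs_set_val; exists U.
  have n2 : nbhs c [set z : circle | V (set_val z)].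
    by apply/nbhs_set_val; exists V.
  by have [z [Uz Vz]] := yc _ _ n1 n2; exists (set_val z).
exact: (accessible_closed_set1 (hausdorff_accessible hc)).
Qed.

(** At the base point a neighbourhood is given petal by petal, and finitely many conditions can be
    combined; at other points one petal is locally the whole bouquet. *)
Lemma bouquet_continuous_at (Z : topologicalType) (f : Z -> B) (z : Z) :
  (forall k, {for z, continuous (fun w => petal_coord k (f w))}) ->
  {for z, continuous f}.
Proof.
move=> cf A; change (nbhs (f z) A -> nbhs z (f @^-1` A)).
have [i ei] : exists i, petal_index (f z) = i by exists (petal_index (f z)).
have [fb|fnb] := eqVneq (petal_coord i (f z)) base.
  have fzE : f z = @wedge_lift _ _ (fun _ : 'I_m => base) i base.
    by rewrite -[LHS]petal_indexK ei fb.
  rewrite {1}fzE wedge_point_nbhs => nA.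
  have nk k : nbhs z [set w | A (petal k (petal_coord k (f w)))].
    have fk : petal_coord k (f z) = base.
      by rewrite fzE petal_coordE; case: ifP.
    have := cf k (petal k @^-1` A); rewrite /= fk; apply.
    exact: (nA k Logic.I).
  have := filter_forall (nbhs_filter z) nk; apply: filterS => w hw.
  by have := hw (petal_index (f w)); rewrite /= petal_indexK.
have fzE : f z = @wedge_lift _ _ (fun _ : 'I_m => base) i (petal_coord i (f z)).
  by rewrite -[LHS]petal_indexK ei.
rewrite {1}fzE -(@wedge_lift_nbhs _ _ _ i _ closed_base fnb) => nA.
have n1 := cf i _ nA.
have n2 : nbhs z [set w | petal_coord i (f w) != base].
  apply: (cf i (fun y => y != base)); apply: open_nbhs_nbhs; split => //.
  have := closed_openC closed_base; congr open.
  by apply/seteqP; split => y /eqP.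
apply: (@filterS2 _ (nbhs z) _ _ _ _ _ n1 n2) => w Aw wb.
by have := Aw; rewrite /= -/(petal _ _) petal_coord_neqK.
Qed.

End BouquetTopology.

(** * Contractions of the pieces of the bouquet *)

Section ContractiblePieces.
Variables (R : realType) (p : nat) (X : topologicalType).
Local Notation chain n := (chain R 'F_p X n).

(** What a homotopy leaves on chains when it contracts each component of W to the point named by
    [kappa]; Mayer-Vietoris uses nothing else about the pieces. *)
Definition contracts_to (W : set X) (kappa : X -> X) :=
  exists K : forall n, {linear chain n -> chain n.+1},
  [/\ forall n c, chain_in (simplex_in W) c -> chain_in (simplex_in W) (K n c),
      forall n (c : chain n.+1), chain_in (simplex_in W) c ->
        boundary (K n.+1 c) = c - K n (boundary c)
    & forall x, W x ->
        boundary (K 0 (point_class R p x)) = point_class R p x - point_class R p (kappa x)].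

Lemma contraction_contracts_to (W : set X) (H : X -> R -> X) :
  (forall x a, W x -> {for (x, a), continuous (fun q : X * R => H q.1 q.2)}) ->
  (forall x a, W x -> W (H x a)) -> (forall x, W x -> H x 0 = x) ->
  (forall n (s : singular_simplex R X n), simplex_in W s ->
     forall t u, H (s t) 1 = H (s u) 1) ->
  contracts_to W (fun x => H x 1).
Proof.
move=> Hc HW H0 H1; exists (fun n => cone Hc H1 'F_p n); split.
- by move=> n c; exact: cone_in.
- by move=> n c Wc; exact: boundary_cone.
- move=> x Wx; rewrite /point_class boundary_cone0 //.
  congr (_ - << _ >>); apply: (@point_simplex_eq _ _ _ _ (vertex R 0)).
  by rewrite face1_scone.
Qed.

End ContractiblePieces.

Section BouquetPieces.
Variables (R : realType) (p m : nat).
Local Notation circle := (circle R).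
Local Notation base := (circle_base R).
Local Notation B := (bouquet R m).

Definition main_coord (x : B) : circle := petal_coord (petal_index x) x.

Definition flow (cen : circle -> circle) (x : B) (a : R) : B :=
  petal (petal_index x) (slide (main_coord x) (cen (main_coord x)) a).

Lemma petal_index_petal i y : y != base -> petal_index (petal i y) = i :> 'I_m.
Proof. by move=> yb; apply: petal_coord_neq; rewrite petal_coordE eqxx. Qed.

Lemma main_coord_petal i y : main_coord (petal i y) = y.
Proof.
have [->|yb] := eqVneq y base.
  by rewrite /main_coord petal_coordE; case: ifP.
by rewrite /main_coord petal_index_petal // petal_coordE eqxx.
Qed.

Section AwayFromBase.
Variables (V : set circle) (cen : circle -> circle).
Hypothesis Vbase : ~ V base.
Hypothesis Vnear : forall y, V y -> \forall y' \near y, V y' /\ cen y' = cen y.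
Hypothesis Vanti : forall y, V y -> ~ antipodal y (cen y).
Hypothesis Vslide : forall y a, V y -> V (slide y (cen y) a).

Let W : set B := [set x | V (main_coord x)].

Let Vneq y : V y -> y != base.
Proof. by move=> Vy; apply/eqP => yb; apply: Vbase; rewrite -yb. Qed.

Let near_index x : W x -> \forall x' \near x, [/\ petal_index x' = petal_index x,
  V (petal_coord (petal_index x) x') &
  cen (petal_coord (petal_index x) x') = cen (main_coord x)].
Proof.
move=> Wx; have n1 := @petal_coord_continuous R m (petal_index x) x _ (Vnear Wx).
by apply: (@filterS _ (nbhs x) _ _ _ _ n1) => x' [Vx' cx']; split => //;
  apply: petal_coord_neq; exact: Vneq.
Qed.

(** Off the base point the petal index is locally constant, and so is [cen]. The flow is thus
    locally a slide on one petal towards a fixed point, and its end is constant along simplices. *)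
Lemma away_contracts_to : contracts_to R p W
  (fun x => petal (petal_index x) (cen (main_coord x))).
Proof.
have E x : W x -> petal (petal_index x) (cen (main_coord x)) = flow cen x 1.
  by move=> Wx; rewrite /flow slide1 //; exact: Vanti.
have [|||| K [KW Kd K0]] := @contraction_contracts_to R p B W (flow cen).
- move=> x a Wx; pose i := petal_index x.
  pose g (q : B * R) := petal i (slide (petal_coord i q.1) (cen (main_coord x)) q.2).
  have cg : {for (x, a), continuous g}.
    apply: (@continuous_comp _ _ _
      (fun q : B * R => slide (petal_coord i q.1) (cen (main_coord x)) q.2) (petal i)).
      apply: slide_continuous_at; first exact: Vanti.
        apply: (@continuous_comp _ _ _ fst (petal_coord i)); first exact: cvg_fst.
        exact: petal_coord_continuous.
      exact: cvg_snd.
    exact: petal_continuous.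
  have nE : nbhs (x, a) [set q | flow cen q.1 q.2 = g q].
    have cfst : {for (x, a), continuous (fst : B * R -> B)} by exact: cvg_fst.
    have := cfst _ (near_index Wx); apply: (@filterS _ (nbhs (x, a))) => -[x' a'] /= [ix' _ cx'].
    by rewrite /flow /g /main_coord ix' -/i cx'.
  move=> A; rewrite /= (_ : flow cen x a = g (x, a)) // => /cg nA.
  by apply: (@filterS2 _ (nbhs (x, a)) _ _ _ _ _ nE nA) => q /= ->.
- move=> x a Wx; rewrite /W /= /flow main_coord_petal; exact: Vslide.
- by move=> x Wx; rewrite /flow slide0 ?petal_indexK //; exact: Vanti.
- move=> n s Ws; apply: (simplex_locally_constant (f := fun t => flow cen (s t) 1)) => t.
  have := @cts_fun _ _ s t _ (near_index (Ws t)).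
  apply: (@filterS _ (nbhs t)) => u [iu Vu cu].
  have Wu : W (s u) by rewrite /W /= /main_coord iu.
  by rewrite -!E //; rewrite iu /main_coord iu cu.
exists K; split => // x Wx.
by rewrite K0 // E.
Qed.

End AwayFromBase.

Lemma cx_base : cx base = 1. Proof. by rewrite /cx /= mxE. Qed.
Lemma cy_base : cy base = 0. Proof. by rewrite /cy /= mxE. Qed.

Definition antibase : circle := @mk_circle R (-1) 0 ltac:(by rewrite sqrrN expr1n expr0n addr0).
Definition north : circle := @mk_circle R 0 1 ltac:(by rewrite expr1n expr0n add0r).
Definition south : circle := @mk_circle R 0 (-1) ltac:(by rewrite sqrrN expr1n expr0n add0r).

Lemma antipodal_base y : antipodal y base <-> y = antibase.
Proof.
rewrite /antipodal cx_base cy_base oppr0; split=> [[h1 h2]|->].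
  by apply: circle_eqP; rewrite ?cx_mk ?cy_mk.
by rewrite cx_mk cy_mk.
Qed.

Lemma antipodal_antibase y : antipodal y antibase <-> y = base.
Proof.
rewrite /antipodal cx_mk cy_mk oppr0 opprK; split=> [[h1 h2]|->].
  by apply: circle_eqP; rewrite ?cx_base ?cy_base.
by rewrite cx_base cy_base.
Qed.

Definition star : set B := [set x | main_coord x != antibase].
Definition arcs : set B := [set x | main_coord x != base].
(** The overlap of [star] and [arcs]: the 2m open half circles cut out by the base point and its
    antipodes. *)
Definition half_arcs : set B := [set x | cy (main_coord x) != 0].

Lemma half_arcsE : half_arcs = star `&` arcs.
Proof.
rewrite /half_arcs /star /arcs; apply/seteqP; split => [x /= h|x /= [h1 h2]].
  by split; apply: contra_neq h => ->; rewrite ?cy_mk ?cy_base.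
apply: contra_neqN h1 => /eqP h; have := circleE (main_coord x).
rewrite h expr0n addr0 => /eqP; rewrite sqrf_eq1 => /orP[/eqP e|/eqP e].
  by move/eqP: h2 => []; apply: circle_eqP; rewrite ?cx_base ?cy_base.
by apply: circle_eqP; rewrite ?cx_mk ?cy_mk.
Qed.

Lemma cy_north : cy north = 1. Proof. exact: cy_mk. Qed.
Lemma cy_south : cy south = -1. Proof. exact: cy_mk. Qed.

Definition pole (y : circle) : circle := if 0 < cy y then north else south.

Lemma open_neq_set (T : topologicalType) (f : T -> R) (a : R) (x : T) :
  {for x, continuous f} -> f x != a -> nbhs x [set y | f y != a].
Proof.
move=> cf fa; have nU : nbhs (f x) [set b | b != a].
  by apply: open_nbhs_nbhs; split => //; exact: open_neq.
exact: (cf _ nU).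
Qed.

Lemma base_neq_antibase : base != antibase.
Proof. by apply/eqP => /(congr1 (@cx R)); rewrite cx_base cx_mk; lra. Qed.

Lemma circle_neq_nbhs (c y : circle) : y != c -> nbhs y [set z | z != c].
Proof.
have [e|ne] := eqVneq (cx y) (cx c).
  have [e'|ne'] := eqVneq (cy y) (cy c).
    by move=> /eqP[]; exact: circle_eqP.
  move=> _; have := open_neq_set (@cy_continuous R y) ne'.
  by apply: filterS => z; apply: contra_neq => ->.
move=> _; have := open_neq_set (@cx_continuous R y) ne.
by apply: filterS => z; apply: contra_neq => ->.
Qed.

Lemma arcs_contracts_to : contracts_to R p arcs
  (fun x => petal (petal_index x) antibase).
Proof.
apply: (@away_contracts_to [set y | y != base] (fun=> antibase)).
- by rewrite /= eqxx.
- by move=> y yb; have := circle_neq_nbhs yb; apply: filterS => z.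
- by move=> y /eqP yb /antipodal_antibase.
- move=> y a /= /eqP yb; apply/eqP => e.
  apply: (@slide_not_antipodal _ y antibase a); first by move/antipodal_antibase.
  by rewrite e; exact/antipodal_antibase.
Qed.

Lemma pole_not_antipodal y : cy y != 0 -> ~ antipodal y (pole y).
Proof.
rewrite /antipodal /pole => /eqP y0; case: ltP => h; rewrite ?cy_north ?cy_south => -[_ h2]; lra.
Qed.

(** Sliding towards the pole on its own side keeps the sign of the second coordinate, so a point
    never leaves its half circle. *)
Lemma cy_slide_pole y a : cy y != 0 -> 0 < cy y * cy (slide y (pole y) a).
Proof.
move=> y0; have [_ ->] := slideE a (pole_not_antipodal y0).
have n0 := mixn_gt0 a (pole_not_antipodal y0).
rewrite mulrA divr_gt0 // /mixy /pole; have := clamp_ge0 a; have := clamp_le1 a.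
move: (clamp a) => b b1 b0; move/eqP : y0 => y0.
have mix_gt0 (t : R) : 0 < t -> 0 < (1 - b) * t + b.
  move=> t0; have h : 0 <= (1 - b) * t by rewrite mulr_ge0 ?subr_ge0 // ltW.
  have [b_gt0|b_le0] := ltP 0 b; first by rewrite ltr_wpDl.
  have -> : b = 0 by apply/eqP; rewrite eq_le b_le0.
  by rewrite subr0 mul1r addr0.
case: (ltP 0 (cy y)) => h; rewrite ?cy_north ?cy_south.
  by rewrite mulr1 mulr_gt0 ?mix_gt0.
have h' : 0 < - cy y by rewrite oppr_gt0 lt_neqAle h andbT; apply/eqP.
have := mulr_gt0 h' (mix_gt0 _ h'); rewrite mulrN1 !mulrN mulNr.
by rewrite -[X in _ < X -> _]mulrN opprD opprK.
Qed.

Lemma half_arcs_contracts_to : contracts_to R p half_arcs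
  (fun x => petal (petal_index x) (pole (main_coord x))).
Proof.
apply: (@away_contracts_to [set y | cy y != 0] pole).
- by rewrite /= cy_base eqxx.
- move=> y /= y0; rewrite /pole; have [h|h] := ltP 0 (cy y).
    have : nbhs y [set z | 0 < cy z].
      apply: (@cy_continuous R y [set b | 0 < b]); exact: lt_nbhsr.
    by apply: filterS => z /= zp; rewrite zp gt_eqF.
  have h' : cy y < 0 by rewrite lt_neqAle y0.
  have : nbhs y [set z | cy z < 0].
    apply: (@cy_continuous R y [set b | b < 0]); exact: lt_nbhsl.
  by apply: filterS => z /= zn; rewrite lt_eqF // ltNge (ltW zn).
- by move=> y /pole_not_antipodal.
- move=> y a /= /cy_slide_pole-/(_ a) h; apply/eqP => e.
  by move: h; rewrite e mulr0 ltxx.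
Qed.

Lemma starP x : star x <-> forall k, petal_coord k x != antibase.
Proof.
split=> [sx k|]; last exact.
have [<- //|ne] := eqVneq (petal_index x) k.
by rewrite petal_coord_off // base_neq_antibase.
Qed.

(** The petal index jumps near the base point, so continuity is checked in each coordinate, where
    the flow is the slide towards the base; the slide fixes the base, as the coordinates of the
    other petals require. *)
Lemma star_contracts_to (i0 : 'I_m) : contracts_to R p star (fun=> petal i0 base).
Proof.
have anti y : y != antibase -> ~ antipodal y base.
  by move=> /eqP ya /antipodal_base.
have coordE k x a :
    petal_coord k (flow (fun=> base) x a) = slide (petal_coord k x) base a.
  rewrite /flow petal_coordE; case: eqP => [<- //|/eqP ne].
  by rewrite (petal_coord_off ne) slide_id.
have E x : star x -> petal i0 base = flow (fun=> base) x 1.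
  by move=> sx; rewrite /flow slide1; [exact: petal_base | exact: anti].
have [|||| K [KW Kd K0]] := @contraction_contracts_to R p B star (flow (fun=> base)).
- move=> x a /starP sx; apply: bouquet_continuous_at => k.
  have cs : {for (x, a), continuous (fun q : B * R => slide (petal_coord k q.1) base q.2)}.
    apply: slide_continuous_at; first by apply: anti; exact: sx.
      apply: (@continuous_comp _ _ _ fst (petal_coord k)); first exact: cvg_fst.
      exact: petal_coord_continuous.
    exact: cvg_snd.
  rewrite /prop_for (_ : (fun w => _) =
    (fun q : B * R => slide (petal_coord k q.1) base q.2)); first exact: cs.
  by apply/funext => q; exact: coordE.
- move=> x a /starP sx; apply/starP => k; rewrite coordE; apply/eqP => e.
  apply: (@slide_not_antipodal _ (petal_coord k x) base a); first exact/anti/sx.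
  by rewrite e; exact/antipodal_base.
- by move=> x sx; rewrite /flow slide0 ?petal_indexK //; exact: anti.
- by move=> n s Ws t u; rewrite -!E //; exact: Ws.
exists K; split => // x sx; by rewrite K0 // -E.
Qed.

Lemma star_open : open star.
Proof.
rewrite openE => x /starP sx; rewrite /interior /=.
have nk k : nbhs x [set z | petal_coord k z != antibase].
  exact: (@petal_coord_continuous R m k x _ (circle_neq_nbhs (sx k))).
have := filter_forall (nbhs_filter x) nk.
by apply: filterS => z hz; apply/starP => k; exact: hz.
Qed.

Lemma arcs_open : open arcs.
Proof.
rewrite openE => x ax; rewrite /interior /=.
have := @petal_coord_continuous R m (petal_index x) x _ (circle_neq_nbhs ax).
apply: (@filterS _ (nbhs x)) => z /= zb.
by rewrite /arcs /= /main_coord (petal_coord_neq zb).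
Qed.

End BouquetPieces.

(** * Mayer-Vietoris for the bouquet *)

Section BouquetHomology.
Variables (R : realType) (p m : nat) (i0 : 'I_m).
Hypothesis pr : prime p.
Local Notation circle := (circle R).
Local Notation base := (circle_base R).
Local Notation B := (bouquet R m).
Local Notation chain n := (chain R 'F_p B n).
Local Notation Sd := (Sd R 'F_p B).
Local Notation star := (@star R m).
Local Notation arcs := (@arcs R m).
Local Notation half_arcs := (@half_arcs R m).
Local Notation pt := (@point_class R p B).

Lemma contracts_acyclic (X : topologicalType) (W : set X) kappa n
    (c : Defs.chain R 'F_p X n.+1) : contracts_to R p W kappa ->
  chain_in (simplex_in W) c -> boundary c = 0 ->
  exists2 f, chain_in (simplex_in W) f & boundary f = c.
Proof.
move=> [K [KW Kd _]] Wc dc; exists (K n.+1 c); first exact: KW.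
by rewrite Kd // dc linear0 subr0.
Qed.

Lemma half_arcs_in n (c : chain n) : chain_in (simplex_in star) c ->
  chain_in (simplex_in arcs) c -> chain_in (simplex_in half_arcs) c.
Proof.
move=> sc ac; apply: chain_in_sub (chain_in_and sc ac) => s [h1 h2] t.
by rewrite half_arcsE; split; [exact: h1 | exact: h2].
Qed.

Lemma half_arcs_star n (c : chain n) :
  chain_in (simplex_in half_arcs) c -> chain_in (simplex_in star) c.
Proof.
by apply: chain_in_sub => s h t; have := h t; rewrite half_arcsE => -[].
Qed.

Lemma half_arcs_arcs n (c : chain n) :
  chain_in (simplex_in half_arcs) c -> chain_in (simplex_in arcs) c.
Proof.
by apply: chain_in_sub => s h t; have := h t; rewrite half_arcsE => -[].
Qed.

(** After enough subdivisions every simplex lies in one of the two pieces; those inside [star] form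
    a, and smallness puts the rest inside [arcs]. *)
Lemma bouquet_split n (c : chain n) : exists k a l,
  [/\ chain_in (simplex_in star) a, chain_in (simplex_in arcs) l &
  iter k (Sd n) c = a + l].
Proof.
pose U (b : bool) := if b then star else arcs.
have [b|x|k hk] := @small_subdivision R 'F_p B bool U n c.
- by case: b; [exact: star_open | exact: arcs_open].
- have [e|ne] := eqVneq (main_coord x) (antibase R); last by exists true.
  by exists false; rewrite /U /arcs /= e eq_sym base_neq_antibase.
pose sel : {linear chain n -> chain n} := [the {linear _ -> _} of
  lext (fun s => if `[< simplex_in star s >] then << s >> : chain n else 0)].
have selE s : sel << s >> = if `[< simplex_in star s >] then << s >> else 0.
  exact: lext_simplex.
exists k, (sel (iter k (Sd n) c)), (iter k (Sd n) c - sel (iter k (Sd n) c)); split.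
- apply: (chain_in_linear (P := fun=> True)) => // s _; rewrite selE.
  case: asboolP => [h|_]; [exact: chain_in_simplex | exact: chain_in0].
- pose f : {linear chain n -> chain n} := GRing.sub_fun
    [the {linear chain n -> chain n} of idfun] sel.
  apply: (chain_in_linear (f := f) _ (hk k (leqnn k))) => s [b Us].
  have -> : f << s >> = << s >> - sel << s >> by [].
  rewrite selE; case: asboolP => [_|ns]; first by rewrite subrr; exact: chain_in0.
  rewrite subr0; apply: chain_in_simplex.
  by case: b Us => Us; [case: (ns Us) | exact: Us].
- by rewrite addrC subrK.
Qed.

Lemma bouquet_homologous_split n (z : chain n.+1) : boundary z = 0 ->
  exists h a l, [/\ chain_in (simplex_in star) a, chain_in (simplex_in arcs) l &
  boundary h = z - (a + l)] /\ boundary a = - boundary l.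
Proof.
move=> dz; have [k [a [l [sa al E]]]] := bouquet_split z.
have da : boundary a = - boundary l.
  apply/eqP; rewrite -addr_eq0 -boundaryD -E boundary_iter_Sd dz.
  by apply/eqP; elim: k {E} => //= k ->; rewrite linear0.
suff [h dh] : exists h, boundary h = z - iter k (Sd n.+1) z.
  by exists h, a, l; rewrite -E.
elim: k {E} => [|k [h dh]]; first by exists 0; rewrite boundary0 subrr.
exists (h + Sdh R 'F_p B n.+1 (iter k (Sd n.+1) z)).
by rewrite boundaryD dh boundary_Sdh_iter // addrA subrK.
Qed.

(** The chain f in the overlap corrects both parts to cycles a - f and l + f of contractible pieces;
    fillings of these add up to one of a + l. *)
Lemma glue_acyclic n (a l : chain n.+1) f :
  chain_in (simplex_in star) a -> chain_in (simplex_in arcs) l ->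
  chain_in (simplex_in half_arcs) f -> boundary a = - boundary l ->
  boundary f = boundary a -> exists g, boundary g = a + l.
Proof.
move=> sa al hf dal df.
have [||g1 _ dg1] := @contracts_acyclic B star _ n (a - f) (star_contracts_to R p i0).
- by apply: chain_inB => //; exact: half_arcs_star.
- by rewrite boundaryB df subrr.
have [||g2 _ dg2] := @contracts_acyclic B arcs _ n (l + f) (arcs_contracts_to R p m).
- by apply: chain_inD => //; exact: half_arcs_arcs.
- by rewrite boundaryD df dal subrr.
by exists (g1 + g2); rewrite boundaryD dg1 dg2 addrACA addNr addr0.
Qed.

Lemma bouquet_acyclic n : acyclic_at (@bd R p B) (@fullc R p B) n.+1.
Proof.
move=> z _ dz; rewrite /bd /= in dz.
have [h [a [l [[sa al dh] dal]]]] := bouquet_homologous_split dz.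
have ha : chain_in (simplex_in half_arcs) (boundary a).
  apply: half_arcs_in; first exact: boundary_in.
  by rewrite dal; apply: chain_inN; exact: boundary_in.
have [f hf df] := contracts_acyclic (half_arcs_contracts_to R p m) ha
  (boundary_boundary a).
have [g dg] := glue_acyclic sa al hf dal df.
by exists (h + g) => //; rewrite /bd /= boundaryD dh dg subrK.
Qed.

Local Notation "x ~~> y" := (exists c : chain 1, boundary c = pt x - pt y)
  (at level 70).

Lemma contracts_connected W kappa x : contracts_to R p W kappa -> W x -> x ~~> kappa x.
Proof. by move=> [K [_ _ K0]] Wx; exists (K 0 (pt x)); exact: K0. Qed.

Definition pole_point (b : bool) (k : 'I_m) : B :=
  petal k (if b then north R else south R).

Lemma cy_pole_point b k : cy (main_coord (pole_point b k)) = if b then 1 else -1.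
Proof. by rewrite main_coord_petal; case: b; [exact: cy_north | exact: cy_south]. Qed.

Lemma pole_point_half b k : half_arcs (pole_point b k).
Proof. by rewrite /half_arcs /= cy_pole_point; case: b; rewrite ?oner_eq0 // oppr_eq0 oner_eq0. Qed.

Lemma pole_point_star b k : star (pole_point b k).
Proof. by have := pole_point_half b k; rewrite half_arcsE => -[]. Qed.

Lemma pole_point_arcs b k : arcs (pole_point b k).
Proof. by have := pole_point_half b k; rewrite half_arcsE => -[]. Qed.

Lemma petal_index_pole b k : petal_index (pole_point b k) = k.
Proof.
apply: petal_index_petal; have := pole_point_arcs b k.
by rewrite /arcs /= main_coord_petal.
Qed.

Lemma bouquet_connected : chain_connected R p B.
Proof.
suff h x : x ~~> petal i0 base.
  move=> x y; apply: chain_connected_trans (h x) _.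
  by apply: chain_connected_sym; exact: h.
have hstar y : star y -> y ~~> petal i0 base.
  by move=> sy; exact: (contracts_connected (star_contracts_to R p i0)).
have [e|ne] := eqVneq (main_coord x) (antibase R); last exact: hstar.
have ax : arcs x by rewrite /arcs /= e eq_sym base_neq_antibase.
have h1 := contracts_connected (arcs_contracts_to R p m) ax.
have h2 := contracts_connected (arcs_contracts_to R p m)
  (pole_point_arcs true (petal_index x)).
rewrite /= petal_index_pole in h2.
apply: chain_connected_trans h1 _.
apply: chain_connected_trans (chain_connected_sym h2) _.
by apply: hstar; exact: pole_point_star.
Qed.

Definition count (Q : B -> bool) : {linear chain 0 -> ('F_p)^o} :=
  [the {linear _ -> _} of
    lext (fun s : singular_simplex R B 0 => (Q (s (vertex R 0)))%:R : ('F_p)^o)].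

Lemma count_simplex Q s : count Q << s >> = (Q (s (vertex R 0)))%:R.
Proof. exact: lext_simplex. Qed.

Lemma count_point Q x : count Q (pt x) = (Q x)%:R.
Proof. exact: count_simplex. Qed.

(** Q is constant along each 1-simplex in W, so the two end points count equally and cancel. *)
Lemma count_boundary Q (W : set B) (c : chain 1) : chain_in (simplex_in W) c ->
  (forall x, W x -> \forall y \near x, Q y = Q x) -> count Q (boundary c) = 0.
Proof.
move=> Wc near_Q; pose f : {linear chain 1 -> ('F_p)^o} :=
  count Q \o [the {linear _ -> _} of @boundary R 'F_p B 0].
apply: (linear_eq0_in (f := f) _ Wc) => s Ws.
have -> : f << s >> = count Q (boundary << s >>) by [].
rewrite boundary_simplex !big_ord_recl big_ord0 addr0 linearP linearZZ.
rewrite !count_simplex expr0 expr1 scale1r scaleN1r.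
have Qc : forall t u, Q (s t) = Q (s u).
  apply: (simplex_locally_constant (f := fun t => Q (s t))) => t.
  exact: (@cts_fun _ _ s t _ (near_Q _ (Ws t))).
by rewrite /= (Qc (coface ord0 _) (coface (fintype.lift ord0 ord0) (vertex R 0))) subrr.
Qed.

Let north_of k (x : B) := 0 < cy (petal_coord k x).
Let south_of k (x : B) := cy (petal_coord k x) < 0.
Let petal_of k (x : B) := petal_coord k x != base.

Lemma petal_of_near k x : arcs x -> \forall y \near x, petal_of k y = petal_of k x.
Proof.
move=> ax; have := @petal_coord_continuous R m (petal_index x) x _ (circle_neq_nbhs ax).
apply: (@filterS _ (nbhs x)) => z /= zb; rewrite /petal_of.
have ex : (petal_coord k x != base) = (petal_index x == k).
  apply/idP/eqP => [/petal_coord_neq //|<-]; exact: ax.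
have ez : petal_index z = petal_index x by exact: petal_coord_neq.
rewrite ex -ez; apply/idP/eqP => [/petal_coord_neq //|<-].
by rewrite ez.
Qed.

Lemma north_of_near k x : half_arcs x -> \forall y \near x, north_of k y = north_of k x.
Proof.
move=> hx; have ax : arcs x by move: hx; rewrite half_arcsE => -[].
have cc : {for x, continuous (fun z => cy (petal_coord k z))}.
  by apply: (@continuous_comp _ _ _ (petal_coord k) (@cy R));
    [exact: petal_coord_continuous | exact: cy_continuous].
rewrite /north_of; have [h|h] := ltP 0 (cy (petal_coord k x)).
  by apply: (cc [set b | (0 < b) = true]); exact: lt_nbhsr.
have [kx|nk] := boolP (petal_of k x).
  have kE : petal_index x = k by exact: petal_coord_neq.
  have h' : cy (petal_coord k x) < 0.
    by rewrite lt_neqAle h andbT -kE; exact: hx.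
  have := cc [set b | b < 0] (lt_nbhsl h').
  by apply: (@filterS _ (nbhs x)) => z /= zn; apply/negbTE; rewrite -leNgt ltW.
have := petal_of_near k ax; apply: (@filterS _ (nbhs x)) => z zk.
move: nk; rewrite -zk /petal_of negbK => /eqP ->.
by rewrite cy_base ltxx.
Qed.

Lemma north_of_pole k j b : north_of k (pole_point b j) = b && (j == k).
Proof.
rewrite /north_of petal_coordE; case: eqP => _; last by rewrite cy_base ltxx andbF.
by rewrite andbT; case: b; rewrite ?cy_north ?cy_south ?ltr01 //; apply/negbTE; rewrite -leNgt; lra.
Qed.

Lemma south_of_pole k j b : south_of k (pole_point b j) = ~~ b && (j == k).
Proof.
rewrite /south_of petal_coordE; case: eqP => _; last by rewrite cy_base ltxx andbF.
by rewrite andbT; case: b; rewrite ?cy_north ?cy_south ?ltrN10 //; apply/negbTE; rewrite -leNgt ler01.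
Qed.

Lemma petal_of_half k x : half_arcs x ->
  (petal_of k x)%:R = (north_of k x)%:R + (south_of k x)%:R :> 'F_p.
Proof.
move=> hx; have ax : arcs x by move: hx; rewrite half_arcsE => -[].
rewrite /petal_of /north_of /south_of.
have [ik|ik] := eqVneq (petal_index x) k; last first.
  by rewrite (petal_coord_off ik) eqxx cy_base ltxx addr0.
have -> : petal_coord k x != base by rewrite -ik; exact: ax.
have c0 : cy (petal_coord k x) != 0 by rewrite -ik; exact: hx.
have [h|h|h] := ltgtP (cy (petal_coord k x)) 0; rewrite ?addr0 ?add0r //.
by rewrite h eqxx in c0.
Qed.

(** The contraction takes each point to the pole of its half circle, so the north and south counts
    determine a 0-chain of the overlap up to boundaries. *)
Lemma half_arcs_0chain (e : chain 0) : chain_in (simplex_in half_arcs) e ->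
  exists2 f, chain_in (simplex_in half_arcs) f &
  boundary f = e - \sum_(k < m) (count (north_of k) e *: pt (pole_point true k)
    + count (south_of k) e *: pt (pole_point false k)).
Proof.
move=> he; have [K [KW _ K0]] := half_arcs_contracts_to R p m.
exists (K 0 e); first exact: KW.
pose T (c : chain 0) : chain 0 := \sum_(k < m)
  (count (north_of k) c *: pt (pole_point true k) +
   count (south_of k) c *: pt (pole_point false k)).
have Tlin : linear T.
  move=> a c d; rewrite /T scaler_sumr -big_split; apply: eq_bigr => k _.
  have countP Q : count Q (a *: c + d) = a * count Q c + count Q d by rewrite linearP.
  by rewrite !countP scalerDr !scalerDl !scalerA addrACA.
pose Tl : {linear chain 0 -> chain 0} :=
  HB.pack T (GRing.isLinear.Build _ _ _ _ T Tlin).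
pose f : {linear chain 0 -> chain 0} :=
  [the {linear _ -> _} of @boundary R 'F_p B 0] \o K 0.
pose g : {linear chain 0 -> chain 0} :=
  GRing.sub_fun [the {linear chain 0 -> chain 0} of idfun] Tl.
apply: (linear_eq_in (f := f) (g := g) _ he) => s hs; rewrite (simplex0E s).
set x := s _; have hx : half_arcs x by exact: hs.
have -> : f (pt x) = boundary (K 0 (pt x)) by [].
have -> : g (pt x) = pt x - T (pt x) by [].
rewrite K0 //; congr (_ - _); rewrite /T (bigD1 (petal_index x)) //= big1 ?addr0 => [|k ki].
  rewrite !count_point /north_of /south_of -/(main_coord x) /pole /pole_point.
  have [h|h|h] := ltgtP 0 (cy (main_coord x)).
  - by rewrite scale1r scale0r addr0.
  - by rewrite scale0r scale1r add0r.
  - by move: hx; rewrite /half_arcs /= -h eqxx.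
have ik : petal_index x != k by rewrite eq_sym.
rewrite !count_point /north_of /south_of (petal_coord_off ik) cy_base ltxx.
by rewrite !scale0r addr0.
Qed.

Lemma contracts_edge W kappa x y : contracts_to R p W kappa -> W x -> W y ->
  kappa x = kappa y ->
  exists a : chain 1, chain_in (simplex_in W) a /\ boundary a = pt x - pt y.
Proof.
move=> [K [KW _ K0]] Wx Wy kxy; exists (K 0 (pt x - pt y)); split.
  by apply: KW; apply: chain_inB; apply: chain_in_simplex.
by rewrite linearB boundaryB !K0 // kxy opprB addrA subrK.
Qed.

Lemma boundary_combination n (v : 'I_m -> 'F_p) (c : 'I_m -> chain n.+1) :
  boundary (\sum_k v k *: c k) = \sum_k v k *: boundary (c k).
Proof.
rewrite (raddf_sum (@boundary R 'F_p B n)); apply: eq_bigr => k _.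
exact: (linearZ_LR (@boundary R 'F_p B n)).
Qed.

(** The k-th basis class is the difference of two chains joining the poles of petal k, one in [star]
    and one in [arcs]. Its coefficients are recovered by the Mayer-Vietoris connecting map followed
    by the north counts. *)
Lemma bouquet_homology1 :
  exists f : {additive 'rV['F_p]_m -> homology R 'F_p B 1}, bijective f.
Proof.
have /choice[ea hea] (k : 'I_m) : exists a : chain 1, chain_in (simplex_in star) a /\
    boundary a = pt (pole_point true k) - pt (pole_point false k).
  apply: (contracts_edge (star_contracts_to R p i0)) => //; exact: pole_point_star.
have /choice[el hel] (k : 'I_m) : exists a : chain 1, chain_in (simplex_in arcs) a /\
    boundary a = pt (pole_point true k) - pt (pole_point false k).
  apply: (contracts_edge (arcs_contracts_to R p m)); try exact: pole_point_arcs.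
  by rewrite /= !petal_index_pole.
pose sa (v : 'rV['F_p]_m) : chain 1 := \sum_k v 0 k *: ea k.
pose sl (v : 'rV['F_p]_m) : chain 1 := \sum_k v 0 k *: el k.
have sa_in v : chain_in (simplex_in star) (sa v).
  by apply: chain_in_sum => k _; apply: chain_inZ; have [] := hea k.
have sl_in v : chain_in (simplex_in arcs) (sl v).
  by apply: chain_in_sum => k _; apply: chain_inZ; have [] := hel k.
have dsa v : boundary (sa v) =
    \sum_k v 0 k *: (pt (pole_point true k) - pt (pole_point false k)).
  by rewrite boundary_combination; apply: eq_bigr => k _; rewrite (hea k).2.
have dsl v : boundary (sl v) = boundary (sa v).
  by rewrite dsa boundary_combination; apply: eq_bigr => k _; rewrite (hel k).2.
have count_sa v k : count (north_of k) (boundary (sa v)) = v 0 k.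
  rewrite dsa linear_sum (bigD1 k) //= big1 ?addr0 => [|j jk].
    by rewrite linearZZ linearB /= !count_point !north_of_pole eqxx subr0 [LHS]mulr1.
  by rewrite linearZZ linearB /= !count_point !north_of_pole (negbTE jk) subr0 [LHS]mulr0.
have count_sa' v k : count (south_of k) (boundary (sa v)) = - v 0 k.
  rewrite dsa linear_sum (bigD1 k) //= big1 ?addr0 => [|j jk].
    by rewrite linearZZ linearB /= !count_point !south_of_pole eqxx sub0r
      scalerN; congr (- _); exact: mulr1.
  by rewrite linearZZ linearB /= !count_point !south_of_pole (negbTE jk) subr0 [LHS]mulr0.
have dg v : boundary (sa v - sl v) = 0 by rewrite boundaryB dsl subrr.
have /choice[gam hgam] v := cycle_exists (dg v).
pose f v : homology R 'F_p B 1 := hclass (gam v).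
have fB : zmod_morphism f.
  move=> u v; rewrite /f -hclassB; congr hclass; apply/val_inj.
  transitivity ((gam u : chain 1) - (gam v : chain 1)); last by exact/esym/(raddfB val).
  rewrite [LHS]hgam !hgam /sa /sl -!sumrB; apply: eq_bigr => k _.
  by rewrite !mxE -!scalerBr scalerBl.
pose fa : {additive 'rV['F_p]_m -> homology R 'F_p B 1} :=
  HB.pack f (GRing.isZmodMorphism.Build _ _ f fB).
exists fa.
have finj : injective fa.
  apply: (@raddf_inj _ _ fa) => v fv0; have : hclass (gam v) = hclass 0.
    by rewrite hclass0; exact: fv0.
  move=> /hclass_eq [d dd]; rewrite hgam /= subr0 in dd.
  have [k [da [dl [da_in dl_in E]]]] := bouquet_split d.
  (* Splitting d shows one and the same chain as lying in [star] (left side) and in [arcs] (right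
     side). It therefore lies in the overlap, where the north counts of its boundary, which are the
     entries of v, vanish. *)
  have split_eq : iter k (Sd 1) (sa v) - boundary da = boundary dl + iter k (Sd 1) (sl v).
    have := congr1 (fun c => boundary c) E; rewrite boundary_iter_Sd dd boundaryD.
    have -> : iter k (Sd 1) (sa v - sl v) = iter k (Sd 1) (sa v) - iter k (Sd 1) (sl v).
      by elim: k {E} => //= k ->; rewrite linearB.
    by move=> /eqP; rewrite subr_eq => /eqP ->; rewrite -(addrA (boundary da)) [LHS]addrAC subrr add0r.
  have e_in : chain_in (simplex_in half_arcs) (iter k (Sd 1) (sa v) - boundary da).
    apply: half_arcs_in.
      by apply: chain_inB; [exact: iter_Sd_in | exact: boundary_in].
    rewrite split_eq; apply: chain_inD; first exact: boundary_in.
    exact: iter_Sd_in (sl_in v).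
  apply/rowP => j; rewrite mxE -count_sa.
  have := count_boundary (Q := north_of j) e_in (@north_of_near j).
  rewrite boundaryB boundary_boundary subr0 boundary_iter_Sd.
  suff -> : iter k (Sd 0) (boundary (sa v)) = boundary (sa v) by [].
  by elim: (k) => //= k' ->; rewrite Sd0.
suff fsurj h : exists v, fa v = h.
  by have [g gK] := choice fsurj; exists g => // v; apply: finj; exact: gK.
have [z <-] := hclass_surj h.
have [h1 [a [l [[a_in l_in dh1] dal]]]] := bouquet_homologous_split (cycle_boundary z).
have e_in : chain_in (simplex_in half_arcs) (boundary a).
  apply: half_arcs_in; first exact: boundary_in.
  by rewrite dal; apply: chain_inN; exact: boundary_in.
pose v : 'rV['F_p]_m := \row_k count (north_of k) (boundary a).
(* On the overlap the north and south counts add up to the count of petal k, which is locally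
   constant on all of [arcs]; as d a = - d l with l in [arcs], the total is zero. *)
have south_v k : count (south_of k) (boundary a) = - v 0 k.
  rewrite mxE; apply/eqP; rewrite -addr_eq0 addrC; apply/eqP.
  pose cs : {linear chain 0 -> ('F_p)^o} := GRing.add_fun
    (count (north_of k)) (count (south_of k)).
  have <- : cs (boundary a) = count (north_of k) (boundary a) +
    count (south_of k) (boundary a) by [].
  rewrite -[RHS]oppr0 -(count_boundary (Q := petal_of k) l_in) => [|x]; last first.
    exact: petal_of_near.
  rewrite -raddfN -dal; apply: (linear_eq_in (f := cs) (g := count (petal_of k)) _ e_in).
  move=> s hs; have -> : cs << s >> = count (north_of k) << s >> +
    count (south_of k) << s >> by [].
  by rewrite !count_simplex petal_of_half //; exact: hs.
exists v; apply/hclass_eq; rewrite hgam.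
have [f1 f1_in df1] := half_arcs_0chain e_in.
have df1' : boundary f1 = boundary a - boundary (sa v).
  rewrite df1 dsa; congr (_ - _); apply: eq_bigr => k _.
  by rewrite south_v scaleNr scalerBr mxE.
(* The candidate cycle [sa v - sl v] is subtracted from a + l. The boundary of what remains in
   [star] bounds f1 in the overlap, so the remainder is a boundary. *)
have [|||||g dgl] := @glue_acyclic 0 (a - sa v) (l + sl v) f1.
- exact: chain_inB a_in (sa_in v).
- exact: chain_inD l_in (sl_in v).
- exact: f1_in.
- by rewrite boundaryB boundaryD dsl dal opprD.
- by rewrite boundaryB.
exists (- (h1 + g)); rewrite boundaryN boundaryD dh1 dgl.
have sum_eq (V : zmodType) (t u w x y : V) :
    - (t - (u + w) + (u - x + (w + y))) = x - y - t.
  by rewrite (addrACA u) [X in - X]addrA subrK opprD opprD !opprK addrC.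
exact: sum_eq.
Qed.

End BouquetHomology.

(** * Finite complexes *)

Section FiniteComplex.
Variables (R : realType) (X : topologicalType) (I : finType) (C : cw_complex R X I).
Hypothesis cX : connected [set: X].
Variable p : nat.
Local Notation disk i := (closed_disk R (cell_dim C i)).
Local Notation closed_cell i := (char_map C i @` disk i).
Local Notation chain n := (chain R 'F_p X n).
Local Notation pt := (@point_class R p X).
Local Notation "x ~~> y" := (exists c : chain 1, boundary c = pt x - pt y)
  (at level 70).

Lemma sqnorm_continuous n : continuous (@sqnorm R n).
Proof.
move=> x; apply: sum_continuous_at => j.
rewrite /prop_for (_ : (fun _ => _) = (fun w : 'rV[R]_n => w 0 j) \* (fun w => w 0 j)); last first.
  by apply/funext => w; rewrite expr2.
by apply: continuousM; exact: coord_continuous.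
Qed.

Lemma compact_closed_disk n : compact (closed_disk R n).
Proof.
apply: bounded_closed_compact; last first.
  apply: (@closed_comp _ _ (@sqnorm R n) [set y | y <= 1]); last exact: closed_le.
  by move=> x _; exact: sqnorm_continuous.
exists 1; split => // M M1 x x1 /=.
rewrite [`|x|]mx_normrE; apply: bigmax_le => //; first by lra.
move=> [i j] _ /=; rewrite (ord1 i); apply: le_trans (ltW M1).
rewrite -(@expr_le1 _ 2) // real_normK ?num_real //; apply: le_trans x1.
rewrite /sqnorm (bigD1 j) //= lerDl; apply: sumr_ge0 => k _; exact: sqr_ge0.
Qed.

Lemma closed_cell_compact i : compact (closed_cell i).
Proof.
apply: continuous_compact; [exact: cw_continuous | exact: compact_closed_disk].
Qed.

Lemma closed_cell_cover x : exists i, closed_cell i x.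
Proof.
have : [set: X] x by []; rewrite -(cw_cover _ _ _ C) => -[i _ [u u1 <-]].
by exists i, u => //; exact: ltW.
Qed.

Lemma finite_complex_compact : compact [set: X].
Proof.
have -> : [set: X] = \big[setU/set0]_(i in I) closed_cell i.
  apply/seteqP; split => // x _; have [i ix] := closed_cell_cover x.
  by rewrite (bigD1 i) //=; left.
by apply: bigsetU_compact => i _; exact: closed_cell_compact.
Qed.

(** The image of the radius from the centre of the disk to a preimage of x is a singular
    1-simplex. *)
Lemma closed_cell_connected i x : closed_cell i x -> x ~~> char_map C i 0.
Proof.
move=> [u u1 <-].
have D0 a : 0 <= a <= 1 -> disk i (a *: u).
  move=> /andP[a0 a1]; rewrite /closed_disk /= /sqnorm.
  under eq_bigr do rewrite mxE exprMn.
  rewrite -mulr_sumr; apply: mulr_ile1 => //; first exact: exprn_ge0.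
    by apply: sumr_ge0 => k _; exact: sqr_ge0.
  exact: exprn_ile1.
pose w (t : @std_simplex R 1) := set_val t 0 0 *: u.
have cg : continuous (fun t : @std_simplex R 1 => char_map C i (w t)).
  move=> t A nA.
  have Dw s : disk i (w s) by apply: D0; rewrite simplex_ge0 simplex_le1.
  have := (subspace_continuousP _ _).1 (@cw_continuous _ _ _ C i) (w t) (Dw t) A nA.
  have cw : {for t, continuous w}.
    apply: rV_continuous_at => j.
    rewrite /prop_for (_ : (fun s => _) = (fun t : @std_simplex R 1 => set_val t 0 0) \* cst (u 0 j)).
      by apply: continuousM; [exact: coord_simplex_continuous | exact: cst_continuous].
    by apply/funext => s; rewrite mxE.
  move=> /(cw _); apply: (@filterS _ (nbhs t)) => s; apply; exact: Dw.
apply: chain_connected_sym.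
exists << ctsmap cg >>; rewrite boundary_simplex !big_ord_recl big_ord0 addr0.
rewrite expr0 expr1 scale1r scaleN1r; congr (<< _ >> - << _ >>);
  apply: (point_simplex_eq (t := vertex R 0)).
  have -> : face ord0 (ctsmap cg) (vertex R 0) =
    char_map C i (w (coface ord0 (vertex R 0))) by [].
  by rewrite /w coface0_0 scale0r.
set k := fintype.lift _ _.
have -> : face k (ctsmap cg) (vertex R 0) =
  char_map C i (w (coface k (vertex R 0))) by [].
by rewrite /w coface_lift_0 mxE eqxx scale1r.
Qed.

(** A closed cell lies wholly inside or wholly outside the class S of x. Both S and its complement
    are finite unions of closed cells, compact and hence closed, so S is open and closed. *)
Lemma finite_complex_chain_connected : chain_connected R p X.
Proof.
move=> y x; pose S : set X := [set z | z ~~> x].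
have closed_cells (Q : set I) : closed (\bigcup_(i in Q) closed_cell i).
  apply: closed_bigcup => [|i _]; first exact: finite_finset.
  by apply: compact_closed (@closed_cell_compact i); exact: cw_hausdorff C.
pose Q : set I := [set i | char_map C i 0 ~~> x].
have SQ i z : closed_cell i z -> S z <-> Q i.
  move=> /closed_cell_connected iz; split => h; apply: chain_connected_trans h.
    exact: chain_connected_sym.
  exact: iz.
have SE : S = \bigcup_(i in Q) closed_cell i.
  apply/seteqP; split => z; last by move=> [i Qi iz]; apply/(SQ i).
  by move=> Sz; have [i iz] := closed_cell_cover z; exists i => //; apply/(SQ i z).
have SCE : ~` S = \bigcup_(i in ~` Q) closed_cell i.
  apply/seteqP; split => z; last by move=> [i Qi iz] /(SQ i z iz).
  by move=> Sz; have [i iz] := closed_cell_cover z; exists i => // /(SQ i z iz).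
have ES : S = [set: X].
  apply: cX; first by exists x; exists 0; rewrite boundary0 subrr.
  - exists S; last by rewrite setTI.
    by rewrite -[S]setCK SCE; apply: closed_openC.
  - by exists S; [rewrite SE | rewrite setTI].
by have : S y by rewrite ES.
Qed.

End FiniteComplex.

Lemma chain_connected_push (R : realType) p (X Y : topologicalType)
    (f : continuousType X Y) : (forall y, exists x, f x = y) ->
  chain_connected R p X -> chain_connected R p Y.
Proof.
move=> fsurj cX y y'; have [x <-] := fsurj y; have [x' <-] := fsurj y'.
have [c dc] := cX x x'; exists (push f c).
have fpt z : push f (point_class R p z) = point_class R p (f z).
  by rewrite push_simplex; congr << _ >>; exact: (point_simplex_eq (t := vertex R 0)).
by rewrite boundary_push dc linearB /= !fpt.
Qed.

(** * Homological criterion for roses *)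

Section RoseCriterion.
Variables (R : realType) (p : nat).
Hypothesis pr : prime p.

Lemma trivial_additive_bij (U V : zmodType) :
  (forall u : U, u = 0) -> (forall v : V, v = 0) ->
  exists f : {additive U -> V}, bijective f.
Proof.
move=> U0 V0; exists [the {additive U -> V} of \0]; exists (fun=> 0) => [u|v].
  exact/esym/U0.
exact/esym/V0.
Qed.

(** Finiteness of H_1 turns into H_1 = F_p^d because p kills it, and nonvanishing gives d > 0; the
    bouquet with d petals is then the model to compare with. *)
Lemma homology_roseP (Y : topologicalType) (y0 : Y) : chain_connected R p Y ->
  homology_rose R p Y <-> rose_homology (@bd R p Y) (@fullc R p Y).
Proof.
move=> cY; split=> [[m [m0 hm]]|[[c /homology_card_le_homology[T [f [_ finj]]]] nac ac]].
  pose i0 := Ordinal m0; have [f bf] := hm 1%N.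
  have [g /bij_additive_inv[h bh]] := bouquet_homology1 R p i0.
  have [k bk] := bij_additive_comp bf bh.
  split.
  - exists #|{: 'rV['F_p]_m}|; apply/homology_card_le_homology.
    by exists 'rV['F_p]_m, k; split => //; exact: bij_inj.
  - move=> /acyclic_homology H0; have [k' _ kK] := bk.
    (* Since m > 0, the vector with all entries 1 is nonzero, so F_p^m is not trivial. *)
    have : k (k' (const_mx 1)) 0 i0 = 0 by rewrite (H0 (k' _)) raddf0 mxE.
    by rewrite kK mxE => /eqP; rewrite oner_eq0.
  - case=> // n _; apply/acyclic_homology => x; have [fn bfn] := hm n.+2.
    apply: (bij_inj bfn); rewrite raddf0.
    exact: (acyclic_homology _ _ _ _).1 (bouquet_acyclic i0 (n := n)) _.
have [d [g bg]] := elementary_abelian_finite pr (@homology_torsion R p Y pr 1) finj.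
have d0 : (0 < d)%N.
  rewrite lt0n; apply/eqP => d0; apply: nac; apply/acyclic_homology => x.
  have [g' _ gK] := bg; rewrite -(gK x) (_ : g' x = 0) ?raddf0 //.
  by apply/rowP => j; have := ltn_ord j; rewrite {2}d0 ltn0.
pose i0 := Ordinal d0; exists d; split => // -[|[|n]].
- have [a ba] := homology0_connected y0 cY.
  have [b /bij_additive_inv[b' bb']] :=
    homology0_connected (petal i0 (circle_base R)) (bouquet_connected p i0).
  exact: bij_additive_comp ba bb'.
- have [b bb] := bouquet_homology1 R p i0.
  have [g' bg'] := bij_additive_inv bg.
  exact: bij_additive_comp bg' bb.
- apply: trivial_additive_bij; apply/acyclic_homology; first exact: ac.
  exact: bouquet_acyclic.
Qed.

End RoseCriterion.

Theorem theorem1p1 (R : realType) (p r : nat) (X : topologicalType) (I : finType)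
  (C : cw_complex R X I) (to : {action 'rV['F_p]_r &-> X}) :
  prime p ->
  [set: X] !=set0 -> connected [set: X] ->
  acts_cellularly to C -> acts_freely to ->
  homology_rose R p (orbit_space to) <-> homology_rose R p X.
Proof.
move=> pr [x0 _] cX [tocont _] tofree; have hX := cw_hausdorff _ _ _ C.
have kX := finite_complex_compact C.
have ccX := finite_complex_chain_connected C cX p.
have ccY : chain_connected R p (orbit_space to).
  apply: (chain_connected_push (f := orbit_proj to)) ccX => y.
  by exists (orbit_repr y); exact: orbit_reprK.
apply: (iff_trans (homology_roseP pr (orbit_map to x0) ccY)).
apply: (iff_trans (rose_homology_orbit R tocont tofree hX)).
apply: (iff_trans (rose_homology_invariants tocont tofree R pr hX kX)).
have h := homology_roseP pr x0 ccX.
by split => /h.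
Qed.
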